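(* Let $(M,\omega)$ be a symplectic manifold of dimension $2n$, not necessarily compact, and let $1\le r\le n$. Then the following sequence is exact: $$0\to H_d^{2r-1}\xrightarrow{\Pi^{r-1}}F^{r-1}H_+^{2r-1}\xrightarrow{L^{-r}d}H_d^0\xrightarrow{L^r}H_d^{2r}\xrightarrow{\Pi^{r-1}}F^{r-1}H_+^{2r}\xrightarrow{L^{-r}d}H_d^1\xrightarrow{L^r}\cdots$$ $$\cdots\to H_d^{n-r-1}\xrightarrow{L^r}H_d^{n+r-1}\xrightarrow{\Pi^{r-1}}F^{r-1}H_+^{n+r-1}\xrightarrow{L^{-r}d}H_d^{n-r}\xrightarrow{L^r}H_d^{n+r}\xrightarrow{\Pi^{r-1}*_r d\,L^{-r}}F^{r-1}H_-^{n+r-1}\xrightarrow{*_r}H_d^{n-r+1}$$ $$\xrightarrow{L^r}H_d^{n+r+1}\xrightarrow{\Pi^{r-1}*_r d\,L^{-r}}F^{r-1}H_-^{n+r-2}\xrightarrow{*_r}H_d^{n-r+2}\xrightarrow{L^r}\cdots\to H_d^{2n-2r}\xrightarrow{L^r}H_d^{2n}\xrightarrow{\Pi^{r-1}*_r d\,L^{-r}}F^{r-1}H_-^{2r-1}\xrightarrow{*_r}H_d^{2n-2r+1}\to 0 .$$ That is, it consists of the segments $H_d^{k-2r}\xrightarrow{L^r}H_d^k\xrightarrow{\Pi^{r-1}}F^{r-1}H_+^k\xrightarrow{L^{-r}d}H_d^{k-2r+1}$ for $2r-1\le k\le n+r-1$ (with $H_d^{-1}=0$), followed by the segments $H_d^{k-2r}\xrightarrow{L^r}H_d^k\xrightarrow{\Pi^{r-1}*_r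 d L^{-r}}F^{r-1}H_-^{2n+2r-1-k}\xrightarrow{*_r}H_d^{k-2r+1}$ for $n+r\le k\le 2n$, ending in $0$.
   Context: $H_d^k=H_d^k(M)$ is de Rham cohomology. $\Omega^k$ denotes the smooth real $k$-forms on $M$ (zero for $k<0$ or $k>2n$), and $L(A)=\omega\wedge A$. For $0\le s\le n$, $\mathcal P^s=\{B\in\Omega^s: L^{n+1-s}B=0\}$ is the space of primitive $s$-forms; set $\mathcal P^s=0$ for other $s$. Every $A_k\in\Omega^k$ has a unique Lefschetz decomposition $A_k=\sum_{\max(0,k-n)\le j\le\lfloor k/2\rfloor}L^jB_{k-2j}$ with $B_{k-2j}\in\mathcal P^{k-2j}$. Reflection: $*_r$ (here the subscript $r$ is part of the symbol, unrelated to the integer $r$ of the claim) is the linear operator with $*_r(L^jB_s)=L^{n-j-s}B_s$ for $B_s\in\mathcal P^s$, $0\le j\le n-s$. Negative powers: for $q>0$, $L^{-q}A_k=\sum_{j\ge q}L^{j-q}B_{k-2j}$. Projection: $\Pi^p A_k=\sum_{j\le p}L^jB_{k-2j}$. Filtered forms: $F^p\Omega^k=\Pi^p\Omega^k$, $0\le p\le n$ (nonzero only for $0\le k\le n+p$; $F^p\Omega^{n+p}=L^p\mathcal P^{n-p}$). Operators $\partial_\pm$: for $B_s\in\mathcal P^s$ write uniquely $dB_s=\partial_+B_s+\omega\wedge\partial_-B_s$ with $\partial_\pm B_s\in\mathcal P^{s\pm1}$, and set $\partial_\pm(L^jB_s)=L^j\partial_\pm B_s$. Operators $d_\pm$: $d_+=\Pi^p\circ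 d:F^p\Omega^k\to F^p\Omega^{k+1}$ and $d_-=*_r\,d\,*_r:F^p\Omega^k\to F^p\Omega^{k-1}$. Filtered cohomologies: for $0\le k\le n+p-1$, $$F^pH_+^k=\frac{\ker d_+\cap F^p\Omega^k}{d_+(F^p\Omega^{k-1})},\qquad F^pH_-^k=\frac{\ker d_-\cap F^p\Omega^k}{d_-(F^p\Omega^{k+1})},$$ and $$F^pH_+^{n+p}=\frac{\ker(\partial_+\partial_-)\cap F^p\Omega^{n+p}}{d_+(F^p\Omega^{n+p-1})},\qquad F^pH_-^{n+p}=\frac{\ker d_-\cap F^p\Omega^{n+p}}{\partial_+\partial_-(F^p\Omega^{n+p})}.$$ The maps in the sequence are those induced on cohomology by the indicated operators on representatives. *)

(* Defs.v *)
From HB Require Import structures.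
From mathcomp Require Import all_boot all_order all_algebra.
From mathcomp Require Import all_classical all_reals all_analysis.

Set Implicit Arguments.
Unset Strict Implicit.
Unset Printing Implicit Defensive.

Import Order.TTheory GRing.Theory Num.Theory.
Import numFieldNormedType.Exports.

Local Open Scope classical_set_scope.
Local Open Scope ring_scope.

(* [f] is infinitely differentiable on [U]: every iterated directional
   derivative of [f] is Fréchet differentiable at every point of [U]. *)
Definition smooth_on (R : realType) (V W : normedModType R) (U : set V)
    (f : V -> W) : Prop :=
  forall (vs : seq V) (x : V), U x ->
    differentiable (foldr (fun v (g : V -> W) => fun y => 'D_v g y) f vs) x.

(* [chart_inv] is only meaningful on the image of the chart. *)
Record chart (R : realType) (m : nat) (T : topologicalType) := Chart {
  chart_dom : set T;
  chart_map : T -> 'rV[R]_m;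
  chart_inv : 'rV[R]_m -> T;
  chart_dom_open : open chart_dom;
  chart_im_open : open (chart_map @` chart_dom);
  chart_mapK : forall p, chart_dom p -> chart_inv (chart_map p) = p;
  chart_map_cont : forall p, chart_dom p -> {for p, continuous chart_map};
  chart_inv_cont : forall x, (chart_map @` chart_dom) x ->
    {for x, continuous chart_inv} }.

Record smoothManifold (R : realType) (m : nat) := SmoothManifold {
  carrier : topologicalType;
  carrier_hausdorff : hausdorff_space carrier;
  carrier_second_countable : @second_countable carrier;
  atlas_index : Type;
  atlas : atlas_index -> chart R m carrier;
  atlas_cover : forall p : carrier, exists i, chart_dom (atlas i) p;
  atlas_smooth : forall i j,
    smooth_on [set x | (chart_map (atlas i) @` chart_dom (atlas i)) x
                       /\ chart_dom (atlas j) (chart_inv (atlas i) x)]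
              (chart_map (atlas j) \o chart_inv (atlas i)) }.

Definition chart_im (R : realType) (m : nat) (M : smoothManifold R m)
    (i : atlas_index M) : set 'rV[R]_m :=
  chart_map (atlas i) @` chart_dom (atlas i).

Definition transition (R : realType) (m : nat) (M : smoothManifold R m)
    (i j : atlas_index M) : 'rV[R]_m -> 'rV[R]_m :=
  chart_map (atlas j) \o chart_inv (atlas i).

(* Families of local representatives: [A i x [:: v_1; ...; v_k]] is the value on
   the tangent vectors v_1, ..., v_k, at the point with coordinates [x] in the
   chart [i], of the degree-k part of [A]. Elements of this type need not be
   homogeneous, and only the members of some [Omega M k] are genuine forms. *)
Definition dform (R : realType) (m : nat) (M : smoothManifold R m) : Type :=
  atlas_index M -> 'rV[R]_m -> seq 'rV[R]_m -> R^o.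

(* The smooth [k]-forms. Homogeneity makes [Omega M k] trivial for k < 0. Since
   the coordinates [x] range over the whole of R^m, representatives are required
   to vanish outside the image of the chart, so that equality of forms is
   equality of families. *)
Definition Omega (R : realType) (m : nat) (M : smoothManifold R m) (k : int) :
    set (dform M) :=
  [set A : dform M |
    (forall i x s, ~ chart_im i x -> A i x s = 0) /\
    (forall i x s, (size s)%:Z != k -> A i x s = 0) /\
    (forall i x s1 s2 (a : R) (u v : 'rV[R]_m),
       A i x (s1 ++ (a *: u + v) :: s2) =
       a * A i x (s1 ++ u :: s2) + A i x (s1 ++ v :: s2)) /\
    (forall i x s1 s2 s3 (u : 'rV[R]_m),
       A i x (s1 ++ u :: s2 ++ u :: s3) = 0) /\
    (forall i s, smooth_on (chart_im i) (fun x => A i x s)) /\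
    (forall i j x s, chart_im i x ->
       chart_dom (atlas j) (chart_inv (atlas i) x) ->
       A i x s = A j (transition i j x) (map ('d (transition i j) x) s))].

Arguments Omega {R m} M k.

(* dA(v_0,...,v_k) = \sum_l (-1)^l D_{v_l} (A(v_0,...,^v_l,...,v_k)) in each
   chart, the v_l being extended as constant vector fields. *)
Definition ext_d (R : realType) (m : nat) (M : smoothManifold R m)
    (A : dform M) : dform M :=
  fun i x s =>
    if `[< chart_im i x >] then
      \sum_(l < size s)
        (-1) ^+ l *
        'D_(nth 0 s l) (fun y => A i y (take l s ++ drop l.+1 s)) x
    else 0.

(* Number of inversions of the shuffle that moves the entries selected by [b] in
   front of the others. *)
Definition shuffle_inv (b : bitseq) : nat :=
  (\sum_(i < size b) \sum_(j < size b | i < j)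
     (~~ nth false b i && nth false b j))%N.

(* (a /\ b)(v_1,...,v_{k+l}) = \sum_sigma sgn(sigma)
     a(v_sigma(1),...,v_sigma(k)) b(v_sigma(k+1),...,v_sigma(k+l)),
   sum over the (k,l)-shuffles; for mixed degrees all k, l contribute. *)
Definition wedge (R : realType) (m : nat) (M : smoothManifold R m)
    (a b : dform M) : dform M :=
  fun i x s =>
    \sum_(t : (size s).-tuple bool)
      (-1) ^+ shuffle_inv t * a i x (mask t s) * b i x (mask (map negb t) s).

Definition hpart (R : realType) (m : nat) (M : smoothManifold R m) (k : nat)
    (A : dform M) : dform M :=
  fun i x s => if size s == k then A i x s else 0.

Record symplecticManifold (R : realType) (n : nat) := SymplecticManifold {
  smanifold :> smoothManifold R n.*2;
  sform : dform smanifold;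
  sform_form : Omega smanifold 2 sform;
  sform_closed : ext_d sform = 0;
  sform_nondegenerate : forall (i : atlas_index smanifold) x u,
    chart_im i x -> (forall v, sform i x [:: u; v] = 0) -> u = 0 }.

Arguments sform {R n} s.

Definition Lpow (R : realType) (n : nat) (M : symplecticManifold R n) (j : nat)
    (A : dform M) : dform M :=
  iter j (wedge (sform M)) A.

Definition primitive (R : realType) (n : nat) (M : symplecticManifold R n)
    (s : int) : set (dform M) :=
  [set B : dform M |
    if (0 <= s <= n%:Z) then Omega M s B /\ Lpow (n.+1 - `|s|) B = 0
    else B = 0].

Arguments primitive {R n} M s.

(* [B j] stands for B_{k-2j}. The truncated subtraction [k - n] is max(0, k-n);
   the components outside the range of summation are set to 0. *)
Definition lefschetz_decomp (R : realType) (n : nat)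
    (M : symplecticManifold R n) (k : nat) (A : dform M) (B : nat -> dform M) :
    Prop :=
  (forall j, if (k - n <= j <= k./2)%N
             then primitive M (k%:Z - j.*2%:Z) (B j) else B j = 0) /\
  A = \sum_(k - n <= j < k./2.+1) Lpow j (B j).

(* The components B_{k-2j} of the degree-[k] part of [A]. *)
Definition lcomp (R : realType) (n : nat) (M : symplecticManifold R n)
    (k : nat) (A : dform M) : nat -> dform M :=
  xget (fun _ => 0) [set B | lefschetz_decomp k (hpart k A) B].

(* In the operators below, the outer sum over [k] is the linear extension from
   the Omega^k, 0 <= k <= 2n, to their direct sum. *)

(* L^j B_{k-2j} |-> L^{n-j-(k-2j)} B_{k-2j} *)
Definition reflect_r (R : realType) (n : nat) (M : symplecticManifold R n)
    (A : dform M) : dform M :=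
  \sum_(k < n.*2.+1) \sum_(k - n <= j < k./2.+1)
    Lpow (n - j - (k - j.*2)) (lcomp k A j).

Definition Lneg (R : realType) (n : nat) (M : symplecticManifold R n) (q : nat)
    (A : dform M) : dform M :=
  \sum_(k < n.*2.+1) \sum_(k - n <= j < k./2.+1 | (q <= j)%N)
    Lpow (j - q) (lcomp k A j).

Definition Pi (R : realType) (n : nat) (M : symplecticManifold R n) (p : nat)
    (A : dform M) : dform M :=
  \sum_(k < n.*2.+1) \sum_(k - n <= j < k./2.+1 | (j <= p)%N)
    Lpow j (lcomp k A j).

Definition FOmega (R : realType) (n : nat) (M : symplecticManifold R n)
    (p : nat) (k : int) : set (dform M) :=
  Pi p @` Omega M k.

Arguments FOmega {R n} M p k.

(* The pair (partial_+ B, partial_- B) for a primitive [s]-form [B]. *)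
Definition partial_prim (R : realType) (n : nat) (M : symplecticManifold R n)
    (s : int) (B : dform M) : dform M * dform M :=
  xget (0, 0) [set P : dform M * dform M |
    [/\ primitive M (s + 1) P.1, primitive M (s - 1) P.2
      & ext_d B = P.1 + wedge (sform M) P.2]].

Definition partial_plus (R : realType) (n : nat) (M : symplecticManifold R n)
    (A : dform M) : dform M :=
  \sum_(k < n.*2.+1) \sum_(k - n <= j < k./2.+1)
    Lpow j (partial_prim (k%:Z - j.*2%:Z) (lcomp k A j)).1.

Definition partial_minus (R : realType) (n : nat) (M : symplecticManifold R n)
    (A : dform M) : dform M :=
  \sum_(k < n.*2.+1) \sum_(k - n <= j < k./2.+1)
    Lpow j (partial_prim (k%:Z - j.*2%:Z) (lcomp k A j)).2.

Definition d_plus (R : realType) (n : nat) (M : symplecticManifold R n)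
    (p : nat) (A : dform M) : dform M :=
  Pi p (ext_d A).

Definition d_minus (R : realType) (n : nat) (M : symplecticManifold R n)
    (A : dform M) : dform M :=
  reflect_r (ext_d (reflect_r A)).

(* A quotient Z/B of subspaces B <= Z of [V]; its elements are the cosets of B
   contained in Z. *)
Record subquotient (R : realType) (V : lmodType R) := Subquotient {
  cycles : set V;
  boundaries : set V }.

Definition is_subspace (R : realType) (V : lmodType R) (S : set V) : Prop :=
  S 0 /\ forall (a : R) (u v : V), S u -> S v -> S (a *: u + v).

Definition subquotient_wf (R : realType) (V : lmodType R)
    (H : subquotient V) : Prop :=
  [/\ is_subspace (cycles H), is_subspace (boundaries H)
    & boundaries H `<=` cycles H].

Definition coh_class (R : realType) (V : lmodType R) (H : subquotient V)
    (x : V) : set V :=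
  [set y | boundaries H (y - x)].

Definition classes (R : realType) (V : lmodType R) (H : subquotient V) :
    set (set V) :=
  coh_class H @` cycles H.

Definition induces (R : realType) (V : lmodType R) (H H' : subquotient V)
    (f : V -> V) : Prop :=
  [/\ subquotient_wf H, subquotient_wf H',
      f @` cycles H `<=` cycles H',
      f @` boundaries H `<=` boundaries H'
    & forall (a : R) (u v : V), cycles H u -> cycles H v ->
        f (a *: u + v) = a *: f u + f v].

(* The map on classes induced by [f], [x] |-> [f x]: the image f(c) + B'. *)
Definition induced_map (R : realType) (V : lmodType R) (H' : subquotient V)
    (f : V -> V) (c : set V) : set V :=
  [set y | exists2 x, c x & boundaries H' (y - f x)].

(* H1 --f--> H2 --g--> H3 are well-defined linear maps, and the sequence is
   exact at H2. *)
Definition exact_at (R : realType) (V : lmodType R)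
    (H1 H2 H3 : subquotient V) (f g : V -> V) : Prop :=
  [/\ induces H1 H2 f, induces H2 H3 g
    & induced_map H2 f @` classes H1 =
      [set c | classes H2 c /\ induced_map H3 g c = coh_class H3 0]].

Definition zeroH (R : realType) (V : lmodType R) : subquotient V :=
  Subquotient [set 0] [set 0].

Arguments zeroH {R} V.

Definition Hd (R : realType) (m : nat) (M : smoothManifold R m) (k : int) :
    subquotient (dform M) :=
  Subquotient [set A | Omega M k A /\ ext_d A = 0]
              (@ext_d _ _ M @` Omega M (k - 1)).

Definition FHplus (R : realType) (n : nat) (M : symplecticManifold R n)
    (p : nat) (k : int) : subquotient (dform M) :=
  if k == (n + p)%:Z then
    Subquotient
      [set A | FOmega M p k A /\ partial_plus (partial_minus A) = 0]
      (@d_plus _ _ M p @` FOmega M p (k - 1))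
  else
    Subquotient
      [set A | FOmega M p k A /\ d_plus p A = 0]
      (@d_plus _ _ M p @` FOmega M p (k - 1)).

Definition FHminus (R : realType) (n : nat) (M : symplecticManifold R n)
    (p : nat) (k : int) : subquotient (dform M) :=
  if k == (n + p)%:Z then
    Subquotient
      [set A | FOmega M p k A /\ d_minus A = 0]
      ((fun A => partial_plus (partial_minus A)) @` FOmega M p k)
  else
    Subquotient
      [set A | FOmega M p k A /\ d_minus A = 0]
      (@d_minus _ _ M @` FOmega M p (k + 1)).

(* Main.v *)
(** In the symplectic setting the contraction Lambda with the inverse of omega
    satisfies Lambda L - L Lambda = n - k on k-forms. Hence, by sl2 theory,
    L^q : Omega^k -> Omega^(k+2q) is injective for k + q <= n and surjective for
    k + q >= n, which gives the Lefschetz decomposition. For C in Omega^(k-2r) one has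
    Pi^(r-1) L^r C = 0, and every k-form A splits as A = Pi^(r-1) A + L^r (L^(-r) A);
    so F^(r-1) Omega^k is the cokernel of L^r, while *_r identifies
    F^(r-1) Omega^(2n-m) with the kernel of L^r on Omega^m.

    In these terms, a class of F^(r-1)H_+^k is represented by an A with dA = L^r C and
    dC = 0, and it is mapped to C; a class of F^(r-1)H_-^(2n-m) is represented by *_r A
    with A a closed m-form killed by L^r, modulo the dY such that L^r Y is exact. Both
    descriptions hold also at the middle degree n+r-1, since
    partial_+ partial_- = *_r d L^(-r) d there. The sequence is thus the long exact
    sequence of the mapping cone of L^r, and its exactness is a diagram chase. *)

Require Import Defs.
From mathcomp Require Import all_boot all_order all_algebra.
From mathcomp Require Import ring lra zify.
From mathcomp Require Import all_classical all_reals all_analysis.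

Set Implicit Arguments.
Unset Strict Implicit.
Unset Printing Implicit Defensive.

Import Order.TTheory GRing.Theory Num.Theory.
Import numFieldNormedType.Exports.

Local Open Scope classical_set_scope.
Local Open Scope ring_scope.

(** * Smooth functions *)

Section SmoothFunctions.
Context {R : realType} {V : normedModType R}.
Implicit Types (U : set V) (x v : V).

(** The middle degree is delicate for a reason of ranges. For [k <= n + r - 1], [L^r] is injective
    on a form [C] of degree [k - 2r + 1], but injectivity on [dC] is available only for
    [k <= n + r - 2]. Below the middle, [d d A = 0] thus forces [dC = 0]; at [k = n + r - 1]
    closedness of [C] is a condition of its own, the one that the second-order operator imposes.
    Dually, a form [X] with [L^r Y = dX] is guaranteed to lie in the image of [L^r], and can then be
    absorbed into [Y], only for [m >= n - r + 2].

    No metric and no Hodge theory enter: the Lefschetz theory comes from the pointwise commutator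
    alone, by induction starting in degrees where forms vanish. As forms are families of chart
    representatives, [d] and Lambda have to be shown compatible with changes of charts, and the
    identities of exterior calculus are obtained by peeling off one argument at a time. The
    operators on Lefschetz components are shown linear on forms of a single degree, so degrees are
    carried through every computation. *)

Lemma near_eq_differentiable (W : normedModType R) (f g : V -> W) x :
  (\near x, f x = g x) -> differentiable f x -> differentiable g x.
Proof.
move=> fg df.
(* The difference vanishes near [x], hence has zero differential there. *)
have -> : g = f + (g - f) by rewrite addrC subrK.
apply: differentiableD; first exact: df.
have gf0 : \forall y \near x, (g - f) y = 0.
  by near=> y; rewrite !fctE (near fg y) ?subrr //.
have gfx : (g - f) x = 0 by exact: nbhs_singleton gf0.
have E : (g - f) \o shift x = cst ((g - f) x) + (\0 : {linear V -> W}) +o_ 0 id.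
  apply/eqaddoP => e e0; rewrite near_simpl.
  have /= := gf0; rewrite (near_shift 0) /=.
  apply: filterS => y /=; rewrite subr0 gfx !fctE => E.
  have {}E : g (y + x) - f (y + x) = 0 by [].
  by rewrite E addr0 subrr normr0 mulr_ge0 // ltW.
apply/diff_locallyP; rewrite (diff_unique _ E); first by split=> //; exact: cst_continuous.
exact: cst_continuous.
Unshelve. all: by end_near. Qed.

Lemma open_near_eq (W : Type) U (f g : V -> W) x :
  open U -> (forall y, U y -> f y = g y) -> U x -> \near x, f x = g x.
Proof.
by move=> oU fg Ux; near=> y; apply: fg; near: y; exact: open_nbhs_nbhs.
Unshelve. all: by end_near. Qed.

Lemma smooth_onP (W : normedModType R) U (f : V -> W) :
  smooth_on U f <-> (forall x, U x -> differentiable f x) /\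
                    forall v, smooth_on U (fun y => 'D_v f y).
Proof.
split=> [sf|[df sf]].
  split=> [x Ux|v vs x Ux]; first exact: (sf [::]).
  by have := sf (rcons vs v) x Ux; rewrite foldr_rcons.
move=> vs; case/lastP: vs => [|vs v] x Ux; first exact: df.
by rewrite foldr_rcons; exact: sf.
Qed.

Lemma smooth_on_derive (W : normedModType R) U (f : V -> W) v :
  smooth_on U f -> smooth_on U (fun y => 'D_v f y).
Proof. by case/smooth_onP. Qed.

Lemma smooth_on_differentiable (W : normedModType R) U (f : V -> W) x :
  smooth_on U f -> U x -> differentiable f x.
Proof. by case/smooth_onP=> + _; apply. Qed.

Lemma smooth_on_derivable (W : normedModType R) U (f : V -> W) x v :
  smooth_on U f -> U x -> derivable f x v.
Proof. by move=> sf Ux; apply/diff_derivable/(smooth_on_differentiable sf). Qed.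

(* Smoothness is a coinductive notion: a class of functions that are
   differentiable on [U] and that is stable under directional derivatives, up to
   equality on [U], consists of smooth functions. *)
Lemma smooth_on_coind (W : normedModType R) U (C : (V -> W) -> Prop) :
  open U ->
  (forall f, C f -> forall x, U x -> differentiable f x) ->
  (forall f v, C f -> exists2 g, C g & forall x, U x -> 'D_v f x = g x) ->
  forall f, C f -> smooth_on U f.
Proof.
move=> oU Cdiff Cder f Cf vs.
suff [g Cg fg] : exists2 g, C g &
    forall x, U x -> foldr (fun v (g : V -> W) y => 'D_v g y) f vs x = g x.
  move=> x Ux; apply: (@near_eq_differentiable _ g); last exact: Cdiff.
  by apply: open_near_eq Ux => // y Uy; rewrite fg.
elim: vs => [|v vs [g Cg fg]] /=; first by exists f.
have [g' Cg' gg'] := Cder g v Cg; exists g' => // x Ux.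
by rewrite -gg' //; apply: near_eq_derive; exact: open_near_eq Ux.
Qed.

Lemma eq_smooth_on (W : normedModType R) U (f g : V -> W) :
  open U -> (forall x, U x -> f x = g x) -> smooth_on U f -> smooth_on U g.
Proof.
move=> oU fg sf; apply: (smooth_on_coind oU (C := fun h =>
  exists2 k, smooth_on U k & forall x, U x -> k x = h x)); last by exists f.
- move=> h [k sk kh] x Ux; apply: (@near_eq_differentiable _ k); first exact: open_near_eq Ux.
  exact: smooth_on_differentiable sk Ux.
- move=> h v [k sk kh]; exists (fun y => 'D_v k y).
    by exists (fun y => 'D_v k y) => //; exact: smooth_on_derive.
  by move=> x Ux; apply/esym/near_eq_derive; exact: open_near_eq Ux.
Qed.

Lemma smooth_on_cst (W : normedModType R) U (c : W) : open U -> smooth_on U (cst c : V -> W).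
Proof.
move=> oU; apply: (smooth_on_coind oU (C := fun h => exists a, h = cst a)); last by exists c.
- by move=> _ [a ->] x _; exact: differentiable_cst.
- by move=> _ v [a ->]; exists (cst 0); [exists 0|move=> x _; rewrite derive_cst].
Qed.

Lemma smooth_onD (W : normedModType R) U (f g : V -> W) :
  open U -> smooth_on U f -> smooth_on U g -> smooth_on U (fun x => f x + g x).
Proof.
move=> oU sf sg; apply: (smooth_on_coind oU (C := fun h => exists f g,
   [/\ h = f + g, smooth_on U f & smooth_on U g])); last by exists f, g.
- by move=> _ [{sf}f [{sg}g [-> sf sg]]] x Ux; apply: differentiableD;
    [exact: smooth_on_differentiable sf Ux|exact: smooth_on_differentiable sg Ux].
- move=> _ v [{sf}f [{sg}g [-> sf sg]]]; exists ((fun y => 'D_v f y) + (fun y => 'D_v g y)).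
    by exists (fun y => 'D_v f y), (fun y => 'D_v g y); split=> //; exact: smooth_on_derive.
  by move=> x Ux; rewrite deriveD ?fctE //;
    [exact: smooth_on_derivable sf Ux|exact: smooth_on_derivable sg Ux].
Qed.

Lemma smooth_on_sum (W : normedModType R) I (r : seq I) (P : pred I) U (F : I -> V -> W) :
  open U -> (forall i, P i -> smooth_on U (F i)) ->
  smooth_on U (fun x => \sum_(i <- r | P i) F i x).
Proof.
move=> oU sF; elim: r => [|i r IH].
  by under eq_fun do rewrite big_nil; exact: smooth_on_cst.
under eq_fun do rewrite big_cons; case Pi: (P i) => //.
exact: smooth_onD (sF i Pi) IH.
Qed.

(* The functions obtained from [1 / f] and smooth functions by sums and products:
   a class stable under differentiation, which yields the smoothness of products
   and inverses at once. *)
Inductive localization U (f : V -> R^o) : (V -> R^o) -> Prop :=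
| LocalizationSmooth g of smooth_on U g : localization U f g
| LocalizationV : localization U f (fun x => (f x)^-1)
| LocalizationM g h of localization U f g & localization U f h :
    localization U f (g * h)
| LocalizationD g h of localization U f g & localization U f h :
    localization U f (g + h).

Lemma localization_smooth U (f g : V -> R^o) :
  open U -> (forall x, U x -> f x != 0) -> smooth_on U f ->
  localization U f g -> smooth_on U g.
Proof.
move=> oU f0 sf.
have diffC h : localization U f h -> forall x, U x -> differentiable h x.
  move=> Ch x Ux; elim: Ch => [a sa||a b _ da _ db|a b _ da _ db].
  - exact: smooth_on_differentiable sa Ux.
  - by apply: differentiableV; [exact: smooth_on_differentiable sf Ux|exact: f0].
  - exact: differentiableM.
  - exact: differentiableD.
apply: (smooth_on_coind oU diffC) => {g}.
move=> h v; elim=> [a sa||a b Ca [a' Ca' aa'] Cb [b' Cb' bb']|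
  a b Ca [a' Ca' aa'] Cb [b' Cb' bb']].
- exists (fun y => 'D_v a y) => //.
  exact/LocalizationSmooth/smooth_on_derive.
- exists ((cst (- 1 : R^o)) * ((fun x => (f x)^-1 : R^o) * (fun x => (f x)^-1 : R^o))
          * (fun y => 'D_v f y)).
    apply: LocalizationM; last exact/LocalizationSmooth/smooth_on_derive.
    apply: LocalizationM; first exact/LocalizationSmooth/(@smooth_on_cst R^o).
    by apply: LocalizationM; exact: LocalizationV.
  move=> x Ux; rewrite (@deriveV _ _ f); [|exact: f0|exact: smooth_on_derivable sf Ux].
  by rewrite /GRing.scale /= !fctE mulN1r expr2 invfM.
- exists (a * b' + b * a').
    by apply: LocalizationD; apply: LocalizationM.
  move=> x Ux; rewrite deriveM; [|by apply: diff_derivable; exact: diffC..].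
  by rewrite !fctE aa' // bb'.
- exists (a' + b'); first exact: LocalizationD.
  move=> x Ux; rewrite deriveD; [|by apply: diff_derivable; exact: diffC..].
  by rewrite !fctE aa' // bb'.
Qed.

Lemma smooth_onM U (f g : V -> R^o) :
  open U -> smooth_on U f -> smooth_on U g ->
  smooth_on U ((fun x => f x * g x) : V -> R^o).
Proof.
move=> oU sf sg; apply: (@localization_smooth U (cst 1)) => //.
- by move=> x _; exact: oner_neq0.
- exact: (@smooth_on_cst R^o).
- by apply: (@LocalizationM _ _ f g); exact: LocalizationSmooth.
Qed.

Lemma smooth_onV U (f : V -> R^o) :
  open U -> (forall x, U x -> f x != 0) -> smooth_on U f ->
  smooth_on U ((fun x => (f x)^-1) : V -> R^o).
Proof.
by move=> oU f0 sf; apply: localization_smooth f0 sf _ => //; exact: LocalizationV.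
Qed.

Lemma smooth_onZ U (c : R) (f : V -> R^o) :
  open U -> smooth_on U f -> smooth_on U ((fun x => c * f x) : V -> R^o).
Proof. by move=> oU; apply: smooth_onM => //; exact: (@smooth_on_cst R^o). Qed.

Lemma smooth_on_prod I (r : seq I) (P : pred I) U (F : I -> V -> R^o) :
  open U -> (forall i, P i -> smooth_on U (F i)) ->
  smooth_on U ((fun x => \prod_(i <- r | P i) F i x) : V -> R^o).
Proof.
move=> oU sF; elim: r => [|i r IH].
  by under eq_fun do rewrite big_nil; exact: (@smooth_on_cst R^o).
under eq_fun do rewrite big_cons; case Pi: (P i) => //.
exact: smooth_onM (sF i Pi) IH.
Qed.

(** Brings directional derivatives within reach of the one-variable mean value theorem. *)
Lemma is_derive_line (f : V -> R^o) (y v : V) (s : R) :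
  derivable f (s *: v + y) v ->
  is_derive s 1 (fun t : R => f (t *: v + y)) ('D_v f (s *: v + y)).
Proof.
have E : (fun h : R => h^-1 *: (f (h *: v + (s *: v + y)) - f (s *: v + y))) =
         (fun h : R => h^-1 *:
            (((fun t : R => f (t *: v + y)) \o shift s) (h *: 1) - f (s *: v + y))).
  by apply/funext => h /=; rewrite addrA -scalerDl [h *: 1]mulr1.
by move=> df; split; rewrite /derivable /derive -E.
Qed.

Lemma second_difference_MVT U (f : V -> R^o) x u v (h : R) :
  smooth_on U f -> 0 < h ->
  (forall s t : R, 0 <= s <= h -> 0 <= t <= h -> U (s *: u + (t *: v + x))) ->
  exists s t : R, [/\ 0 <= s <= h, 0 <= t <= h &
    f (h *: u + (h *: v + x)) - f (h *: u + x) - (f (h *: v + x) - f x) =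
    ('D_v (fun y => 'D_u f y) (s *: u + (t *: v + x)) : R) * (h * h) :> R].
Proof.
move=> sf h0 Uh.
have hh : 0 <= h <= h by apply/andP; split=> //; exact: ltW.
have z0 : (0 : R) <= (0 : R) <= h by rewrite lexx ltW.
(* The second difference is the increment of [phi] over [[0, h]]; the derivative of [phi] is in turn
   an increment, in direction [v], of [psi] below. *)
pose phi (s : R) := (f (s *: u + (h *: v + x)) - f (s *: u + (0 *: v + x)) : R^o).
have dphi s : s \in `[0, h] -> is_derive s 1 phi
    ('D_u f (s *: u + (h *: v + x)) - 'D_u f (s *: u + (0 *: v + x))).
  rewrite in_itv /= => sh.
  by apply: is_deriveB; apply: is_derive_line; apply: smooth_on_derivable sf _; exact: Uh.
have oo_cc (s : R) : s \in `]0, h[ -> s \in `[0, h].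
  by rewrite !in_itv /= => /andP[/ltW-> /ltW->].
have [|s sh Es] := MVT h0 (fun s sh => dphi s (oo_cc s sh)).
  by apply: derivable_within_continuous => s /dphi [].
have {}sh : 0 <= s <= h by move: sh; rewrite in_itv /= => /andP[/ltW-> /ltW->].
pose psi (t : R) := ('D_u f (t *: v + (s *: u + x)) : R^o).
have dpsi t : t \in `[0, h] -> is_derive t 1 psi
    ('D_v (fun y => 'D_u f y) (t *: v + (s *: u + x))).
  rewrite in_itv /= => th; apply: (@is_derive_line (fun y => 'D_u f y)).
  apply: (smooth_on_derivable (U := U)); first exact: smooth_on_derive.
  by rewrite addrCA; exact: Uh.
have [|t th Et] := MVT h0 (fun t th => dpsi t (oo_cc t th)).
  by apply: derivable_within_continuous => t /dpsi [].
have {}th : 0 <= t <= h by move: th; rewrite in_itv /= => /andP[/ltW-> /ltW->].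
exists s, t; split=> //.
move: Es Et; rewrite /phi /psi !scale0r !add0r !subr0 => Es Et.
by rewrite Es [s *: u + (h *: v + x)]addrCA Et [t *: v + (s *: u + x)]addrCA mulrA.
Qed.

(* Two applications of the mean value theorem express the same second difference
   of [f] as a value of either mixed derivative near [x]. *)
Lemma derive_comm U (f : V -> R^o) x u v :
  open U -> smooth_on U f -> U x ->
  'D_u (fun y => 'D_v f y) x = 'D_v (fun y => 'D_u f y) x.
Proof.
move=> oU sf Ux.
pose g1 y := 'D_u (fun y => 'D_v f y) y; pose g2 y := 'D_v (fun y => 'D_u f y) y.
rewrite -/(g1 x) -/(g2 x).
have c1 : {for x, continuous g1}.
  apply: differentiable_continuous; apply: (smooth_on_differentiable (U := U)) => //.
  by do 2! apply: smooth_on_derive.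
have c2 : {for x, continuous g2}.
  apply: differentiable_continuous; apply: (smooth_on_differentiable (U := U)) => //.
  by do 2! apply: smooth_on_derive.
apply/eqP; rewrite -subr_eq0 -normr_le0; apply/ler_addgt0Pr => e e0; rewrite add0r.
have e20 : 0 < e / 2 by rewrite divr_gt0.
have n0 : \forall y \near x, U y by exact: open_nbhs_nbhs.
have n1 : \forall y \near x, `|g1 x - g1 y| < e / 2.
  by move/cvgrPdist_lt : c1 => /(_ _ e20).
have n2 : \forall y \near x, `|g2 x - g2 y| < e / 2.
  by move/cvgrPdist_lt : c2 => /(_ _ e20).
have /nbhs_ballP[d d0 xd] : \forall y \near x,
    [/\ U y, `|g1 x - g1 y| < e / 2 & `|g2 x - g2 y| < e / 2].
  by apply: filterS3 n0 n1 n2.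
have {}d0 : 0 < d := d0.
(* With [h * k = d / 2], the parallelogram of sides [h *: u] and [h *: v] stays in the ball of
   radius [d]; the summand [1] keeps [k] positive when [u] and [v] vanish. *)
pose k := `|u| + `|v| + 1.
have k0 : 0 < k by rewrite ltr_wpDl // addr_ge0.
pose h := d / 2 / k.
have h0 : 0 < h by rewrite !divr_gt0.
have near_x s t : 0 <= s <= h -> 0 <= t <= h ->
    ball x d (s *: u + (t *: v + x)).
  move=> /andP[s0 sh] /andP[t0 th]; rewrite -ball_normE /ball_ /=.
  rewrite addrA opprD addrCA subrr addr0 normrN.
  apply: le_lt_trans (ler_normD _ _) _; rewrite !normrZ !ger0_norm //.
  apply: (@le_lt_trans _ _ (h * k)).
    by rewrite /k !mulrDr mulr1 -addrA lerD ?ler_wpM2r // ler_wpDr ?ler_wpM2r // ltW.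
  by rewrite /h divfK ?gt_eqF // ltr_pdivrMr // ltr_pMr // ltr1n.
(* The second difference is symmetric in the two directions. *)
have swap (a b c l : R^o) : a - b - (c - l) = a - c - (b - l).
  by rewrite !opprB addrACA [RHS]addrACA [- b - c]addrC.
have [|s1 [t1 [s1h t1h E1]]] := @second_difference_MVT U f x v u h sf h0.
  by move=> s t sh th; rewrite addrCA; case: (xd _ (near_x t s th sh)).
have [|s2 [t2 [s2h t2h E2]]] := @second_difference_MVT U f x u v h sf h0.
  by move=> s t sh th; case: (xd _ (near_x s t sh th)).
have hh0 : h * h != 0 by rewrite mulf_neq0 ?gt_eqF.
move: E1; rewrite [h *: v + (h *: u + x)]addrCA => E1.
have E3 := swap (f (h *: u + (h *: v + x))) (f (h *: v + x)) (f (h *: u + x)) (f x).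
have E4 := etrans (esym E1) (etrans E3 E2).
have := mulIf hh0 E4.
rewrite -/(g1 _) -/(g2 _).
have [_ + _] := xd _ (near_x t1 s1 t1h s1h); rewrite addrCA /=.
have [_ _ /=] := xd _ (near_x s2 t2 s2h t2h).
move: (g1 (_ + _)) (g2 (_ + _)) => a b; move=> + + ab; rewrite ab => H2 H1.
rewrite -(subrK b (g1 x)) -addrA; apply: ltW; apply: le_lt_trans (ler_normD _ _) _.
rewrite [ltRHS](splitr e); apply: ltrD; first exact: H1.
by rewrite (distrC b); exact: H2.
Qed.

End SmoothFunctions.

(** * Alternating forms on a vector space *)

Section AlternatingForms.
Context {R : realType} {V : lmodType R}.
Implicit Types (f g : seq V -> R^o) (s : seq V) (u v w : V).

(* The interior product of [f] with [v]. As a form is determined by its interior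
   products, identities between forms reduce to induction on the list of arguments,
   using [wedgep_cons] and, for the exterior derivative, [dl_cons]. *)
Definition iprod v f : seq V -> R^o := fun s => f (v :: s).

Definition homogeneous (k : nat) f := forall s, size s != k -> f s = 0.

Definition is_multilinear f := forall s1 s2 (a : R) u v,
  f (s1 ++ (a *: u + v) :: s2) = a * f (s1 ++ u :: s2) + f (s1 ++ v :: s2).

Definition is_alternating f := forall s1 s2 s3 u,
  f (s1 ++ u :: s2 ++ u :: s3) = 0.

Definition kform k f := [/\ homogeneous k f, is_multilinear f & is_alternating f].

(** The value of [wedge] at one point: [wedge a b i x] is convertible to
    [wedgep (a i x) (b i x)]. *)
Definition wedgep f g : seq V -> R^o := fun s =>
  \sum_(t : (size s).-tuple bool)
    (-1) ^+ shuffle_inv t * f (mask t s) * g (mask (map negb t) s).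

Lemma iprod_homogeneous k v f : homogeneous k f -> homogeneous k.-1 (iprod v f).
Proof. by move=> hf s sk; apply: hf; case: k sk. Qed.

Lemma iprod_multilinear v f : is_multilinear f -> is_multilinear (iprod v f).
Proof. by move=> mf s1; exact: (mf (v :: s1)). Qed.

Lemma iprod_alternating v f : is_alternating f -> is_alternating (iprod v f).
Proof. by move=> af s1; exact: (af (v :: s1)). Qed.

Lemma iprod_kform k v f : kform k f -> kform k.-1 (iprod v f).
Proof.
case=> hf mf af; split; first exact: iprod_homogeneous.
- exact: iprod_multilinear.
- exact: iprod_alternating.
Qed.

Lemma iprod_lin a u v f : is_multilinear f -> iprod (a *: u + v) f = a *: iprod u f + iprod v f.
Proof. by move=> mf; apply/funext => s; exact: (mf [::]). Qed.

Lemma iprod_homogeneous0 f v : homogeneous 0 f -> iprod v f = 0.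
Proof. by move=> hf; apply/funext => s; exact: hf. Qed.

Lemma wedgep_linl a f f' g : wedgep (a *: f + f') g = a *: wedgep f g + wedgep f' g.
Proof.
apply/funext => s; rewrite /wedgep !fctE scaler_sumr -big_split /=.
by apply: eq_bigr => t _; rewrite /GRing.scale /=; ring.
Qed.

Lemma wedgep_linr a f g g' : wedgep f (a *: g + g') = a *: wedgep f g + wedgep f g'.
Proof.
apply/funext => s; rewrite /wedgep !fctE scaler_sumr -big_split /=.
by apply: eq_bigr => t _; rewrite /GRing.scale /=; ring.
Qed.

Lemma wedgep0l g : wedgep 0 g = 0.
Proof. by apply/funext => s; apply: big1 => t _; rewrite mulr0 mul0r. Qed.

Lemma wedgep0r f : wedgep f 0 = 0.
Proof. by apply/funext => s; apply: big1 => t _; rewrite mulr0. Qed.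

Lemma wedgep_suml (I : Type) (r : seq I) (F : I -> seq V -> R^o) g :
  wedgep (\sum_(i <- r) F i) g = \sum_(i <- r) wedgep (F i) g.
Proof.
elim: r => [|i r IH]; first by rewrite !big_nil wedgep0l.
by rewrite !big_cons -IH -[F i in LHS]scale1r wedgep_linl scale1r.
Qed.

Lemma wedgep_sumr (I : Type) (r : seq I) f (G : I -> seq V -> R^o) :
  wedgep f (\sum_(i <- r) G i) = \sum_(i <- r) wedgep f (G i).
Proof.
elim: r => [|i r IH]; first by rewrite !big_nil wedgep0r.
by rewrite !big_cons -IH -[G i in LHS]scale1r wedgep_linr scale1r.
Qed.

Lemma wedgep_nil f g : wedgep f g [::] = f [::] * g [::].
Proof.
rewrite /wedgep (big_pred1 [tuple]); last by move=> t; apply/esym/eqP; exact: tuple0.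
by rewrite /shuffle_inv big_ord0 expr0 mul1r.
Qed.

(** A leading unselected entry is overtaken by every selected one; this is the origin of the sign in
    [wedgep_cons]. *)
Lemma shuffle_inv_cons b (t : bitseq) :
  shuffle_inv (b :: t) = ((if b then 0 else count id t) + shuffle_inv t)%N.
Proof.
rewrite /shuffle_inv /= big_ord_recl /=; congr addn; last first.
  apply: eq_bigr => i _; rewrite big_mkcond big_ord_recl /= add0n.
  by rewrite -big_mkcond.
rewrite big_mkcond big_ord_recl /= add0n; case: b => /=; first by rewrite big1.
rewrite -sum1_count [RHS]big_mkcond (big_nth false) big_mkord.
by apply: eq_bigr => i _; rewrite add0n; case: nth.
Qed.

Lemma big_tuple_cons (n : nat) (F : n.+1.-tuple bool -> R^o) :
  \sum_t F t = \sum_(t : n.-tuple bool) F [tuple of true :: t] +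
               \sum_(t : n.-tuple bool) F [tuple of false :: t].
Proof.
rewrite (reindex (fun p : bool * n.-tuple bool => [tuple of p.1 :: p.2])) /=; last first.
  exists (fun t => (thead t, [tuple of behead t])) => [[b t] _|t _] /=.
    by congr (_, _); apply: val_inj.
  by rewrite [RHS]tuple_eta; apply: val_inj.
rewrite -(pair_bigA _ (fun (b : bool) (t : n.-tuple bool) => F [tuple of b :: t])).
by rewrite /= big_bool.
Qed.

(** The shuffles are split by whether [v] goes to [f] or to [g]; in the second case the [p]
    arguments of [f] move past [v]. *)
Lemma wedgep_cons p f g v s : homogeneous p f ->
  wedgep f g (v :: s) = wedgep (iprod v f) g s + (-1) ^+ p * wedgep f (iprod v g) s.
Proof.
move=> hf; rewrite /wedgep big_tuple_cons; congr (_ + _).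
  by apply: eq_bigr => t _; rewrite shuffle_inv_cons.
rewrite mulr_sumr; apply: eq_bigr => t _; rewrite shuffle_inv_cons /=.
have [<-|/hf->] := eqVneq (size (mask t s)) p; last by rewrite !(mulr0, mul0r).
by rewrite size_mask ?size_tuple // exprD -!mulrA.
Qed.

Lemma iprod_wedgep p f g v : homogeneous p f ->
  iprod v (wedgep f g) = wedgep (iprod v f) g + (-1) ^+ p *: wedgep f (iprod v g).
Proof. by move=> hf; apply/funext => s; exact: wedgep_cons. Qed.

Lemma wedgep_homogeneous p q f g :
  homogeneous p f -> homogeneous q g -> homogeneous (p + q) (wedgep f g).
Proof.
move=> hf hg s spq; apply: big1 => t _.
have [fp|/hf->] := eqVneq (size (mask t s)) p; last by rewrite mulr0 mul0r.
rewrite (hg (mask (map negb t) s)) ?mulr0 //.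
apply: contra spq => /eqP <-; rewrite -fp !size_mask ?size_map ?size_tuple //.
by rewrite count_map (count_predC id) size_tuple.
Qed.

Lemma wedgep_multilinear p q f g : kform p f -> kform q g -> is_multilinear (wedgep f g).
Proof.
move=> kf kg s1; elim: s1 => [|w s1 IH] in p q f g kf kg * => s2 a u v /=.
  have [hf mf _] := kf; have [hg mg _] := kg.
  rewrite !(wedgep_cons _ _ _ hf) !iprod_lin // wedgep_linl wedgep_linr !fctE.
  by rewrite /GRing.scale /=; ring.
have [hf mf _] := kf; have [hg mg _] := kg.
rewrite !(wedgep_cons _ _ _ hf) (IH _ _ _ _ (iprod_kform w kf) kg).
rewrite (IH _ _ _ _ kf (iprod_kform w kg)); ring.
Qed.

(** Polarization of the adjacent case gives skew symmetry in neighbouring arguments, and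
    transpositions carry the first [u] up to the second. *)
Lemma adjacent_alternating f : is_multilinear f ->
  (forall s1 s2 u, f (s1 ++ [:: u, u & s2]) = 0) -> is_alternating f.
Proof.
move=> mf af s1 s2 s3 u.
have madd r1 r2 v w : f (r1 ++ (v + w) :: r2) = f (r1 ++ v :: r2) + f (r1 ++ w :: r2).
  by rewrite -[v in LHS]scale1r mf mul1r.
have skew r1 r2 v w : f (r1 ++ [:: v, w & r2]) = - f (r1 ++ [:: w, v & r2]).
  have := af r1 r2 (v + w).
  have madd2 x : f (r1 ++ [:: x, v + w & r2]) =
      f (r1 ++ [:: x, v & r2]) + f (r1 ++ [:: x, w & r2]).
    by have := madd (rcons r1 x) r2 v w; rewrite !cat_rcons.
  rewrite madd !madd2 !af add0r addr0.
  by move/eqP; rewrite addr_eq0 => /eqP.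
elim: s2 s1 => [|w s2 IH] s1 /=; first exact: af.
by have := IH (rcons s1 w); rewrite skew cat_rcons => ->; rewrite oppr0.
Qed.

Lemma wedgep_kform p q f g : kform p f -> kform q g -> kform (p + q) (wedgep f g).
Proof.
move=> kf kg; split.
- by apply: wedgep_homogeneous; [case: kf|case: kg].
- exact: wedgep_multilinear kf kg.
apply: adjacent_alternating; first exact: wedgep_multilinear kf kg.
move=> s1; elim: s1 => [|w s1 IH] in p q f g kf kg * => s2 u /=; last first.
  have [hf _ _] := kf.
  rewrite (wedgep_cons _ _ _ hf) (IH _ _ _ _ (iprod_kform w kf) kg).
  by rewrite (IH _ _ _ _ kf (iprod_kform w kg)) mulr0 addr0.
have [hf _ af] := kf; have [hg _ ag] := kg.
have ff : iprod u (iprod u f) = 0 by apply/funext => s; exact: (af [::] [::]).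
have gg : iprod u (iprod u g) = 0 by apply/funext => s; exact: (ag [::] [::]).
rewrite (wedgep_cons _ _ _ hf) (wedgep_cons _ _ _ (iprod_homogeneous u hf)) (wedgep_cons _ _ _ hf).
have z s : (0 : seq V -> R^o) s = 0 by [].
rewrite ff gg wedgep0l wedgep0r !z mulr0 addr0 add0r -mulrDl.
(* The mixed terms carry the signs [(-1) ^+ p.-1] and [(-1) ^+ p]. These are opposite unless
   [p = 0], where [iprod u f] vanishes. *)
case: p hf {kf} => [|p] hf; first by rewrite iprod_homogeneous0 // wedgep0l mulr0.
by rewrite /= exprS mulN1r subrr mul0r.
Qed.

Lemma wedgep_homogeneous0 f g : homogeneous 0 f -> wedgep f g = f [::] *: g.
Proof.
move=> hf; apply/funext => s; elim: s g => [|v s IH] g; first exact: wedgep_nil.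
rewrite (wedgep_cons _ _ _ hf) iprod_homogeneous0 // wedgep0l expr0 mul1r IH.
exact: add0r.
Qed.

End AlternatingForms.

(** * Coordinates, contraction with a bivector and the sl2 relation *)

Section RowVectorForms.
Context {R : realType} {m : nat}.
Notation V := 'rV[R]_m.
Implicit Types (f g : seq V -> R^o) (s : seq V) (u v w : V).

Definition ebase (a : 'I_m) : V := delta_mx 0 a.

Definition coform (a : 'I_m) : seq V -> R^o :=
  fun s => if s is [:: v] then v 0 a else 0.

Lemma coform_homogeneous a : homogeneous 1 (coform a).
Proof. by case=> [|v []]. Qed.

Lemma multilinear0 f s1 s2 : is_multilinear f -> f (s1 ++ 0 :: s2) = 0.
Proof.
move=> mf; have := mf s1 s2 1 0 0; rewrite scale1r addr0 mul1r => /eqP.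
by rewrite eq_sym -subr_eq0 addrK => /eqP.
Qed.

Lemma multilinear_sum f (I : Type) (r : seq I) (c : I -> R) (w : I -> V) s :
  is_multilinear f ->
  f (\sum_(i <- r) c i *: w i :: s) = \sum_(i <- r) c i * f (w i :: s).
Proof.
move=> mf; elim: r => [|i r IH]; first by rewrite !big_nil (multilinear0 [::]).
by rewrite !big_cons -IH; exact: (mf [::]).
Qed.

Lemma multilinear_coord f v s : is_multilinear f ->
  f (v :: s) = \sum_a v 0 a * f (ebase a :: s).
Proof. by move=> mf; rewrite {1}(row_sum_delta v) multilinear_sum. Qed.

Lemma alternating_swap f u v s : is_multilinear f -> is_alternating f ->
  f (u :: v :: s) = - f (v :: u :: s).
Proof.
move=> mf af; have madd a b t : f (a + b :: t) = f (a :: t) + f (b :: t).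
  by have := mf [::] t 1 a b; rewrite scale1r mul1r.
have madd2 a b c t : f (c :: a + b :: t) = f (c :: a :: t) + f (c :: b :: t).
  by have := mf [:: c] t 1 a b; rewrite scale1r mul1r.
have := af [::] [::] s (u + v); rewrite /= madd !madd2.
rewrite (af [::] [::] s u) (af [::] [::] s v) add0r addr0 => /eqP.
by rewrite addr_eq0 => /eqP.
Qed.

(** The operator [\sum_a dx_a /\ iota_a] counts degrees. Contracting it with [v], the terms where
    [v] meets [dx_a] add up to [f (v :: s)]; in the others the two contractions anticommute, which
    cancels the sign and leaves the formula for [iprod v f]. *)
Lemma euler_formula f s : is_multilinear f -> is_alternating f ->
  (\sum_a wedgep (coform a) (iprod (ebase a) f) s) = (size s)%:R * f s.
Proof.
elim: s f => [|v s IH] f mf af.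
  by rewrite mul0r big1 // => a _; rewrite wedgep_nil mul0r.
have E a : wedgep (coform a) (iprod (ebase a) f) (v :: s) =
   v 0 a * f (ebase a :: s) + wedgep (coform a) (iprod (ebase a) (iprod v f)) s.
  rewrite (wedgep_cons _ _ _ (@coform_homogeneous a)); congr (_ + _).
    rewrite wedgep_homogeneous0 //.
    exact: (iprod_homogeneous v (@coform_homogeneous a)).
  have -> : iprod v (iprod (ebase a) f) = (-1) *: iprod (ebase a) (iprod v f) + 0.
    apply/funext => t; rewrite addr0 !fctE [_ *: _]mulN1r /iprod.
    exact: alternating_swap.
  rewrite wedgep_linr wedgep0r addr0 expr1 mulN1r fctE -[X in _ = X]opprK.
  by congr (- _); exact: mulN1r.
under eq_bigr do rewrite E.
rewrite big_split /= -multilinear_coord // IH; last 2 first.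
- exact: iprod_multilinear.
- exact: iprod_alternating.
by rewrite -natr1 mulrDl mul1r addrC.
Qed.

Lemma euler_kform k f : kform k f ->
  \sum_a wedgep (coform a) (iprod (ebase a) f) = k%:R *: f.
Proof.
case=> hf mf af; apply/funext => s; rewrite fct_sumE euler_formula //.
rewrite -[RHS]/(k%:R * f s).
by have [<-//|/hf->] := eqVneq (size s) k; rewrite !mulr0.
Qed.

Lemma oneform_coord f : kform 1 f -> f = \sum_a f [:: ebase a] *: coform a.
Proof.
case=> hf mf _; apply/funext => s; rewrite fct_sumE.
case: s => [|v []] /=.
- by rewrite hf // big1 // => a _; exact: mulr0.
- by rewrite multilinear_coord //; apply: eq_bigr => a _; rewrite mulrC.
- by move=> w s; rewrite hf // big1 // => a _; exact: mulr0.
Qed.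

(* Contraction with the bivector [P / 2]. For [P] the inverse transpose of the
   Gram matrix of a symplectic form [w], this is the operator Lambda, for which
   [contr_wedgep] is the sl2 relation [Lambda L - L Lambda = n - k] on k-forms. *)
Definition contr (P : 'M[R]_m) f : seq V -> R^o :=
  2^-1 *: \sum_a \sum_b P a b *: iprod (ebase b) (iprod (ebase a) f).

Definition gram f : 'M[R]_m := \matrix_(a, b) f [:: ebase a; ebase b].

Lemma contrE P f s :
  contr P f s = 2^-1 * \sum_a \sum_b P a b * f [:: ebase a, ebase b & s].
Proof.
rewrite /contr fctE fct_sumE; congr (_ * _); apply: eq_bigr => a _.
by rewrite fct_sumE.
Qed.

Lemma contr_kform k P f : kform k f -> kform k.-2 (contr P f).
Proof.
case=> hf mf af; split.
- move=> s sk; rewrite contrE big1 ?mulr0 // => a _; rewrite big1 // => b _.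
  by rewrite hf ?mulr0 //=; apply: contra sk => /eqP <-.
- move=> s1 s2 c u v; rewrite !contrE [c * _]mulrCA -mulrDr; congr (_ * _).
  rewrite mulr_sumr -big_split /=; apply: eq_bigr => a _.
  rewrite mulr_sumr -big_split /=; apply: eq_bigr => b _.
  by rewrite (mf [:: ebase a, ebase b & s1]) /=; ring.
- move=> s1 s2 s3 u; rewrite contrE big1 ?mulr0 // => a _; rewrite big1 // => b _.
  by rewrite (af [:: ebase a, ebase b & s1]) mulr0.
Qed.

Lemma kform_iprod_gram (w : seq V -> R^o) a : kform 2 w ->
  iprod (ebase a) w = \sum_c gram w a c *: coform c.
Proof.
move=> kw; rewrite [LHS]oneform_coord; last exact: (iprod_kform _ kw).
by apply: eq_bigr => c _; rewrite mxE.
Qed.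

Lemma gram_skew (w : seq V -> R^o) a b : kform 2 w -> gram w a b = - gram w b a.
Proof. by case=> _ mf af; rewrite !mxE alternating_swap. Qed.

(** Contracting [w /\ f] twice gives four sums. The one with both contractions on [w] is a trace,
    [m] times [f]; each of the two mixed ones is [- k] times [f] by Euler's formula; the last has
    both contractions on [f]. The factor [2^-1] turns [m - 2k] into [m / 2 - k]. *)
Lemma contr_wedgep k P f (w : seq V -> R^o) :
  kform 2 w -> P^T *m gram w = 1%:M -> kform k f ->
  contr P (wedgep w f) = wedgep w (contr P f) + (m%:R / 2 - k%:R) *: f.
Proof.
move=> kw Pw kf.
have [hw mw aw] := kw.
pose I a b := wedgep (iprod (ebase a) w) (iprod (ebase b) f).
have E a b : iprod (ebase b) (iprod (ebase a) (wedgep w f)) =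
   gram w a b *: f - I a b + I b a + wedgep w (iprod (ebase b) (iprod (ebase a) f)).
  rewrite (iprod_wedgep _ _ hw) expr2 mulrNN mulr1 scale1r.
  have -> u g g' : iprod u (g + g') = iprod u g + iprod u g' by [].
  rewrite (iprod_wedgep _ _ hw) expr2 mulrNN mulr1 scale1r.
  rewrite (iprod_wedgep _ _ (iprod_homogeneous _ hw)) expr1 scaleN1r addrA.
  congr (_ - _ + _ + _).
  rewrite wedgep_homogeneous0 ?mxE //.
  by apply: (iprod_homogeneous _ (iprod_homogeneous _ hw)).
have S1 : \sum_a \sum_b P a b *: (gram w a b *: f) = m%:R *: f.
  have -> : m%:R = \sum_(b < m) 1 :> R by rewrite sumr_const card_ord.
  rewrite exchange_big /= scaler_suml.
  apply: eq_bigr => b _; have := congr1 (fun M : 'M[R]_m => M b b) Pw.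
  rewrite !mxE eqxx => E1; rewrite -[1 *: f]/(true%:R *: f) -E1 scaler_suml.
  apply: eq_bigr => a _.
  by rewrite scalerA !mxE.
have S2 : \sum_a \sum_b P a b *: I a b = k%:R *: f.
  rewrite -euler_kform // exchange_big; apply: eq_bigr => b _ /=.
  have -> : coform b = \sum_c (1%:M : 'M[R]_m) b c *: coform c.
    rewrite (bigD1 b) //= mxE eqxx scale1r big1 ?addr0 // => c cb.
    by rewrite mxE eq_sym (negbTE cb) scale0r.
  rewrite -Pw.
  have -> : \sum_c (P^T *m gram w) b c *: coform c = \sum_a P a b *: iprod (ebase a) w.
    under [RHS]eq_bigr => a _ do rewrite kform_iprod_gram // scaler_sumr.
    rewrite exchange_big /=; apply: eq_bigr => c _.
    by rewrite mxE scaler_suml; apply: eq_bigr => a _; rewrite scalerA !mxE.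
  rewrite wedgep_suml; apply: eq_bigr => a _.
  by rewrite -[_ *: iprod _ _]addr0 wedgep_linl wedgep0l addr0.
(* [S3] contracts along the other index of [gram w], hence needs the inverse on the other side. *)
have PT : gram w *m P^T = 1%:M by exact: mulmx1C.
have S3 : \sum_a \sum_b P a b *: I b a = - (k%:R *: f).
  rewrite -euler_kform // -sumrN; apply: eq_bigr => a _ /=.
  have -> : coform a = \sum_c (1%:M : 'M[R]_m) c a *: coform c.
    rewrite (bigD1 a) //= mxE eqxx scale1r big1 ?addr0 // => c cb.
    by rewrite mxE (negbTE cb) scale0r.
  rewrite -PT.
  have -> : \sum_c (gram w *m P^T) c a *: coform c = - \sum_b P a b *: iprod (ebase b) w.
    under [in RHS]eq_bigr => b _ do rewrite kform_iprod_gram // scaler_sumr.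
    rewrite exchange_big /= -sumrN; apply: eq_bigr => c _.
    rewrite mxE scaler_suml -sumrN; apply: eq_bigr => b _.
    by rewrite scalerA (gram_skew b c kw) [P^T _ _]mxE mulrN scaleNr opprK mulrC.
  rewrite -sumrN wedgep_suml -sumrN; apply: eq_bigr => b _.
  by rewrite -[- (_ *: iprod _ _)]addr0 -scaleNr wedgep_linl wedgep0l addr0 scaleNr opprK.
have -> : contr P (wedgep w f) = 2^-1 *: (m%:R *: f - k%:R *: f - k%:R *: f +
    \sum_a \sum_b P a b *: wedgep w (iprod (ebase b) (iprod (ebase a) f))).
  rewrite /contr -S1 -[X in _ - _ + X + _]S3 -S2 -sumrN -!big_split; congr (_ *: _).
  apply: eq_bigr => a _ /=; rewrite -sumrN -!big_split; apply: eq_bigr => b _ /=.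
  by rewrite E !scalerDr scalerN.
have -> : wedgep w (contr P f) =
    2^-1 *: \sum_a \sum_b P a b *: wedgep w (iprod (ebase b) (iprod (ebase a) f)).
  rewrite /contr -[_ *: _ in LHS]addr0 wedgep_linr wedgep0r addr0; congr (_ *: _).
  rewrite wedgep_sumr; apply: eq_bigr => a _; rewrite wedgep_sumr; apply: eq_bigr => b _.
  by rewrite -[_ *: iprod _ _ in LHS]addr0 wedgep_linr wedgep0r addr0.
rewrite scalerDr addrC; congr (_ + _).
rewrite -!scalerBl scalerA; by congr (_ *: _); field.
Qed.

(** The arguments are expanded in the basis one after the other, [r] collecting the basis vectors
    already chosen; more than [m] of them contain a repetition. *)
Lemma kform_eq0 k f : kform k f -> (m < k)%N -> f = 0.
Proof.
case=> hf mf af mk; apply/funext => s.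
have [sk|/hf//] := eqVneq (size s) k.
suff fe t1 (r : seq 'I_m) : (size (t1 : seq V) + size r)%N = k -> f (map ebase r ++ t1) = 0.
  by have := fe s [::]; rewrite /= addn0; exact.
elim: t1 r => [|v t1 IH] r /= E.
  rewrite cats0; have nur : ~~ uniq r.
    apply/negP => /card_uniqP r_card.
    have := max_card (mem r); rewrite r_card card_ord => rm.
    by move: mk; rewrite -E ltnNge rm.
  suff fr t : f (map ebase (t ++ r)) = 0 by exact: (fr [::]).
  elim: r nur {E} t => //= a r IHr; rewrite negb_and negbK => /orP[ar|/IHr fr] t.
    by case/splitPr: ar => p1 p2; rewrite !(map_cat, map_cons) af.
  by rewrite -cat_rcons.
rewrite {1}(row_sum_delta v).
suff -> : f (map ebase r ++ \sum_a v 0 a *: delta_mx 0 a :: t1) =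
    \sum_a v 0 a * f (map ebase (rcons r a) ++ t1).
  by rewrite big1 // => a _; rewrite IH ?mulr0 // size_rcons -E addnS addSn.
elim: (index_enum _) => [|a e IHe]; first by rewrite !big_nil multilinear0.
by rewrite !big_cons -IHe mf map_rcons cat_rcons.
Qed.

Definition lin_mx1 (J : V -> V) : 'M[R]_m := \matrix_(a, b) J (ebase a) 0 b.

Lemma gram_pullback f (J : V -> V) : is_multilinear f ->
  gram (f \o map J) = lin_mx1 J *m gram f *m (lin_mx1 J)^T.
Proof.
move=> mf; apply/matrixP => a b; rewrite !mxE /= multilinear_coord //.
under [RHS]eq_bigr do rewrite !mxE mulr_suml.
rewrite exchange_big /=; apply: eq_bigr => c _.
rewrite -[f _]/(iprod (ebase c) f [:: J (ebase b)]) multilinear_coord; last first.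
  exact: iprod_multilinear.
by rewrite mulr_sumr; apply: eq_bigr => d _; rewrite !mxE /iprod; ring.
Qed.

(** [J] pushes the bivector [P] forward to [J^T P J]. Together with [dual_gram_pullback] this makes
    [Lam] independent of the chart. *)
Lemma contr_pullback P f (J : V -> V) s : is_multilinear f ->
  contr P (f \o map J) s = contr ((lin_mx1 J)^T *m P *m lin_mx1 J) f (map J s).
Proof.
move=> mf; rewrite !contrE; congr (_ * _).
pose F a b := f [:: ebase a, ebase b & map J s].
transitivity (\sum_a \sum_b \sum_c \sum_e P a b * lin_mx1 J a c * lin_mx1 J b e * F c e).
  apply: eq_bigr => a _; apply: eq_bigr => b _ /=.
  rewrite multilinear_coord // mulr_sumr; apply: eq_bigr => c _.
  rewrite -[f _]/(iprod (ebase c) f (J (ebase b) :: map J s)) multilinear_coord; last first.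
    exact: iprod_multilinear.
  by rewrite !mulr_sumr; apply: eq_bigr => d _; rewrite !mxE /iprod /F; ring.
under eq_bigr do rewrite exchange_big /=.
rewrite exchange_big /=; apply: eq_bigr => c _.
under eq_bigr do rewrite exchange_big /=.
rewrite exchange_big /=; apply: eq_bigr => e _.
rewrite [in RHS]mxE mulr_suml [LHS]exchange_big /=; apply: eq_bigr => b _ /=.
rewrite [in RHS]mxE !mulr_suml; apply: eq_bigr => a _; rewrite [_^T _ _]mxE /F; ring.
Qed.

Lemma gram_unit f : is_multilinear f ->
  (forall u, (forall v, f [:: u; v] = 0) -> u = 0) -> gram f \in unitmx.
Proof.
move=> mf f0; rewrite -row_free_unit; apply: inj_row_free => u u0; apply: f0 => v.
rewrite multilinear_coord //.
have E a : f [:: ebase a; v] = \sum_b gram f a b * v 0 b.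
  rewrite -[f _]/(iprod (ebase a) f [:: v]) multilinear_coord; last exact: iprod_multilinear.
  by apply: eq_bigr => b _; rewrite mxE mulrC.
under eq_bigr do rewrite E mulr_sumr.
rewrite exchange_big big1 //= => b _.
have := congr1 (fun M : 'rV[R]_m => M 0 b) u0; rewrite !mxE => u0b.
under eq_bigr do rewrite mulrA.
by rewrite -mulr_suml u0b mul0r.
Qed.

(** The bivector inverse to [f], transposed so as to satisfy the hypothesis on [P] in
    [contr_wedgep]. *)
Definition dual_gram f := (invmx (gram f))^T.

Lemma dual_gramP f : gram f \in unitmx -> (dual_gram f)^T *m gram f = 1%:M.
Proof. by move=> uf; rewrite trmxK mulVmx. Qed.

Lemma dual_gram_pullback f (J : V -> V) :
  is_multilinear f -> gram f \in unitmx -> gram (f \o map J) \in unitmx ->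
  (lin_mx1 J)^T *m dual_gram (f \o map J) *m lin_mx1 J = dual_gram f.
Proof.
move=> mf uf ufJ.
(* A pulled-back Gram matrix can be invertible only if [J] is. *)
have EJ := gram_pullback J mf; have uJ : lin_mx1 J \in unitmx.
  by move: ufJ; rewrite EJ -mulmxA unitmx_mul => /andP[].
rewrite /dual_gram EJ; apply: trmx_inj; rewrite !trmx_mul !trmxK.
have uJT : (lin_mx1 J)^T \in unitmx by rewrite unitmx_tr.
have -> : invmx (lin_mx1 J *m gram f *m (lin_mx1 J)^T) =
  invmx (lin_mx1 J)^T *m invmx (gram f) *m invmx (lin_mx1 J).
  apply: (can_inj (mulKmx ufJ)); rewrite EJ mulmxV -?EJ // EJ.
  by rewrite !mulmxA mulmxK // mulmxK // mulmxV.
by rewrite !mulmxA mulmxV // mul1mx mulmxKV.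
Qed.

End RowVectorForms.

Local Opaque derive.

(** * The exterior derivative in a chart *)

Section LocalExteriorDerivative.
Context {R : realType} {V : normedModType R}.
Implicit Types (F G : V -> seq V -> R^o) (U : set V) (s : seq V) (x y u v w : V).

(* The formula of [ext_d], on the whole of [V]. *)
Definition dl F x : seq V -> R^o := fun s =>
  \sum_(l < size s)
    (-1) ^+ l * 'D_(nth 0 s l) (fun y => F y (take l s ++ drop l.+1 s)) x.

Definition smooth_family U F := forall s, smooth_on U (fun x => F x s).

Lemma form_addE (f g : seq V -> R^o) s : (f + g) s = f s + g s.
Proof. by []. Qed.

Lemma form_scaleE (a : R) (f : seq V -> R^o) s : (a *: f) s = a * f s.
Proof. by []. Qed.

Lemma derive_linv (f : V -> R^o) (a : R) u v x : differentiable f x ->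
  'D_(a *: u + v) f x = a * 'D_u f x + 'D_v f x.
Proof. by move=> df; rewrite !deriveE // linearP. Qed.

Lemma derive_scale (f : V -> R^o) (c : R) v x : derivable f x v ->
  'D_v (fun y => c * f y : R^o) x = c * 'D_v f x.
Proof. exact: deriveZ. Qed.

Lemma derive_addf (f g : V -> R^o) v x : derivable f x v -> derivable g x v ->
  'D_v (fun y => f y + g y) x = 'D_v f x + 'D_v g x.
Proof. exact: deriveD. Qed.

Lemma derive_sumf (I : Type) (r : seq I) (h : I -> V -> R^o) v x :
  (forall i, derivable (h i) x v) ->
  'D_v (fun y => \sum_(i <- r) h i y) x = \sum_(i <- r) 'D_v (h i) x /\
  derivable (fun y => \sum_(i <- r) h i y) x v.
Proof.
move=> dh; elim: r => [|i r [IH1 IH2]].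
  under eq_fun do rewrite big_nil; rewrite big_nil; split; last exact: derivable_cst.
  exact: derive_cst.
under eq_fun do rewrite big_cons; rewrite big_cons -IH1.
split; first exact: derive_addf (dh i) IH2.
exact: derivableD (dh i) IH2.
Qed.

Lemma derive_mulf (f g : V -> R^o) v x : derivable f x v -> derivable g x v ->
  'D_v (fun y => f y * g y : R^o) x = 'D_v f x * g x + f x * 'D_v g x.
Proof.
by move=> df dg; rewrite [LHS](deriveM df dg) addrC; congr (_ + _); exact: mulrC.
Qed.

Lemma dl_nil F x : dl F x [::] = 0.
Proof. by rewrite /dl big_ord0. Qed.

(** Cartan's formula for the constant vector field [v]: [iota_v d = D_v - d iota_v]. *)
Lemma dl_cons F x v s :
  dl F x (v :: s) = 'D_v (fun y => F y s) x - dl (fun y => iprod v (F y)) x s.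
Proof.
rewrite /dl big_ord_recl /= expr0 mul1r drop0 -sumrN; congr (_ + _).
by apply: eq_bigr => l _; rewrite /bump /= add1n exprS mulN1r mulNr.
Qed.

Lemma iprod_dl F x v : iprod v (dl F x) =
  (-1) *: dl (fun y => iprod v (F y)) x + (fun s => 'D_v (fun y => F y s) x).
Proof.
apply/funext => s; rewrite [LHS]dl_cons addrC.
by rewrite -[RHS]/(-1 * dl _ x s + _) mulN1r.
Qed.

Lemma dl_near F G U x : open U -> (forall y, U y -> F y = G y) -> U x ->
  dl F x = dl G x.
Proof.
move=> oU FG Ux; apply/funext => s; apply: eq_bigr => l _; congr (_ * _).
by apply: near_eq_derive; apply: open_near_eq Ux => // y Uy; rewrite FG.
Qed.

Lemma smooth_family_iprod U F v : smooth_family U F ->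
  smooth_family U (fun y => iprod v (F y)).
Proof. by move=> sF s; exact: sF. Qed.

Lemma smooth_family_derive U F v : smooth_family U F ->
  smooth_family U (fun y s => 'D_v (fun z => F z s) y).
Proof. by move=> sF s; apply: smooth_on_derive; exact: sF. Qed.

Lemma smooth_family_dl U F : open U -> smooth_family U F -> smooth_family U (dl F).
Proof.
move=> oU sF s; apply: smooth_on_sum => // l _; apply: smooth_onZ => //.
by apply: smooth_on_derive; exact: sF.
Qed.

Lemma dl_lin U a F G x : smooth_family U F -> smooth_family U G -> U x ->
  dl (fun y => a *: F y + G y) x = a *: dl F x + dl G x.
Proof.
move=> sF sG Ux; apply/funext => s.
rewrite -[RHS]/(a * dl F x s + dl G x s) /dl mulr_sumr -big_split /=.
apply: eq_bigr => l _.
set t := _ ++ _; set v := nth _ _ _.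
have dF : derivable (fun y => F y t) x v by exact: smooth_on_derivable (sF t) Ux.
have dG : derivable (fun y => G y t) x v by exact: smooth_on_derivable (sG t) Ux.
rewrite [X in _ * X = _](_ : _ = a * 'D_v (fun y => F y t) x + 'D_v (fun y => G y t) x).
  by rewrite mulrDr mulrCA.
have dZ : derivable (fun y => a * F y t : R^o) x v by exact: derivableZ dF.
by rewrite -(derive_scale a dF) -(derive_addf dZ dG).
Qed.

Lemma dl_homogeneous k F x : (forall y, homogeneous k (F y)) ->
  homogeneous k.+1 (dl F x).
Proof.
move=> hF s sk; apply: big1 => l _.
rewrite [X in derive X _ _](_ : _ = cst 0) ?derive_cst ?mulr0 //.
apply/funext => y; apply: hF; apply: contra sk.
rewrite size_cat size_take size_drop ltn_ord => /eqP <-.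
by rewrite -addnS subnSK ?subnKC // ltnW.
Qed.

Lemma dl_multilinear k F U x : smooth_family U F -> U x ->
  (forall y, kform k (F y)) -> is_multilinear (dl F x).
Proof.
move=> sF Ux kF s1; elim: s1 => [|w s1 IH] in k F sF kF * => s2 a u v /=.
  rewrite !dl_cons derive_linv; last exact: smooth_on_differentiable (sF s2) Ux.
  rewrite (_ : (fun y => iprod _ _) = fun y => a *: iprod u (F y) + iprod v (F y)).
    rewrite (dl_lin _ (smooth_family_iprod u sF) (smooth_family_iprod v sF) Ux) fctE.
    by rewrite opprD addrACA mulrBr.
  by apply/funext => y; apply: iprod_lin; case: (kF y).
rewrite !dl_cons (IH _ _ (smooth_family_iprod w sF) (fun y => iprod_kform w (kF y))).
set t := fun z => s1 ++ z :: s2.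
have dF z : derivable (fun y => F y (t z)) x w by exact: smooth_on_derivable (sF _) Ux.
rewrite [X in X - _](_ : _ = a * 'D_w (fun y => F y (t u)) x + 'D_w (fun y => F y (t v)) x).
  by rewrite opprD addrACA mulrBr.
rewrite -derive_scale // -derive_addf //; last exact: derivableZ.
by congr ('D_w _ x); apply/funext => y; have [_ mF _] := kF y; exact: mF.
Qed.

Lemma dl_kform k F U x : smooth_family U F -> U x ->
  (forall y, kform k (F y)) -> kform k.+1 (dl F x).
Proof.
move=> sF Ux kF; split.
- by apply: dl_homogeneous => y; case: (kF y).
- exact: dl_multilinear kF.
apply: adjacent_alternating; first exact: dl_multilinear kF.
move=> s1; elim: s1 => [|w s1 IH] in k F sF kF * => s2 u /=.
  have FF0 : (fun y => iprod u (iprod u (F y))) = fun=> 0.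
    by apply/funext => y; apply/funext => s; have [_ _ aF] := kF y; exact: (aF [::] [::]).
  rewrite !dl_cons FF0 (_ : dl (fun=> 0) x s2 = 0) ?subr0 ?subrr //.
  by apply: big1 => l _; rewrite (derive_cst (0 : R^o)) mulr0.
rewrite dl_cons (IH _ _ (smooth_family_iprod w sF) (fun y => iprod_kform w (kF y))) subr0.
rewrite (_ : (fun y => _) = cst 0) ?derive_cst //.
by apply/funext => y; have [_ _ aF] := kF y; exact: (aF s1 [::]).
Qed.

Lemma dl_derive U F x v s : open U -> smooth_family U F -> U x ->
  'D_v (fun y => dl F y s) x = dl (fun y t => 'D_v (fun z => F z t) y) x s.
Proof.
move=> oU sF Ux.
have dD l : derivable (fun y => (-1) ^+ l *
    'D_(nth 0 s l) (fun z => F z (take l s ++ drop l.+1 s)) y : R^o) x v.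
  apply: derivableZ; apply: (smooth_on_derivable (U := U)) => //.
  by apply: smooth_on_derive; exact: sF.
rewrite /dl; have [-> _] := derive_sumf (index_enum _) (fun l : 'I_(size s) => dD l).
apply: eq_bigr => l _; rewrite derive_scale; last first.
  by apply: (smooth_on_derivable (U := U)) => //; apply: smooth_on_derive; exact: sF.
by rewrite (derive_comm v (nth 0 s l) oU (sF _) Ux).
Qed.

(** By Cartan's formula, [iota_v d d = D_v d - d D_v + d d iota_v]. The first two terms cancel by
    symmetry of second derivatives, and the last has one argument fewer. *)
Lemma dl_dl U F x s : open U -> smooth_family U F -> U x -> dl (dl F) x s = 0.
Proof.
move=> oU sF Ux; elim: s F sF => [|v s IH] F sF; first exact: dl_nil.
rewrite dl_cons (dl_derive _ _ oU) //.
rewrite (_ : (fun y => iprod v _) = fun y => (-1) *: dl (fun z => iprod v (F z)) y +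
    (fun t => 'D_v (fun z => F z t) y)); last by apply/funext => y; exact: iprod_dl.
rewrite (dl_lin _ (smooth_family_dl oU (smooth_family_iprod v sF)) (smooth_family_derive v sF) Ux).
rewrite form_addE form_scaleE mulN1r opprD addrCA subrr addr0 opprK.
exact/IH/smooth_family_iprod.
Qed.

Lemma smooth_family_wedgep U F G : open U -> smooth_family U F -> smooth_family U G ->
  smooth_family U (fun y => wedgep (F y) (G y)).
Proof.
move=> oU sF sG s; apply: smooth_on_sum => // t _.
by apply: smooth_onM => //; apply: smooth_onZ.
Qed.

Lemma derive_wedgep U F G x v s : smooth_family U F -> smooth_family U G -> U x ->
  'D_v (fun y => wedgep (F y) (G y) s) x =
  wedgep (fun t => 'D_v (fun y => F y t) x) (G x) s +
  wedgep (F x) (fun t => 'D_v (fun y => G y t) x) s.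
Proof.
move=> sF sG Ux.
have dF t : derivable (fun y => F y t) x v by exact: smooth_on_derivable (sF t) Ux.
have dG t : derivable (fun y => G y t) x v by exact: smooth_on_derivable (sG t) Ux.
have dT (t : (size s).-tuple bool) : derivable
  (fun y => (-1) ^+ shuffle_inv t * F y (mask t s) * G y (mask (map negb t) s) : R^o) x v.
  by apply: derivableM => //; apply: derivableZ.
rewrite /wedgep; have [-> _] := derive_sumf (index_enum _) dT.
rewrite -big_split; apply: eq_bigr => t _ /=.
rewrite derive_mulf //; last exact: derivableZ.
by rewrite derive_scale.
Qed.

Lemma dl_wedgep p U F G x s : open U -> smooth_family U F -> smooth_family U G -> U x ->
  (forall y, homogeneous p (F y)) ->
  dl (fun y => wedgep (F y) (G y)) x s =
  wedgep (dl F x) (G x) s + (-1) ^+ p * wedgep (F x) (dl G x) s.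
Proof.
move=> oU sF sG Ux hF; elim: s => [|v s IH] in p F G sF sG hF *.
  by rewrite dl_nil !wedgep_nil !dl_nil mul0r !mulr0 addr0.
rewrite dl_cons (derive_wedgep _ _ sF sG Ux).
rewrite (wedgep_cons _ _ _ (hF x)) (wedgep_cons _ _ _ (dl_homogeneous x hF)).
rewrite (_ : (fun y => iprod v _) = fun y =>
    (-1) ^+ p *: wedgep (F y) (iprod v (G y)) + wedgep (iprod v (F y)) (G y)); last first.
  by apply/funext => y; rewrite (iprod_wedgep _ _ (hF y)) addrC.
have sFv := smooth_family_iprod v sF; have sGv := smooth_family_iprod v sG.
rewrite (dl_lin _ (smooth_family_wedgep oU sF sGv) (smooth_family_wedgep oU sFv sG) Ux).
rewrite form_addE form_scaleE.
rewrite !iprod_dl wedgep_linl wedgep_linr !form_addE !form_scaleE.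
rewrite (IH p F (fun y => iprod v (G y))) //.
rewrite (IH p.-1 (fun y => iprod v (F y)) G) //; last by move=> y; exact: iprod_homogeneous.
(* The truncated predecessor gives the wrong sign at [p = 0], but there the interior product of [F]
   is zero. *)
have E : (-1) ^+ p.-1 * wedgep (iprod v (F x)) (dl G x) s =
    - ((-1) ^+ p * wedgep (iprod v (F x)) (dl G x) s) :> R.
  case: (p) hF => [|q] hF; last by rewrite /= exprS mulN1r mulNr opprK.
  by rewrite iprod_homogeneous0 // wedgep0l mulr0 oppr0.
rewrite E exprS.
set a := (-1) ^+ p; have aa : a * a = 1 by rewrite /a -exprMn mulrNN mulr1 expr1n.
move: a aa (wedgep _ _ _) (wedgep _ _ _) (wedgep _ _ _)(wedgep _ _ _) (wedgep _ _ _) (wedgep _ _ _).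
move=> b bb w1 w2 w3 w4 w5 w6.
have -> : w6 + w5 = w6 + b * b * w5 by rewrite bb mul1r.
ring.
Qed.

End LocalExteriorDerivative.

(** * Pullback by a change of charts *)

Section Pullback.
Context {R : realType} {m : nat}.
Notation V := 'rV[R]_m.
Implicit Types (F : V -> seq V -> R^o) (f g : seq V -> R^o) (U : set V) (s : seq V).

Lemma derive_coord (phi : V -> V) x v a : derivable phi x v ->
  'D_v (fun y => phi y 0 a : R^o) x = ('D_v phi x) 0 a.
Proof. by move=> dphi; rewrite derive_mx // mxE. Qed.

Lemma differentiable_coordf (phi : V -> V) x a : differentiable phi x ->
  differentiable (fun y => phi y 0 a : R^o) x.
Proof.
move=> dphi; apply: (@differentiable_comp _ _ _ _ phi (fun N : V => N 0 a : R^o)) => //.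
exact: differentiable_coord.
Qed.

Lemma smooth_on_coord U (phi : V -> V) a : open U -> smooth_on U phi ->
  smooth_on U (fun y => phi y 0 a : R^o).
Proof.
move=> oU sphi.
apply: (smooth_on_coind oU (C := fun h : V -> R^o => exists2 psi : V -> V,
  smooth_on U psi & h = fun y => psi y 0 a)); last by exists phi.
- move=> _ [psi spsi ->] x Ux; apply: differentiable_coordf.
  exact: smooth_on_differentiable spsi Ux.
- move=> _ v [psi spsi ->]; exists (fun y => ('D_v psi y) 0 a).
    by exists (fun y => 'D_v psi y) => //; exact: smooth_on_derive.
  by move=> x Ux; rewrite derive_coord //; exact: smooth_on_derivable spsi Ux.
Qed.

Lemma derive_comm_rV U (phi : V -> V) x u v : open U -> smooth_on U phi -> U x ->
  'D_u (fun y => 'D_v phi y) x = 'D_v (fun y => 'D_u phi y) x.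
Proof.
move=> oU sphi Ux; apply/rowP => a.
have dd w : smooth_on U (fun y => 'D_w phi y) by exact: smooth_on_derive.
have E w w' : ('D_w (fun y => 'D_w' phi y) x) 0 a =
    'D_w (fun y => 'D_w' (fun z => phi z 0 a : R^o) y) x.
  transitivity ('D_w (fun y => ('D_w' phi y) 0 a : R^o) x).
    by apply/esym/derive_coord; exact: smooth_on_derivable (dd w') Ux.
  apply: near_eq_derive; apply: open_near_eq Ux => // y Uy.
  by rewrite derive_coord //; exact: smooth_on_derivable sphi Uy.
have C := derive_comm u v oU (smooth_on_coord a oU sphi) Ux.
exact: etrans (E u v) (etrans C (esym (E v u))).
Qed.

Lemma derive_comp (phi : V -> V) (g : V -> R^o) x u :
  differentiable phi x -> differentiable g (phi x) ->
  'D_u (fun y => g (phi y)) x = 'D_('D_u phi x) g (phi x).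
Proof.
move=> dphi dg; have dc := differentiable_comp dphi dg.
rewrite (deriveE u dphi) (deriveE _ dg).
exact: etrans (deriveE u dc) (congr1 (fun h : V -> R^o => h u) (diff_comp dphi dg)).
Qed.

(* The derivative of [f (J s)] produced by varying [J] in the direction [H u]. *)
Fixpoint vary (J : V -> V) (H : V -> V -> V) u f s : R^o :=
  if s is v :: s' then f (H u v :: map J s') + vary J H u (iprod (J v) f) s'
  else 0.

Lemma vary_lin J H u a f g s :
  vary J H u (a *: f + g) s = a * vary J H u f s + vary J H u g s.
Proof.
elim: s f g => [|v s IH] f g /=; first by rewrite mulr0 addr0.
by rewrite IH form_addE form_scaleE mulrDr addrACA.
Qed.

Lemma vary_sum J H u (I : Type) (r : seq I) (c : I -> R) (h : I -> seq V -> R^o) s :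
  vary J H u (\sum_(i <- r) c i *: h i) s = \sum_(i <- r) c i * vary J H u (h i) s.
Proof.
elim: r => [|i r IH]; last by rewrite !big_cons vary_lin IH.
by rewrite !big_nil; elim: s => //= v s ->; rewrite addr0.
Qed.

Lemma vary_alternating J H u f s : is_multilinear f -> is_alternating f ->
  vary J H u f s =
  \sum_(l < size s) (-1) ^+ l * f (H u (nth 0 s l) :: map J (take l s ++ drop l.+1 s)).
Proof.
elim: s f => [|v s IH] f mf af /=; first by rewrite big_ord0.
rewrite big_ord_recl /= expr0 mul1r drop0; congr (_ + _).
rewrite IH; [|exact: iprod_multilinear|exact: iprod_alternating].
apply: eq_bigr => l _; rewrite /bump /= add1n exprS mulN1r mulNr -mulrN; congr (_ * _).
exact: alternating_swap.
Qed.

(* The second derivatives of a change of charts do not contribute to the exterior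
   derivative of a pullback, because they are symmetric and [f] is alternating. *)
Lemma vary_symmetric J H f s : is_multilinear f -> is_alternating f ->
  (forall u v, H u v = H v u) ->
  \sum_(l < size s) (-1) ^+ l * vary J H (nth 0 s l) f (take l s ++ drop l.+1 s) = 0.
Proof.
move=> mf af Hs; elim: s f mf af => [|v s IH] f mf af; first by rewrite big_ord0.
rewrite big_ord_recl /= expr0 mul1r drop0 vary_alternating // -big_split /=.
rewrite -[RHS]oppr0 -[in RHS](IH (iprod (J v) f)); last 2 first.
- exact: iprod_multilinear.
- exact: iprod_alternating.
rewrite -sumrN; apply: eq_bigr => l _.
by rewrite /bump /= add1n exprS Hs; ring.
Qed.

(** The product rule: the first term differentiates the coefficients of [F], the second the
    Jacobian. Expanding the first argument in coordinates makes each summand a scalar function times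
    a pullback with one argument fewer. *)
Lemma derive_pullback U U' (phi : V -> V) F x u s :
  open U -> smooth_on U phi -> U x -> U' (phi x) ->
  smooth_family U' F -> (forall y, is_multilinear (F y)) ->
  let G s y := F (phi y) (map (fun v => 'D_v phi y) s) in
  derivable (G s) x u /\
  'D_u (G s) x =
    'D_('D_u phi x) (fun z => F z (map (fun v => 'D_v phi x) s)) (phi x) +
    vary (fun v => 'D_v phi x) (fun u v => 'D_u (fun y => 'D_v phi y) x) u (F (phi x)) s.
Proof.
move=> oU sphi Ux Ux' sF mF G; rewrite {}/G.
have dphi : differentiable phi x by exact: smooth_on_differentiable sphi Ux.
elim: s F sF mF => [|v s IH] F sF mF.
  rewrite addr0; have dF : differentiable (fun z => F z [::]) (phi x).
    exact: smooth_on_differentiable (sF _) Ux'.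
  split; first by apply: diff_derivable; exact: (differentiable_comp dphi dF).
  exact: derive_comp dphi dF.
have sphiv : smooth_on U (fun y => 'D_v phi y) by exact: smooth_on_derive.
pose c a y := (('D_v phi y) 0 a : R^o).
have dc a : derivable (c a) x u.
  exact: smooth_on_derivable (smooth_on_coord a oU sphiv) Ux.
pose Fa a y := iprod (ebase a) (F y).
have IHa a := IH (Fa a) (smooth_family_iprod (ebase a) sF)
  (fun y => iprod_multilinear (ebase a) (mF y)).
pose h a (y : V) := (c a y * Fa a (phi y) (map (fun w => 'D_w phi y) s) : R^o).
have dh a : derivable (h a) x u by apply: derivableM; [exact: dc|exact: (IHa a).1].
have -> : (fun y => F (phi y) (map (fun w => 'D_w phi y) (v :: s))) = fun y => \sum_a h a y.
  by apply/funext => y; rewrite /= multilinear_coord.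
have [-> dsum] := derive_sumf (index_enum _) dh; split=> //.
have E a : 'D_u (h a) x =
  ('D_u (fun y => 'D_v phi y) x) 0 a * Fa a (phi x) (map (fun w => 'D_w phi x) s) +
  (c a x * 'D_('D_u phi x) (fun z => Fa a z (map (fun w => 'D_w phi x) s)) (phi x) +
  c a x * vary (fun w => 'D_w phi x) (fun u v => 'D_u (fun y => 'D_v phi y) x) u (Fa a (phi x)) s).
  rewrite /h derive_mulf; [|exact: dc|exact: (IHa a).1].
  rewrite (IHa a).2.
  rewrite (derive_coord a (smooth_on_derivable sphiv Ux)).
  by rewrite -[X in _ = _ + X]mulrDr.
under eq_bigr do rewrite E.
rewrite !big_split /= [RHS]addrCA; congr (_ + (_ + _)).
- by rewrite multilinear_coord.
- have dF t : derivable (fun z => F z t) (phi x) ('D_u phi x).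
    exact: smooth_on_derivable (sF t) Ux'.
  rewrite (_ : (fun z => F z _) = fun z =>
    \sum_a c a x * Fa a z (map (fun w => 'D_w phi x) s)); last first.
    by apply/funext => z; rewrite multilinear_coord.
  have dFa a : derivable (fun z => c a x * Fa a z (map (fun w => 'D_w phi x) s) : R^o)
      (phi x) ('D_u phi x).
    by apply: derivableZ; exact: dF.
  have [-> _] := derive_sumf (index_enum _) dFa.
  by apply: eq_bigr => a _; rewrite (derive_scale _ (dF _)).
- rewrite -vary_sum; congr (vary _ _ _ _ _); apply/funext => t.
  rewrite fct_sumE /iprod multilinear_coord //.
Qed.

Lemma dl_pullback k U U' (phi : V -> V) F x s :
  open U -> smooth_on U phi -> U x -> U' (phi x) ->
  smooth_family U' F -> (forall y, kform k (F y)) ->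
  dl (fun y t => F (phi y) (map (fun v => 'D_v phi y) t)) x s =
  dl F (phi x) (map (fun v => 'D_v phi x) s).
Proof.
move=> oU sphi Ux Ux' sF kF.
have mF y : is_multilinear (F y) by case: (kF y).
have aF y : is_alternating (F y) by case: (kF y).
rewrite [RHS]/dl size_map.
(* The Jacobian terms sum to zero by [vary_symmetric]; once they are added on the right, both sides
   agree term by term. *)
rewrite -[RHS]addr0 -[X in _ = _ + X](@vary_symmetric (fun v => 'D_v phi x)
  (fun u v => 'D_u (fun y => 'D_v phi y) x) _ s (mF (phi x)) (aF (phi x))); last first.
  by move=> u v; exact: derive_comm_rV oU sphi Ux.
rewrite -big_split; apply: eq_bigr => l _ /=.
have [_ ->] := derive_pullback (nth 0 s l) (take l s ++ drop l.+1 s) oU sphi Ux Ux' sF mF.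
by rewrite -mulrDr (nth_map 0) // map_cat map_take map_drop.
Qed.

End Pullback.

(** * Forms on a manifold *)

Section ManifoldForms.
Context {R : realType} {m : nat} {M : smoothManifold R m}.
Implicit Types (A B : dform M) (i j : atlas_index M).

Lemma open_chart_im i : open (@chart_im R m M i).
Proof. exact: chart_im_open. Qed.

Definition overlap i j : set 'rV[R]_m :=
  [set x | chart_im i x /\ chart_dom (atlas j) (chart_inv (atlas i) x)].

Lemma open_overlap i j : open (overlap i j).
Proof.
rewrite openE => x [ix jx]; apply: filterI.
  by apply: open_nbhs_nbhs; split=> //; exact: open_chart_im.
apply: (chart_inv_cont ix); apply: open_nbhs_nbhs; split=> //.
exact: chart_dom_open.
Qed.

Lemma smooth_transition i j : smooth_on (overlap i j) (transition i j).
Proof. exact: (@atlas_smooth _ _ M i j). Qed.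

Lemma transition_im i j x : overlap i j x -> chart_im j (transition i j x).
Proof. by case=> _ jx; exists (chart_inv (atlas i) x). Qed.

(** The compatibility condition of [Omega], with directional derivatives in place of the
    differential so as to match [dl_pullback]. *)
Definition form_compat A := forall i j x s, overlap i j x ->
  A i x s = A j (transition i j x) (map (fun v => 'D_v (transition i j) x) s).

Lemma OmegaP (k : nat) A : Omega M k A <->
  [/\ forall i x, ~ chart_im i x -> A i x = 0,
      forall i x, kform k (A i x),
      forall i, smooth_family (chart_im i) (A i) & form_compat A].
Proof.
have dE i j x : overlap i j x ->
    map ('d (transition i j) x) = map (fun v => 'D_v (transition i j) x).
  move=> ijx; apply/funext => s; apply: eq_map => v; rewrite deriveE //.
  exact: smooth_on_differentiable (@smooth_transition i j) ijx.
split=> [[A0 [hA [mA [aA [sA cA]]]]]|[A0 kA sA cA]].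
  split=> [i x nx|i x||i j x s ijx].
  - by apply/funext => s; exact: A0.
  - split; [by move=> s sk; apply: hA|exact: mA|exact: aA].
  - exact: sA.
  - by rewrite (cA i j) ?dE //; case: ijx.
split; first by move=> i x s nx; rewrite A0.
split; first by move=> i x s sk; case: (kA i x) => + _ _; apply.
split; first by move=> i x; case: (kA i x).
split; first by move=> i x; case: (kA i x).
split; first exact: sA.
by move=> i j x s ix jx; rewrite (cA i j x s (conj ix jx)) dE.
Qed.

Lemma Omega_eq0 (k : int) A : k < 0 -> Omega M k A -> A = 0.
Proof.
move=> k0 [_ [hA _]]; apply/funext => i; apply/funext => x; apply/funext => s.
by apply: hA; apply: contraTneq k0 => <-; rewrite -leNgt.
Qed.

Lemma OmegaW (P : int -> dform M -> Prop) :
  (forall k, P k 0) -> (forall (k : nat) A, Omega M k A -> P k A) ->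
  forall k A, Omega M k A -> P k A.
Proof.
move=> P0 Pk [k|k] A kA; first exact: Pk.
by rewrite (Omega_eq0 _ kA).
Qed.

Lemma kform0 k : kform k (0 : seq 'rV[R]_m -> R^o).
Proof. by split=> // s1 s2 a u v; rewrite mulr0 addr0. Qed.

Lemma Omega0 k : Omega M k 0.
Proof.
split=> //; split=> //; split; first by move=> *; rewrite mulr0 addr0.
by split=> //; split=> // i s; exact: (@smooth_on_cst _ _ R^o _ 0 (@open_chart_im i)).
Qed.

Lemma Omega_lin k (a : R) A B : Omega M k A -> Omega M k B -> Omega M k (a *: A + B).
Proof.
move=> [A0 [hA [mA [aA [sA cA]]]]] [B0 [hB [mB [aB [sB cB]]]]].
have E i x s : (a *: A + B) i x s = a * A i x s + B i x s by [].
split; first by move=> i x s nx; rewrite E A0 // B0 // mulr0 addr0.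
split; first by move=> i x s nx; rewrite E hA // hB // mulr0 addr0.
split; first by move=> i x s1 s2 c u v; rewrite !E mA mB; ring.
split; first by move=> *; rewrite E aA aB mulr0 addr0.
split; last by move=> i j x s ix jx; rewrite !E (cA i j) ?(cB i j).
move=> i s; apply: smooth_onD; [exact: open_chart_im| |exact: sB].
by apply: smooth_onZ; [exact: open_chart_im|exact: sA].
Qed.

Lemma ext_d_in A i x : chart_im i x -> ext_d A i x = dl (A i) x.
Proof. by move=> ix; apply/funext => s; rewrite /ext_d asboolT. Qed.

Lemma ext_d_out A i x : ~ chart_im i x -> ext_d A i x = 0.
Proof. by move=> ix; apply/funext => s; rewrite /ext_d asboolF. Qed.

Lemma ext_d0 : ext_d (0 : dform M) = 0.
Proof.
apply/funext => i; apply/funext => x; have [ix|ix] := pselect (chart_im i x); last exact: ext_d_out.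
rewrite ext_d_in //; apply/funext => s; apply: big1 => l _.
by rewrite (derive_cst (0 : R^o)) mulr0.
Qed.

Lemma Omega_smooth k A i : Omega M k A -> smooth_family (chart_im i) (A i).
Proof. by case=> _ [_ [_ [_ [sA _]]]]; exact: sA. Qed.

Lemma Omega_kform (k : nat) A i x : Omega M k A -> kform k (A i x).
Proof. by case/OmegaP. Qed.

Lemma ext_d_lin k l (a : R) A B : Omega M k A -> Omega M l B ->
  ext_d (a *: A + B) = a *: ext_d A + ext_d B.
Proof.
move=> kA kB; apply/funext => i; apply/funext => x.
have -> : (a *: ext_d A + ext_d B) i x = a *: ext_d A i x + ext_d B i x by [].
have [ix|ix] := pselect (chart_im i x); last by rewrite !ext_d_out // scaler0 addr0.
by rewrite !ext_d_in // -(dl_lin _ (Omega_smooth (i := i) kA) (Omega_smooth (i := i) kB) ix).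
Qed.

Lemma Omega_ext_d k A : Omega M k A -> Omega M (k + 1) (ext_d A).
Proof.
move: k A; apply: OmegaW => [k|k A]; first by rewrite ext_d0; exact: Omega0.
case/OmegaP => A0 kA sA cA; rewrite -PoszD addn1; apply/OmegaP; split.
- by move=> i x; exact: ext_d_out.
- move=> i x; have [ix|ix] := pselect (chart_im i x).
    by rewrite ext_d_in //; exact: dl_kform (sA i) ix (kA i).
  by rewrite ext_d_out //; exact: kform0.
- move=> i s; have := smooth_family_dl (@open_chart_im i) (sA i) s.
  apply: eq_smooth_on; first exact: open_chart_im.
  by move=> x ix; rewrite ext_d_in.
- move=> i j x s ijx; have [ix _] := ijx; rewrite !ext_d_in //; last exact: transition_im.
  rewrite -(dl_pullback s (@open_overlap i j) (@smooth_transition i j) ijx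
    (transition_im ijx) (sA j) (kA j)).
  rewrite (@dl_near _ _ _ (fun y t => A j (transition i j y)
    (map (fun v => 'D_v (transition i j) y) t)) (overlap i j)) //.
    exact: open_overlap.
  by move=> y ijy; apply/funext => t; exact: cA.
Qed.

Lemma ext_d_ext_d k A : Omega M k A -> ext_d (ext_d A) = 0.
Proof.
move=> kA; apply/funext => i; apply/funext => x.
have [ix|ix] := pselect (chart_im i x); last exact: ext_d_out.
rewrite ext_d_in // (@dl_near _ _ _ (dl (A i)) (chart_im i)) //.
- by apply/funext => s; exact: dl_dl (@open_chart_im i) (Omega_smooth kA) ix.
- exact: open_chart_im.
- by move=> y iy; rewrite ext_d_in.
Qed.

Lemma wedge_lin A (a : R) B B' : wedge A (a *: B + B') = a *: wedge A B + wedge A B'.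
Proof. by apply/funext => i; apply/funext => x; exact: wedgep_linr. Qed.

Lemma wedge0 A : wedge A 0 = 0.
Proof. by apply/funext => i; apply/funext => x; exact: wedgep0r. Qed.

Lemma Omega_wedge (p : nat) k A B : Omega M p A -> Omega M k B -> Omega M (p%:Z + k) (wedge A B).
Proof.
move=> pA; move: k B; apply: OmegaW => [k|k B kB].
  rewrite wedge0; exact: Omega0.
have [A0 kA sA cA] := (OmegaP _ _).1 pA; have [B0 kfB sB cB] := (OmegaP _ _).1 kB.
rewrite -PoszD; apply/OmegaP; split=> [i x nx|i x|i|i j x s ijx].
- by rewrite -[LHS]/(wedgep (A i x) (B i x)) A0 // wedgep0l.
- exact: wedgep_kform.
- by apply: smooth_family_wedgep => //; exact: open_chart_im.
- rewrite /wedge size_map; apply: eq_bigr => t _.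
  by rewrite -!map_mask -cA // -cB.
Qed.

Lemma ext_d_wedge (p : nat) k A B : Omega M p A -> Omega M k B ->
  ext_d (wedge A B) = wedge (ext_d A) B + (-1) ^+ p *: wedge A (ext_d B).
Proof.
move=> pA kB; apply/funext => i; apply/funext => x; apply/funext => s.
rewrite -[RHS]/(wedgep (ext_d A i x) (B i x) s + (-1) ^+ p * wedgep (A i x) (ext_d B i x) s).
have [ix|ix] := pselect (chart_im i x); last first.
  by rewrite !ext_d_out // wedgep0l wedgep0r /= mulr0 addr0.
rewrite !ext_d_in //; apply: (@dl_wedgep _ _ _ (chart_im i)) => //.
- exact: open_chart_im.
- exact: Omega_smooth pA.
- exact: Omega_smooth kB.
- by move=> y; case: (Omega_kform i y pA).
Qed.

Lemma Omega_dim k A : (m%:Z < k) -> Omega M k A -> A = 0.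
Proof.
case: k => // k mk kA; apply/funext => i; apply/funext => x.
by apply: kform_eq0 (Omega_kform i x kA) _.
Qed.

End ManifoldForms.

(** * The operator Lambda on a symplectic manifold *)

Section SymplecticForms.
Context {R : realType} {n : nat} {M : symplecticManifold R n}.
Implicit Types (A B : dform M) (i j : atlas_index M).

(** Off the image of the chart the Gram matrix need not be invertible, but genuine forms vanish
    there, so the default value of [invmx] is harmless. *)
Definition Lam A : dform M := fun i x => contr (dual_gram (sform M i x)) (A i x).

Lemma sform_kform i x : kform 2 (sform M i x).
Proof. exact: Omega_kform (sform_form M). Qed.

Lemma sform_gram_unit i x : chart_im i x -> gram (sform M i x) \in unitmx.
Proof.
move=> ix; apply: gram_unit; first by case: (sform_kform i x).
by move=> u; exact: sform_nondegenerate.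
Qed.

Lemma smooth_on_det (V : normedModType R) (U : set V) p (N : V -> 'M[R]_p) : open U ->
  (forall a b, smooth_on U (fun x => N x a b : R^o)) ->
  smooth_on U (fun x => \det (N x) : R^o).
Proof.
move=> oU sN; apply: smooth_on_sum => // s _; apply: smooth_onM => //.
  exact: (@smooth_on_cst _ _ R^o).
exact: smooth_on_prod.
Qed.

(** Cramer's rule: the entries are cofactors divided by a determinant without zeros on the chart. *)
Lemma smooth_dual_gram i a b :
  smooth_on (chart_im i) (fun x => dual_gram (sform M i x) a b : R^o).
Proof.
have oU := @open_chart_im _ _ M i.
have sG c e : smooth_on (chart_im i) (fun x => gram (sform M i x) c e : R^o).
  under eq_fun do rewrite mxE.
  exact: (Omega_smooth (sform_form M)).
apply: (@eq_smooth_on _ _ R^o _ (fun x => (\det (gram (sform M i x)))^-1 *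
    (\adj (gram (sform M i x)) b a))) => //.
  by move=> x ix; rewrite /dual_gram [RHS]mxE /invmx sform_gram_unit // [RHS]mxE.
apply: smooth_onM => //.
  apply: smooth_onV => //; last exact: smooth_on_det.
  by move=> x /sform_gram_unit; rewrite unitmxE unitfE.
under eq_fun do rewrite mxE /cofactor.
apply: smooth_onZ => //; apply: smooth_on_det => // c e.
under eq_fun do rewrite !mxE.
exact: (Omega_smooth (sform_form M)).
Qed.

Lemma Lam0 : Lam 0 = 0.
Proof.
apply/funext => i; apply/funext => x; apply/funext => s; rewrite /Lam contrE.
by rewrite big1 ?mulr0 // => a _; rewrite big1 // => b _; rewrite mulr0.
Qed.

Lemma Omega_Lam k A : Omega M k A -> Omega M (k - 2) (Lam A).
Proof.
move: k A; apply: OmegaW => [k|k A kA]; first by rewrite Lam0; exact: Omega0.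
have [A0 kfA sA cA] := (OmegaP _ _).1 kA.
(* Here [k - 2] is negative while [k.-2] is truncated to [0], so the contraction has to be shown to
   vanish. *)
have [k2|k2] := ltnP k 2.
  suff -> : Lam A = 0 by exact: Omega0.
  apply/funext => i; apply/funext => x; apply/funext => s; rewrite /Lam contrE.
  rewrite big1 ?mulr0 // => a _; rewrite big1 // => b _; have [hA _ _] := kfA i x.
  by rewrite hA ?mulr0 //; apply: contraTneq k2 => <-.
have -> : k%:Z - 2 = k.-2%:Z by lia.
apply/OmegaP; split=> [i x nx|i x|i s|i j x s ijx].
- apply/funext => s; rewrite /Lam contrE A0 //.
  by rewrite big1 ?mulr0 // => a _; rewrite big1 // => b _; rewrite mulr0.
- exact: contr_kform.
- have oU := @open_chart_im _ _ M i.
  rewrite /Lam; under eq_fun do rewrite contrE.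
  apply: smooth_onZ => //; apply: smooth_on_sum => // a _; apply: smooth_on_sum => // b _.
  by apply: smooth_onM => //; [exact: smooth_dual_gram|exact: sA].
- have [_ mAj _] := kfA j (transition i j x).
  have [ix _] := ijx; have jx := transition_im ijx.
  have [_ _ _ cS] := (OmegaP _ _).1 (sform_form M).
  set J := fun v => 'D_v (transition i j) x.
  have AJ : A i x = A j (transition i j x) \o map J by apply/funext => t; exact: cA.
  have SJ : sform M i x = sform M j (transition i j x) \o map J by apply/funext => t; exact: cS.
  rewrite /Lam AJ contr_pullback // SJ dual_gram_pullback //.
  - by case: (sform_kform j (transition i j x)).
  - exact: sform_gram_unit.
  - by rewrite -SJ; exact: sform_gram_unit.
Qed.

Lemma Lam_L k A : Omega M k A ->
  Lam (wedge (sform M) A) = wedge (sform M) (Lam A) + (n%:Z - k)%:~R *: A.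
Proof.
move: k A; apply: OmegaW => [k|k A kA]; first by rewrite wedge0 Lam0 wedge0 scaler0 addr0.
have [A0 kfA _ _] := (OmegaP _ _).1 kA.
apply/funext => i; apply/funext => x.
rewrite -[RHS]/(wedgep (sform M i x) (contr (dual_gram (sform M i x)) (A i x)) +
  (n%:Z - k%:Z)%:~R *: A i x).
have [ix|ix] := pselect (chart_im i x).
  rewrite -[LHS]/(contr _ (wedgep (sform M i x) (A i x))).
  rewrite (contr_wedgep (sform_kform i x) _ (kfA i x)); last exact/dual_gramP/sform_gram_unit.
  by congr (_ + _ *: _); rewrite rmorphB /= -!pmulrn -muln2 natrM mulfK.
rewrite A0 // scaler0 addr0 -[LHS]/(contr _ (wedgep (sform M i x) (A i x))) A0 // wedgep0r.
have c0 P : contr P (0 : seq 'rV[R]_(n.*2) -> R^o) = 0.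
  by apply/funext => s; rewrite contrE big1 ?mulr0 // => a _; rewrite big1 // => b _; rewrite mulr0.
by rewrite !c0 wedgep0r.
Qed.

End SymplecticForms.

(** * Hard Lefschetz *)

Section HardLefschetz.
Context {R : realType} {n : nat} {M : symplecticManifold R n}.
Implicit Types (A B C D : dform M) (k m : int) (q j : nat).
Notation L := (wedge (sform M)).

Lemma Lpow_lin q (a : R) A B : Lpow q (a *: A + B) = a *: Lpow q A + Lpow q B.
Proof. by elim: q => //= q ->; exact: wedge_lin. Qed.

Lemma Lpow0 q : Lpow q (0 : dform M) = 0.
Proof. by elim: q => //= q ->; exact: wedge0. Qed.

Lemma LpowS q A : Lpow q.+1 A = L (Lpow q A).
Proof. by []. Qed.

Lemma LpowSr q A : Lpow q.+1 A = Lpow q (L A).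
Proof. exact: iterSr. Qed.

Lemma LpowD q j A : Lpow (q + j) A = Lpow q (Lpow j A).
Proof. exact: iterD. Qed.

Lemma LpowDf q A B : Lpow q (A + B) = Lpow q A + Lpow q B.
Proof. by rewrite -[A in LHS]scale1r Lpow_lin scale1r. Qed.

Lemma LpowZ q (a : R) A : Lpow q (a *: A) = a *: Lpow q A.
Proof. by rewrite -[_ *: A]addr0 Lpow_lin Lpow0 addr0. Qed.

Lemma LpowN q A : Lpow q (- A) = - Lpow q A.
Proof. by rewrite -scaleN1r LpowZ scaleN1r. Qed.

Lemma LpowB q A B : Lpow q (A - B) = Lpow q A - Lpow q B.
Proof. by rewrite LpowDf LpowN. Qed.

Lemma Lpow_sum q (I : Type) (r : seq I) (P : pred I) (F : I -> dform M) :
  Lpow q (\sum_(i <- r | P i) F i) = \sum_(i <- r | P i) Lpow q (F i).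
Proof. by rewrite (big_morph (Lpow q) (LpowDf q) (Lpow0 q)). Qed.

Lemma OmegaZ k (a : R) A : Omega M k A -> Omega M k (a *: A).
Proof. by move=> kA; rewrite -[_ *: A]addr0; apply: Omega_lin => //; exact: Omega0. Qed.

Lemma OmegaD k A B : Omega M k A -> Omega M k B -> Omega M k (A + B).
Proof. by move=> kA kB; rewrite -[A]scale1r; exact: Omega_lin. Qed.

Lemma OmegaN k A : Omega M k A -> Omega M k (- A).
Proof. by move=> kA; rewrite -scaleN1r; exact: OmegaZ. Qed.

Lemma OmegaB k A B : Omega M k A -> Omega M k B -> Omega M k (A - B).
Proof. by move=> kA kB; apply: OmegaD => //; rewrite -scaleN1r; exact: OmegaZ. Qed.

Lemma Omega_sum k (I : Type) (r : seq I) (P : pred I) (F : I -> dform M) :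
  (forall i, P i -> Omega M k (F i)) -> Omega M k (\sum_(i <- r | P i) F i).
Proof. by move=> kF; apply: big_ind => //; [exact: Omega0|exact: OmegaD]. Qed.

Lemma Omega_L k A : Omega M k A -> Omega M (k + 2) (L A).
Proof. by rewrite addrC; exact: Omega_wedge (sform_form M). Qed.

Lemma Omega_Lpow k q A : Omega M k A -> Omega M (k + q.*2%:Z) (Lpow q A).
Proof.
move=> kA; elim: q => [|q IH]; first by rewrite addr0.
have -> : k + q.+1.*2%:Z = k + q.*2%:Z + 2 by rewrite doubleS; lia.
exact: Omega_L.
Qed.

Lemma Lam_lin (c : R) A B : Lam (c *: A + B) = c *: Lam A + Lam B.
Proof.
apply/funext => i; apply/funext => x; apply/funext => s.
rewrite -[RHS]/(c * contr _ (A i x) s + contr _ (B i x) s).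
rewrite /Lam !contrE [c * _]mulrCA -mulrDr; congr (_ * _).
rewrite mulr_sumr -big_split /=; apply: eq_bigr => a _.
rewrite mulr_sumr -big_split /=; apply: eq_bigr => b _.
by rewrite mulrCA -mulrDr.
Qed.

Lemma LamZ (c : R) A : Lam (c *: A) = c *: Lam A.
Proof. by rewrite -[_ *: A]addr0 Lam_lin Lam0 addr0. Qed.

(** Moving [Lam] past [q + 1] factors [L] collects [n - k - 2i] for [0 <= i <= q], whose sum is the
    coefficient. *)
Lemma Lam_Lpow k q A : Omega M k A ->
  Lam (Lpow q.+1 A) = Lpow q.+1 (Lam A) + (q.+1%:Z * (n%:Z - k - q%:Z))%:~R *: Lpow q A.
Proof.
move=> kA; elim: q => [|q IH].
  by rewrite subr0 mul1r; exact: Lam_L.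
rewrite LpowS (Lam_L (Omega_Lpow q.+1 kA)) {}IH.
rewrite -[L (_ + _)]/(Lpow 1 (_ + _)) LpowDf (LpowZ 1 (_%:~R)) -addrA.
rewrite -[Lpow 1 (Lpow q A)]/(Lpow q.+1 A) -scalerDl -intrD.
by congr (_ + _%:~R *: _); rewrite doubleS; lia.
Qed.

Lemma intr_scale_eq0 (c : int) A : c != 0 -> c%:~R *: A = 0 -> A = 0.
Proof.
move=> c0 cA; have c0' : (c%:~R : R) != 0 by rewrite intr_eq0.
by rewrite -[A]scale1r -(mulVf c0') -scalerA cA scaler0.
Qed.
(** If [L^(q+1) A = 0], applying [Lam] and then [L] gives [L^(q+2) (Lam A) = 0], so [Lam A = 0] by
    induction on the degree. The commutator then leaves a nonzero multiple of [L^q A], and induction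
    on [q] concludes. [N] bounds the degree, the base case being negative degrees. *)
Lemma Lpow_inj k q A : Omega M k A -> k + q%:Z <= n%:Z -> Lpow q A = 0 -> A = 0.
Proof.
move=> kA kq; have [N kN] : exists N : nat, k < N%:Z.
  by exists `|k|.+1; lia.
elim: N k A q kA kq kN => [|N IH] k A q kA kq kN; first by rewrite (Omega_eq0 _ kA).
elim: q kq => [//|q IHq] kq Lq.
have LamA : Lam A = 0.
  apply: (IH (k - 2) _ q.+2); [exact: Omega_Lam|lia|lia|].
  have := Lam_Lpow q kA; rewrite Lq Lam0 => /esym/(congr1 (Lpow 1)).
  by rewrite LpowDf (LpowZ 1 (_%:~R)) -[Lpow 1 (Lpow q A)]/(Lpow q.+1 A) Lq scaler0 addr0 Lpow0.
apply: IHq; first by lia.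
have := Lam_Lpow q kA; rewrite Lq LamA Lam0 Lpow0 add0r => /esym.
by apply: intr_scale_eq0; rewrite mulf_neq0 //; lia.
Qed.
Lemma Omega_iter_Lam k q A : Omega M k A -> Omega M (k - q.*2%:Z) (iter q Lam A).
Proof.
move=> kA; elim: q => [|q IH]; first by rewrite subr0.
have -> : k - q.+1.*2%:Z = k - q.*2%:Z - 2 by rewrite doubleS; lia.
exact: Omega_Lam.
Qed.
(** The mirror image of [Lam_Lpow] on a form killed by [L]; the coefficient is the sum of
    [m - n - 2i] for [0 <= i <= q]. *)
Lemma L_iter_Lam m q D : Omega M m D -> L D = 0 ->
  L (iter q.+1 Lam D) = (q.+1%:Z * (m - n%:Z - q%:Z))%:~R *: iter q Lam D.
Proof.
move=> mD LD.
have LL i : L (Lam (iter i Lam D)) = Lam (L (iter i Lam D)) +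
    (m - i.*2%:Z - n%:Z)%:~R *: iter i Lam D.
  rewrite (Lam_L (Omega_iter_Lam i mD)) -addrA -scalerDl -intrD.
  by rewrite (_ : _ + _ = 0 :> int) ?scale0r ?addr0 //; lia.
elim: q => [|q IH].
  by rewrite [LHS](LL 0%N) LD Lam0 add0r; congr (_%:~R *: _); lia.
rewrite [LHS](LL q.+1) IH LamZ -scalerDl -intrD; congr (_%:~R *: _).
by rewrite doubleS; lia.
Qed.
(** Descending induction on the degree, from degrees above [2n]. Two degrees up, [L A = L^(q+1) E],
    so [D = A - L^q E] is killed by [L], and such a form is a multiple of [L^q Lam^q D]. *)
Lemma Lpow_surj m q A : Omega M m A -> n%:Z + q%:Z <= m ->
  exists2 B, Omega M (m - q.*2%:Z) B & A = Lpow q B.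
Proof.
move=> mA nq; have [N mN] : exists N : nat, n.*2%:Z < m + N%:Z.
  by exists (n.*2).+1; lia.
elim: N m A q mA nq mN => [|N IH] m A q mA nq mN.
  exists 0; first exact: Omega0.
  by rewrite Lpow0; apply: Omega_dim mA; move: mN; rewrite addr0.
have [||E mE LE] := IH (m + 2) (L A) q.+1 (Omega_L mA); [lia|lia|].
have {}mE : Omega M (m - q.*2%:Z) E.
  by have -> : m - q.*2%:Z = m + 2 - q.+1.*2%:Z by rewrite doubleS; lia.
have mLE : Omega M m (Lpow q E) by have := Omega_Lpow q mE; rewrite subrK.
pose D := A - Lpow q E.
have mD : Omega M m D by exact: OmegaB.
have LD : L D = 0 by rewrite -[L D]/(Lpow 1 D) LpowB -[Lpow 1 (Lpow q E)]/(Lpow q.+1 E) -LE subrr.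
(* [c] is the product of [(i + 1) * (m - n - i)] for [i < q]; no factor vanishes because
   [q <= m - n]. *)
have [c c0 cD] : exists2 c : int, c != 0 & Lpow q (iter q Lam D) = c%:~R *: D.
  elim: (q) nq => [|i IHi] ni; first by exists 1; rewrite //= scale1r.
  have [|c c0 cD] := IHi; first by lia.
  exists (i.+1%:Z * (m - n%:Z - i%:Z) * c); first by rewrite !mulf_neq0 //; lia.
  by rewrite LpowSr (L_iter_Lam _ mD LD) LpowZ cD scalerA -intrM.
exists (E + c%:~R^-1 *: iter q Lam D).
  by apply: OmegaD => //; apply: OmegaZ; exact: Omega_iter_Lam.
rewrite LpowDf LpowZ cD scalerA mulVf ?intr_eq0 // scale1r.
by rewrite /D addrC subrK.
Qed.
End HardLefschetz.

(** * The Lefschetz decomposition *)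

Section LefschetzDecomposition.
Context {R : realType} {n : nat} {M : symplecticManifold R n}.
Implicit Types (A B C D : dform M).
Notation L := (wedge (sform M)).

Lemma primitive_Omega (k : int) B : primitive M k B -> Omega M k B.
Proof. by rewrite /primitive /=; case: ifP => _ => [[]//|->]; exact: Omega0. Qed.

Lemma primitive0 (k : int) : primitive M k 0.
Proof. by rewrite /primitive /=; case: ifP => // _; split; [exact: Omega0|exact: Lpow0]. Qed.

Lemma primitive_lin (k : int) (a : R) B C : primitive M k B -> primitive M k C ->
  primitive M k (a *: B + C).
Proof.
rewrite /primitive /=; case: ifP => _ => [[kB LB] [kC LC]|-> ->].
  by split; [exact: Omega_lin|rewrite Lpow_lin LB LC scaler0 addr0].
by rewrite scaler0 addr0.
Qed.

Lemma primitive_nat (s : nat) B : (s <= n)%N ->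
  primitive M s B <-> Omega M s B /\ Lpow (n.+1 - s) B = 0.
Proof. by move=> sn; rewrite /primitive /= lez_nat sn. Qed.

Lemma primitive_Lpow (k : int) q B : primitive M k B -> n%:Z < k + q%:Z -> Lpow q B = 0.
Proof.
rewrite /primitive /=; case: ifP => [k0n|_ -> _]; last exact: Lpow0.
move=> [_ LB] nq.
have -> : q = ((q - (n.+1 - `|k|)) + (n.+1 - `|k|))%N by lia.
by rewrite LpowD LB Lpow0.
Qed.

Lemma lefschetz_lin (k : nat) (a : R) A A' (B B' : nat -> dform M) :
  lefschetz_decomp k A B -> lefschetz_decomp k A' B' ->
  lefschetz_decomp k (a *: A + A') (fun j => a *: B j + B' j).
Proof.
move=> [pB ->] [pB' ->]; split.
  move=> j; have := pB j; have := pB' j; case: ifP => _ pB'j pBj.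
    exact: primitive_lin.
  by rewrite pBj pB'j scaler0 addr0.
rewrite scaler_sumr -big_split; apply: eq_bigr => j _.
by rewrite Lpow_lin.
Qed.

Lemma lefschetz_Omega (k : nat) A (B : nat -> dform M) j :
  lefschetz_decomp k A B -> (k - n <= j <= k./2)%N -> Omega M (k%:Z - j.*2%:Z) (B j).
Proof. by case=> pB _ kj; have := pB j; rewrite kj; exact: primitive_Omega. Qed.

Lemma lefschetz_out (k : nat) A (B : nat -> dform M) j :
  lefschetz_decomp k A B -> ~~ (k - n <= j <= k./2)%N -> B j = 0.
Proof. by case=> pB _ /negbTE kj; have := pB j; rewrite kj. Qed.

(** With [C] the sum of the remaining terms divided by [L], [L^(n+1-k)] kills the primitive [B 0]
    and leaves [L^(n+2-k) C = 0]. Injectivity in degree [k - 2] gives [C = 0], so [B 0 = 0], and the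
    induction continues with [C]. *)
Lemma lefschetz_unique0_low (k : nat) (B : nat -> dform M) : (k <= n)%N ->
  lefschetz_decomp k 0 B -> forall j, B j = 0.
Proof.
elim/ltn_ind: k B => k IH B kn dB.
have kn0 : (k - n = 0)%N by lia.
pose C := \sum_(0 <= j < k./2) Lpow j (B j.+1).
have E0 : 0 = B 0%N + L C.
  case: (dB) => _; rewrite kn0 big_nat_recl // => ->; congr (_ + _).
  rewrite -[L C]/(Lpow 1 C) Lpow_sum; apply: eq_bigr => j _.
  by rewrite -LpowD.
have C0 : C = 0.
  apply: (@Lpow_inj _ _ _ (k%:Z - 2) (n.+2 - k)).
  - rewrite /C big_nat; apply: Omega_sum => j jk.
    have -> : k%:Z - 2 = k%:Z - j.+1.*2%:Z + j.*2%:Z by rewrite doubleS; lia.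
    by apply: Omega_Lpow; apply: lefschetz_Omega dB _; lia.
  - by lia.
  - have [pB _] := dB; have := pB 0%N; rewrite kn0 /= subr0 => /(primitive_Lpow (q := n.+1 - k)).
    have -> : (n.+2 - k = n.+1 - k + 1)%N by lia.
    move=> LB; rewrite LpowD; have := congr1 (Lpow (n.+1 - k)) E0.
    by rewrite Lpow0 LpowDf LB ?add0r //; lia.
have B0 : B 0%N = 0 by rewrite E0 C0 wedge0 addr0.
move=> [//|j]; have [k2|k2] := ltnP k 2.
  by apply: lefschetz_out dB _; lia.
apply: (IH k.-2 _ (fun j => B j.+1)); [lia|lia|split].
  move=> i; have [pB _] := dB; have := pB i.+1; rewrite kn0.
  have -> : (k.-2 - n <= i <= k.-2./2)%N = (0 <= i.+1 <= k./2)%N by lia.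
  case: ifP => // _; congr (primitive _ _ _); rewrite doubleS; lia.
have -> : (k.-2 - n = 0)%N by lia.
have -> : k.-2./2.+1 = k./2 by lia.
by rewrite -/C C0.
Qed.

(** In degree [n + m] the decomposition starts at [j = m], so it is [L^m] of a decomposition in
    degree [n - m]; this reduces uniqueness to degrees up to [n]. *)
Lemma lefschetz_shift (k m : nat) A (B : nat -> dform M) :
  (k <= n)%N -> (k + m = n)%N -> lefschetz_decomp (n + m) A B ->
  exists2 C, lefschetz_decomp k C (fun j => B (j + m)%N) & A = Lpow m C.
Proof.
move=> kn km [pB AB].
exists (\sum_(0 <= j < k./2.+1) Lpow j (B (j + m)%N)).
  split; last by have -> : (k - n = 0)%N by lia.
  move=> j; have := pB (j + m)%N.
  have -> : (k - n <= j <= k./2)%N = (n + m - n <= j + m <= (n + m)./2)%N by lia.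
  by case: ifP => // _; congr (primitive _ _ _); lia.
rewrite AB Lpow_sum; have -> : (n + m - n = 0 + m)%N by lia.
rewrite big_addn; have -> : ((n + m)./2.+1 - m = k./2.+1)%N by lia.
by apply: eq_bigr => j _; rewrite -LpowD addnC.
Qed.

Lemma lefschetz_unique0 (k : nat) (B : nat -> dform M) :
  lefschetz_decomp k 0 B -> forall j, B j = 0.
Proof.
move=> dB; have [kn|nk] := leqP k n; first exact: lefschetz_unique0_low dB.
have [nk2 j|k2n] := ltnP n.*2 k.
  by apply: lefschetz_out dB _; lia.
have [m km] : exists m, k = (n + m)%N by exists (k - n)%N; lia.
move: dB; rewrite km => dB.
have [||C dC /esym LC] := @lefschetz_shift (n - m) m _ _ _ _ dB; [lia|lia|].
have C0 : C = 0.
  apply: (@Lpow_inj _ _ _ (n - m)%N%:Z m) => //; last by lia.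
  case: dC => pB ->; rewrite big_nat; apply: Omega_sum => j jk.
  have -> : (n - m)%N%:Z = (n - m)%N%:Z - j.*2%:Z + j.*2%:Z by lia.
  apply: Omega_Lpow; apply: primitive_Omega; have := pB j.
  by have -> : (n - m - n <= j <= (n - m)./2)%N by lia.
move: dC; rewrite C0 => /lefschetz_unique0_low B0 j.
have [jm|mj] := ltnP j m; first by apply: lefschetz_out dB _; lia.
by rewrite -(subnK mj) B0 //; lia.
Qed.

Lemma lefschetz_unique (k : nat) A (B B' : nat -> dform M) :
  lefschetz_decomp k A B -> lefschetz_decomp k A B' -> B = B'.
Proof.
move=> dB dB'; apply/funext => j; have := lefschetz_lin (-1) dB' dB.
have -> : -1 *: A + A = 0 by rewrite scaleN1r addNr.
by move=> /lefschetz_unique0/(_ j)/eqP; rewrite scaleN1r addrC subr_eq0 => /eqP.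
Qed.

(** By surjectivity [L^(n+1-k) A = L^(n+2-k) A'] for some [A'] of degree [k - 2], which makes
    [A - L A'] primitive; [A'] is then decomposed by induction. *)
Lemma lefschetz_exists_low (k : nat) A : (k <= n)%N -> Omega M k A ->
  exists B : nat -> dform M, lefschetz_decomp k A B.
Proof.
elim/ltn_ind: k A => k IH A kn kA.
have kn0 : (k - n = 0)%N by lia.
have LA : Omega M (n.*2.+2 - k)%N (Lpow (n.+1 - k) A).
  have := Omega_Lpow (n.+1 - k) kA.
  by have -> : k%:Z + (n.+1 - k).*2%:Z = (n.*2.+2 - k)%N%:Z by lia.
have [|A' kA' LA'] := Lpow_surj (q := n.+2 - k) LA; first by lia.
have {}kA' : Omega M (k%:Z - 2) A'.
  by have -> : k%:Z - 2 = (n.*2.+2 - k)%N%:Z - (n.+2 - k).*2%:Z by lia.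
pose B0 : dform M := A - L A'.
have pB0 : primitive M k B0.
  apply/primitive_nat => //; split.
    apply: OmegaB => //; have := Omega_L kA'.
    by rewrite subrK.
  rewrite LpowB LA' -LpowSr; have -> : (n.+2 - k = (n.+1 - k).+1)%N by lia.
  by rewrite subrr.
have EA : A = B0 + L A' by rewrite subrK.
have [k2|k2] := ltnP k 2.
  have A'0 : A' = 0 by apply: Omega_eq0 kA'; lia.
  exists (fun j : nat => match j return dform M with 0%N => B0 | _ => 0 end); split.
    move=> [|j]; first by rewrite kn0 /= subr0.
    by have -> : (k - n <= j.+1 <= k./2)%N = false by lia.
  rewrite kn0; have -> : (k./2 = 0)%N by lia.
  by rewrite big_nat1 /= EA A'0 wedge0 addr0.
have [|||B' [pB' AB']] := IH k.-2 _ A'; [lia|lia| |].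
  by have -> : k.-2%:Z = k%:Z - 2 by lia.
exists (fun j => if j is j'.+1 then B' j' else B0); split.
  move=> [|j]; first by rewrite kn0 /= subr0.
  have -> : (k - n <= j.+1 <= k./2)%N = (k.-2 - n <= j <= k.-2./2)%N by lia.
  by have := pB' j; case: ifP => // _; congr (primitive _ _ _); rewrite doubleS; lia.
rewrite EA kn0 big_nat_recl //; congr (_ + _).
rewrite AB'; have -> : (k.-2 - n = 0)%N by lia.
have -> : k.-2./2.+1 = k./2 by lia.
by rewrite -[L _]/(Lpow 1 _) Lpow_sum; apply: eq_bigr => j _; rewrite -LpowD.
Qed.

Lemma lefschetz_exists (k : nat) A : Omega M k A ->
  exists B : nat -> dform M, lefschetz_decomp k A B.
Proof.
move=> kA; have [kn|nk] := leqP k n; first exact: lefschetz_exists_low.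
have [k2|k2] := ltnP n.*2 k.
  exists (fun=> 0); split.
    by move=> j; case: ifP => // _; exact: primitive0.
  rewrite big1 => [|j _]; last exact: Lpow0.
  by apply: Omega_dim kA; lia.
have [m km] : exists m, k = (n + m)%N by exists (k - n)%N; lia.
have [|C kC AC] := Lpow_surj (q := m) kA; first by lia.
have {}kC : Omega M (n - m)%N C.
  by have -> : (n - m)%N%:Z = k%:Z - m.*2%:Z by lia.
have [|B [pB CB]] := lefschetz_exists_low _ kC; first by lia.
exists (fun j => if (j < m)%N then 0 else B (j - m)%N); split.
  move=> j; have [jm|mj] := ltnP j m.
    by have -> : (k - n <= j <= k./2)%N = false by lia.
  have -> : (k - n <= j <= k./2)%N = (n - m - n <= j - m <= (n - m)./2)%N by lia.
  by have := pB (j - m)%N; case: ifP => // _; congr (primitive _ _ _); lia.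
have -> : (k - n = 0 + m)%N by lia.
rewrite big_addn; have -> : (k./2.+1 - m = (n - m)./2.+1)%N by lia.
rewrite AC CB Lpow_sum; have -> : (n - m - n = 0)%N by lia.
apply: eq_bigr => j _; rewrite -LpowD addnC ltnNge leq_addl /= addnK.
by [].
Qed.

Lemma hpart_Omega (k : nat) A : Omega M k A -> hpart k A = A.
Proof.
move=> [_ [hA _]]; apply/funext => i; apply/funext => x; apply/funext => s.
rewrite /hpart; case: ifP => // sk; rewrite hA //.
by apply/eqP => -[] sk'; rewrite sk' eqxx in sk.
Qed.

Lemma hpart_Omega0 (l : int) (k : nat) A : Omega M l A -> l != k -> hpart k A = 0.
Proof.
move=> [_ [hA _]] lk; apply/funext => i; apply/funext => x; apply/funext => s.
rewrite /hpart; case: eqP => // sk; apply: hA; rewrite sk.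
by rewrite eq_sym.
Qed.

Lemma lefschetz0 (k : nat) : lefschetz_decomp k (0 : dform M) (fun=> 0).
Proof.
split; first by move=> j; case: ifP => // _; exact: primitive0.
by rewrite big1 // => j _; exact: Lpow0.
Qed.

Lemma lcomp_eq (k : nat) A (B : nat -> dform M) : Omega M k A -> lefschetz_decomp k A B ->
  lcomp k A = B.
Proof.
move=> kA dB; rewrite /lcomp hpart_Omega //.
by case: xgetP => [B' _ dB'|/(_ B)//]; exact: lefschetz_unique dB' dB.
Qed.

Lemma lcompP (k : nat) A : Omega M k A -> lefschetz_decomp k A (lcomp k A).
Proof. by move=> kA; have [B dB] := lefschetz_exists kA; rewrite (lcomp_eq kA dB). Qed.

Lemma lcomp_other (l : int) (k : nat) A : Omega M l A -> l != k -> lcomp k A = fun=> 0.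
Proof.
move=> lA lk; rewrite /lcomp (hpart_Omega0 lA lk).
case: xgetP => [B' _ dB'|/(_ (fun=> 0))]; first exact: lefschetz_unique dB' (lefschetz0 k).
by case; exact: lefschetz0.
Qed.

Lemma lcomp_lin (l : int) (k : nat) (a : R) A B : Omega M l A -> Omega M l B ->
  lcomp k (a *: A + B) = fun j => a *: lcomp k A j + lcomp k B j.
Proof.
move=> lA lB; have lAB := Omega_lin a lA lB.
have [lk|lk] := eqVneq l k; last first.
  by rewrite !(lcomp_other _ lk) //; apply/funext => j; rewrite scaler0 addr0.
move: lA lB lAB; rewrite lk => lA lB lAB.
by apply: lcomp_eq => //; apply: lefschetz_lin; exact: lcompP.
Qed.

Lemma lcomp_term s j B : primitive M s%:Z B -> (s + j <= n)%N ->
  lcomp (s + j.*2)%N (Lpow j B) = fun i => if i == j then B else 0.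
Proof.
move=> pB sj; apply: lcomp_eq.
  by rewrite PoszD; apply: Omega_Lpow; exact: primitive_Omega.
split.
  move=> i; have [->|ij] := eqVneq i j; last by case: ifP => // _; exact: primitive0.
  have -> : (s + j.*2 - n <= j <= (s + j.*2)./2)%N by lia.
  by have -> : (s + j.*2)%N%:Z - j.*2%:Z = s%:Z by lia.
rewrite (big_cat_nat (n := j)) //=; [|lia|lia].
rewrite big_nat big1 ?add0r; last first.
  by move=> i ij; have -> : (i == j) = false by [lia]; exact: Lpow0.
rewrite big_ltn; last by lia.
rewrite eqxx big_nat big1 ?addr0 // => i ij.
by have -> : (i == j) = false by [lia]; exact: Lpow0.
Qed.

Lemma Omega_ind (k : nat) (P : dform M -> Prop) :
  P 0 -> (forall A B, Omega M k A -> Omega M k B -> P A -> P B -> P (A + B)) ->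
  (forall s j B, (s + j.*2 = k)%N -> (s + j <= n)%N -> primitive M s%:Z B -> P (Lpow j B)) ->
  forall A, Omega M k A -> P A.
Proof.
move=> P0 PD PL A kA; have [pB ->] := lcompP kA.
suff [] : Omega M k (\sum_(k - n <= j < k./2.+1) Lpow j (lcomp k A j)) /\
  P (\sum_(k - n <= j < k./2.+1) Lpow j (lcomp k A j)) by [].
rewrite big_nat; apply: (big_ind (fun X => Omega M k X /\ P X)).
- by split=> //; exact: Omega0.
- by move=> X Y [kX PX] [kY PY]; split; [exact: OmegaD|exact: PD].
move=> j jk; have := pB j; have -> : (k - n <= j <= k./2)%N by lia.
move=> pBj; split.
  have -> : k%:Z = k%:Z - j.*2%:Z + j.*2%:Z by lia.
  by apply: Omega_Lpow; exact: primitive_Omega.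
apply: (PL (k - j.*2)%N); [lia|lia|].
by have -> : (k - j.*2)%N%:Z = k%:Z - j.*2%:Z by lia.
Qed.

(* The common shape of [Pi], [Lneg], [reflect_r], [partial_plus] and
   [partial_minus]; such an operator is computed on the terms [Lpow j B], with [B]
   primitive, which span the forms by [Omega_ind]. *)
Definition lefschetz_op (P : nat -> nat -> bool) (G : nat -> nat -> dform M -> dform M) A :=
  \sum_(k < n.*2.+1) \sum_(k - n <= j < k./2.+1 | P k j) G k j (lcomp k A j).

Lemma lefschetz_op_term P G s j B :
  (forall k i, (k - n <= i <= k./2)%N -> G k i 0 = 0) ->
  primitive M s%:Z B -> (s + j <= n)%N ->
  lefschetz_op P G (Lpow j B) =
  if P (s + j.*2)%N j then G (s + j.*2)%N j B else 0.
Proof.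
move=> G0 pB sj; set k := (s + j.*2)%N.
have kLB : Omega M k (Lpow j B).
  by rewrite /k PoszD; apply: Omega_Lpow; exact: primitive_Omega.
have k2n : (k < n.*2.+1)%N by rewrite /k; lia.
rewrite /lefschetz_op (bigD1 (Ordinal k2n)) //= [X in _ + X]big1 ?addr0; last first.
  move=> k' kk'; rewrite (lcomp_other kLB); last first.
    by apply: contra kk' => /eqP[kk']; apply/eqP/val_inj.
  by rewrite big_nat_cond big1 // => i /andP[/andP[? ?] _]; apply: G0; lia.
rewrite (lcomp_term pB sj) big_mkcond big_nat.
rewrite (eq_bigr (fun i => if i == j then (if P k j then G k j B else 0) else 0)); last first.
  move=> i ik; have [->//|ij] := eqVneq i j.
  by case: ifP => // _; apply: G0; lia.
rewrite -big_nat -big_mkcond big_nat1_eq.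
by have -> : (k - n <= j < k./2.+1)%N by rewrite /k; lia.
Qed.

Lemma lefschetz_op_lin P G (l : int) (a : R) A B :
  (forall k i C D, G k i (a *: C + D) = a *: G k i C + G k i D) ->
  Omega M l A -> Omega M l B ->
  lefschetz_op P G (a *: A + B) = a *: lefschetz_op P G A + lefschetz_op P G B.
Proof.
move=> Glin lA lB; rewrite /lefschetz_op scaler_sumr -big_split.
apply: eq_bigr => k _ /=; rewrite (lcomp_lin _ _ lA lB) scaler_sumr -big_split.
by apply: eq_bigr => j _; exact: Glin.
Qed.

End LefschetzDecomposition.

(** * Operators on Lefschetz components *)

Section LefschetzOperators.
Context {R : realType} {n : nat} {M : symplecticManifold R n}.
Implicit Types (A B C D : dform M) (k l : int).
Notation L := (wedge (sform M)).

Lemma Omega_cast k l A : k = l -> Omega M k A -> Omega M l A.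
Proof. by move=> ->. Qed.

Lemma Omega_indz k (P : dform M -> Prop) :
  P 0 -> (forall A B, Omega M k A -> Omega M k B -> P A -> P B -> P (A + B)) ->
  (forall s j B, s%:Z + j.*2%:Z = k -> (s + j <= n)%N -> primitive M s%:Z B -> P (Lpow j B)) ->
  forall A, Omega M k A -> P A.
Proof.
case: k => [k|k] P0 PD PL A kA; last by rewrite (Omega_eq0 _ kA).
apply: Omega_ind kA => // s j B sjk; apply: PL; lia.
Qed.

Lemma ext_d_Lpow k q A : Omega M k A -> ext_d (Lpow q A) = Lpow q (ext_d A).
Proof.
move=> kA; elim: q => //= q <-.
rewrite (ext_d_wedge (sform_form M) (Omega_Lpow q kA)) sform_closed.
rewrite expr2 mulrNN mulr1 scale1r.
have -> : wedge 0 (Lpow q A) = 0; last by rewrite add0r.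
by apply/funext => i; apply/funext => x; exact: wedgep0l.
Qed.

Lemma ext_dB k l A B : Omega M k A -> Omega M l B -> ext_d (A - B) = ext_d A - ext_d B.
Proof.
move=> kA lB; have -> : A - B = -1 *: B + A by rewrite scaleN1r addrC.
by rewrite (ext_d_lin _ lB kA) scaleN1r addrC.
Qed.

Lemma ext_dN k A : Omega M k A -> ext_d (- A) = - ext_d A.
Proof.
by move=> kA; have := ext_dB (Omega0 (M := M) k) kA; rewrite !sub0r ext_d0 sub0r.
Qed.

Lemma ext_dD k l A B : Omega M k A -> Omega M l B -> ext_d (A + B) = ext_d A + ext_d B.
Proof.
move=> kA lB; have -> : A + B = 1 *: A + B by rewrite scale1r.
by rewrite (ext_d_lin _ kA lB) scale1r.
Qed.

Lemma Pi_term p s j B : primitive M s%:Z B -> (s + j <= n)%N ->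
  Pi p (Lpow j B) = if (j <= p)%N then Lpow j B else 0.
Proof.
move=> pB sj; have := lefschetz_op_term (fun _ j => (j <= p)%N)
  (G := fun _ j => Lpow j) _ pB sj.
by apply=> *; exact: Lpow0.
Qed.

Lemma Lneg_term q s j B : primitive M s%:Z B -> (s + j <= n)%N ->
  Lneg q (Lpow j B) = if (q <= j)%N then Lpow (j - q) B else 0.
Proof.
move=> pB sj; have := lefschetz_op_term (fun _ j => (q <= j)%N)
  (G := fun _ j => Lpow (j - q)) _ pB sj.
by apply=> *; exact: Lpow0.
Qed.

Lemma reflect_term s j B : primitive M s%:Z B -> (s + j <= n)%N ->
  reflect_r (Lpow j B) = Lpow (n - j - s) B.
Proof.
move=> pB sj; have := lefschetz_op_term (fun _ _ => true)
  (G := fun (k : nat) j => Lpow (n - j - (k - j.*2))) _ pB sj.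
rewrite addnK; apply=> *; exact: Lpow0.
Qed.

Lemma Pi_lin p k (a : R) A B : Omega M k A -> Omega M k B ->
  Pi p (a *: A + B) = a *: Pi p A + Pi p B.
Proof.
apply: (lefschetz_op_lin (fun _ j => (j <= p)%N) (G := fun _ j => Lpow j)).
by move=> *; exact: Lpow_lin.
Qed.

Lemma Lneg_lin q k (a : R) A B : Omega M k A -> Omega M k B ->
  Lneg q (a *: A + B) = a *: Lneg q A + Lneg q B.
Proof.
apply: (lefschetz_op_lin (fun _ j => (q <= j)%N) (G := fun _ j => Lpow (j - q))).
by move=> *; exact: Lpow_lin.
Qed.

Lemma reflect_lin k (a : R) A B : Omega M k A -> Omega M k B ->
  reflect_r (a *: A + B) = a *: reflect_r A + reflect_r B.
Proof.
apply: (lefschetz_op_lin (fun _ _ => true)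
  (G := fun (k : nat) j => Lpow (n - j - (k - j.*2)))).
by move=> *; exact: Lpow_lin.
Qed.

Lemma lin_add (f : dform M -> dform M) A B :
  f (1 *: A + B) = 1 *: f A + f B -> f (A + B) = f A + f B.
Proof. by rewrite !scale1r. Qed.

Lemma lin0 (f : dform M -> dform M) : f (1 *: 0 + 0) = 1 *: f 0 + f 0 -> f 0 = 0.
Proof.
rewrite !scale1r addr0 => /eqP; rewrite -subr_eq0 opprD addrA subrr add0r oppr_eq0.
by move/eqP.
Qed.

Lemma Pi0 p : Pi p (0 : dform M) = 0.
Proof. by apply: lin0; apply: (Pi_lin p (k := 0)); exact: Omega0. Qed.

Lemma Lneg0 q : Lneg q (0 : dform M) = 0.
Proof. by apply: lin0; apply: (Lneg_lin q (k := 0)); exact: Omega0. Qed.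

Lemma reflect0 : reflect_r (0 : dform M) = 0.
Proof. by apply: lin0; apply: (reflect_lin (k := 0)); exact: Omega0. Qed.

Lemma PiD p k A B : Omega M k A -> Omega M k B -> Pi p (A + B) = Pi p A + Pi p B.
Proof. by move=> kA kB; apply: lin_add; exact: Pi_lin kA kB. Qed.

Lemma PiB p k A B : Omega M k A -> Omega M k B -> Pi p (A - B) = Pi p A - Pi p B.
Proof.
move=> kA kB; have -> : A - B = -1 *: B + A by rewrite scaleN1r addrC.
by rewrite (Pi_lin p (-1) kB kA) scaleN1r addrC.
Qed.

Lemma LnegD q k A B : Omega M k A -> Omega M k B -> Lneg q (A + B) = Lneg q A + Lneg q B.
Proof. by move=> kA kB; apply: lin_add; exact: Lneg_lin kA kB. Qed.

Lemma reflectD k A B : Omega M k A -> Omega M k B ->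
  reflect_r (A + B) = reflect_r A + reflect_r B.
Proof. by move=> kA kB; apply: lin_add; exact: reflect_lin kA kB. Qed.

Lemma Omega_term s j B k : primitive M s%:Z B -> s%:Z + j.*2%:Z = k -> Omega M k (Lpow j B).
Proof. by move=> pB <-; apply: Omega_Lpow; exact: primitive_Omega. Qed.

Lemma Omega_Pi p k A : Omega M k A -> Omega M k (Pi p A).
Proof.
move: A; apply: Omega_indz => [|A B kA kB PA PB|s j B sjk sj pB].
- by rewrite Pi0; exact: Omega0.
- by rewrite (PiD p kA kB); exact: OmegaD.
- rewrite (Pi_term p pB sj); case: ifP => _; last exact: Omega0.
  exact: Omega_term pB _.
Qed.

Lemma Omega_Lneg q k A : Omega M k A -> Omega M (k - q.*2%:Z) (Lneg q A).
Proof.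
move: A; apply: Omega_indz => [|A B kA kB PA PB|s j B sjk sj pB].
- by rewrite Lneg0; exact: Omega0.
- by rewrite (LnegD q kA kB); exact: OmegaD.
- rewrite (Lneg_term q pB sj); case: ifP => qj; last exact: Omega0.
  by apply: Omega_term pB _; lia.
Qed.

Lemma Omega_reflect k A : Omega M k A -> Omega M (n.*2%:Z - k) (reflect_r A).
Proof.
move: A; apply: Omega_indz => [|A B kA kB PA PB|s j B sjk sj pB].
- by rewrite reflect0; exact: Omega0.
- by rewrite (reflectD kA kB); exact: OmegaD.
- by rewrite (reflect_term pB sj); apply: Omega_term pB _; lia.
Qed.

Lemma Pi_Lneg r k A : (0 < r)%N -> Omega M k A ->
  A = Pi r.-1 A + Lpow r (Lneg r A).
Proof.
move=> r0; move: A; apply: Omega_indz => [|A B kA kB PA PB|s j B sjk sj pB].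
- by rewrite Pi0 Lneg0 Lpow0 addr0.
- rewrite (PiD _ kA kB) (LnegD _ kA kB) LpowDf addrACA -PA -PB //.
- rewrite (Pi_term _ pB sj) (Lneg_term _ pB sj).
  have -> : (j <= r.-1)%N = ~~ (r <= j)%N by lia.
  rewrite if_neg; case: ifP => rj; first by rewrite -LpowD subnKC // add0r.
  by rewrite Lpow0 addr0.
Qed.

Lemma Pi_Lpow r k C : (0 < r)%N -> Omega M k C -> Pi r.-1 (Lpow r C) = 0.
Proof.
move=> r0; move: C; apply: Omega_indz => [|A B kA kB PA PB|s j B sjk sj pB].
- by rewrite Lpow0 Pi0.
- by rewrite LpowDf (PiD _ (Omega_Lpow r kA) (Omega_Lpow r kB)) PA PB addr0.
(* Past the end of the chain of [B], the power of [L] annihilates [B]. *)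
- rewrite -LpowD; have [srj|srj] := leqP (s + (r + j)) n.
    by rewrite (Pi_term _ pB srj) (_ : (_ <= _)%N = false) //; lia.
  by rewrite (primitive_Lpow pB) ?Pi0 //; lia.
Qed.

Lemma Lneg_Pi r k A : (0 < r)%N -> Omega M k A -> Lneg r (Pi r.-1 A) = 0.
Proof.
move=> r0; move: A; apply: Omega_indz => [|A B kA kB PA PB|s j B sjk sj pB].
- by rewrite Pi0 Lneg0.
- by rewrite (PiD _ kA kB) (LnegD r (Omega_Pi r.-1 kA) (Omega_Pi r.-1 kB)) PA PB addr0.
- rewrite (Pi_term _ pB sj); case: ifP => jr; last exact: Lneg0.
  by rewrite (Lneg_term _ pB sj) (_ : (_ <= _)%N = false) //; lia.
Qed.

Lemma reflectK k A : Omega M k A -> reflect_r (reflect_r A) = A.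
Proof.
move: A; apply: Omega_indz => [|A B kA kB PA PB|s j B sjk sj pB].
- by rewrite !reflect0.
- by rewrite (reflectD kA kB) (reflectD (Omega_reflect kA) (Omega_reflect kB)) PA PB.
- rewrite (reflect_term pB sj) (reflect_term pB); last by lia.
  by congr (Lpow _ B); lia.
Qed.

(** Reflection reverses each chain [B, L B, ..., L^(n-s) B], so raising by [q] becomes lowering by
    [q]; leaving the chain gives [0] on both sides. *)
Lemma Lneg_reflect q k A : Omega M k A -> Lneg q (reflect_r A) = reflect_r (Lpow q A).
Proof.
move: A; apply: Omega_indz => [|A B kA kB PA PB|s j B sjk sj pB].
- by rewrite Lpow0 !reflect0 Lneg0.
- rewrite (reflectD kA kB) (LnegD q (Omega_reflect kA) (Omega_reflect kB)) PA PB.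
  by rewrite LpowDf (reflectD (Omega_Lpow q kA) (Omega_Lpow q kB)).
- rewrite (reflect_term pB sj) (Lneg_term q pB); last by lia.
  rewrite -LpowD; case: ifP => qj.
    by rewrite (reflect_term pB); [congr (Lpow _ B); lia|lia].
  by rewrite (primitive_Lpow (q := q + j) pB) ?reflect0 //; lia.
Qed.

Lemma reflect_eq0 k A : Omega M k A -> reflect_r A = 0 -> A = 0.
Proof. by move=> kA A0; rewrite -(reflectK kA) A0 reflect0. Qed.

(** [L^(-r) L^r C] and [C] always have the same image under [L^r]; in this range of degrees [L^r] is
    injective. *)
Lemma Lneg_Lpow r k C : (0 < r)%N -> Omega M k C -> k + r%:Z <= n%:Z ->
  Lneg r (Lpow r C) = C.
Proof.
move=> r0 kC krn; have kLC := Omega_Lpow r kC.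
have kNLC : Omega M k (Lneg r (Lpow r C)).
  by apply: Omega_cast (Omega_Lneg r kLC); rewrite addrK.
apply/eqP; rewrite -subr_eq0; apply/eqP; apply: (Lpow_inj (OmegaB kNLC kC) krn).
rewrite LpowB {2}(Pi_Lneg r0 kLC) (Pi_Lpow r0 kC) add0r subrr.
by [].
Qed.

Lemma Pi_high r k A : (0 < r)%N -> Omega M k A -> n%:Z + r%:Z <= k -> Pi r.-1 A = 0.
Proof. by move=> r0 kA nrk; have [B kB ->] := Lpow_surj kA nrk; exact: Pi_Lpow kB. Qed.

Lemma FOmegaP r k A : (0 < r)%N -> FOmega M r.-1 k A <-> Omega M k A /\ Lneg r A = 0.
Proof.
move=> r0; split=> [[A' kA' <-]|[kA A0]].
  by split; [exact: Omega_Pi|exact: Lneg_Pi kA'].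
by exists A => //; rewrite [RHS](Pi_Lneg r0 kA) A0 Lpow0 addr0.
Qed.

Lemma FOmega_reflectP r k A : (0 < r)%N ->
  FOmega M r.-1 k A <-> Omega M k A /\ Lpow r (reflect_r A) = 0.
Proof.
move=> r0; apply: (iff_trans (FOmegaP k A r0)).
split=> -[kA A0]; split=> //; have kRA := Omega_reflect kA.
  by apply: (reflect_eq0 (Omega_Lpow r kRA)); rewrite -(Lneg_reflect r kRA) (reflectK kA).
by rewrite -(reflectK kA) (Lneg_reflect r kRA) A0 reflect0.
Qed.

Lemma Pi_FOmega r k A : (0 < r)%N -> FOmega M r.-1 k A -> Pi r.-1 A = A.
Proof.
by move=> r0 /(FOmegaP _ _ r0)[kA A0]; rewrite [RHS](Pi_Lneg r0 kA) A0 Lpow0 addr0.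
Qed.

(** [L^(n-z)] kills [B] and leaves [L^(n-z+1) C = 0], where [C] has degree [z - 1], the limit case
    of injectivity. This is what pins down the choice made in [partial_prim]. *)
Lemma primitive_sum_unique (z : int) B C : z <= n%:Z ->
  primitive M (z + 1) B -> primitive M (z - 1) C -> B + L C = 0 -> B = 0 /\ C = 0.
Proof.
move=> zn pB pC BC; suff C0 : C = 0 by split=> //; rewrite -BC C0 wedge0 addr0.
have [z0|z0] := ltP z 0.
  by apply: Omega_eq0 (primitive_Omega pC); lia.
apply: (Lpow_inj (q := `|n%:Z - z|.+1) (primitive_Omega pC)); first by lia.
have := congr1 (Lpow `|n%:Z - z|) BC.
rewrite LpowDf (primitive_Lpow pB) ?add0r ?Lpow0 -?LpowSr //; lia.
Qed.

Lemma partial_prim_eq (z : int) A B C : z <= n%:Z ->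
  primitive M (z + 1) B -> primitive M (z - 1) C -> ext_d A = B + L C ->
  partial_prim z A = (B, C).
Proof.
move=> zn pB pC dA; rewrite /partial_prim.
case: xgetP => [[B' C'] _ [/= pB' pC' dA']|/(_ (B, C))]; last by case.
have [|||B0 C0] := @primitive_sum_unique z (-1 *: B + B') (-1 *: C + C') zn.
- exact: primitive_lin.
- exact: primitive_lin.
- by rewrite wedge_lin addrACA !scaleN1r -opprD -dA -dA' addNr.
by congr (_, _); apply/eqP; rewrite -subr_eq0 addrC -scaleN1r; apply/eqP.
Qed.

Lemma partial_prim0 (z : int) : z <= n%:Z -> partial_prim z (0 : dform M) = (0, 0).
Proof.
move=> zn; apply: partial_prim_eq => //; try exact: primitive0.
by rewrite ext_d0 wedge0 addr0.
Qed.

Lemma partial_minus_term s j B : primitive M s%:Z B -> (s + j <= n)%N ->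
  partial_minus (Lpow j B) = Lpow j (partial_prim s%:Z B).2.
Proof.
move=> pB sj; have := lefschetz_op_term (fun _ _ => true)
  (G := fun (k : nat) j C => Lpow j (partial_prim (k%:Z - j.*2%:Z) C).2) _ pB sj.
have -> : (s + j.*2)%N%:Z - j.*2%:Z = s%:Z by lia.
by apply=> k i ki; rewrite partial_prim0 ?Lpow0 //; lia.
Qed.

Lemma partial_plus_term s j B : primitive M s%:Z B -> (s + j <= n)%N ->
  partial_plus (Lpow j B) = Lpow j (partial_prim s%:Z B).1.
Proof.
move=> pB sj; have := lefschetz_op_term (fun _ _ => true)
  (G := fun (k : nat) j C => Lpow j (partial_prim (k%:Z - j.*2%:Z) C).1) _ pB sj.
have -> : (s + j.*2)%N%:Z - j.*2%:Z = s%:Z by lia.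
by apply=> k i ki; rewrite partial_prim0 ?Lpow0 //; lia.
Qed.

(** A term [L^j B_s] with [s + 2j = n + p] and [s + j <= n] has [j >= p], so the filtration leaves
    only [j = p]. *)
Lemma FOmega_top p A : (p <= n)%N -> FOmega M p (n + p)%N A ->
  exists2 B, primitive M (n - p)%N B & A = Lpow p B.
Proof.
move=> pn [A' kA' <-]; move: A' kA'.
apply: Omega_ind => [|X Y kX kY [B pB EB] [C pC EC]|s j B sj snj pB].
- by exists 0; [exact: primitive0|rewrite Pi0 Lpow0].
- exists (1 *: B + C); first exact: primitive_lin.
  by rewrite (PiD p kX kY) EB EC Lpow_lin scale1r.
rewrite (Pi_term p pB snj); case: ifP => jp; last first.
  by exists 0; [exact: primitive0|rewrite Lpow0].
have jE : j = p by lia.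
by exists B; [have -> : (n - p)%N = s by lia|rewrite jE].
Qed.

(* If [A = L^(r-1) B] with [B] primitive, both sides are [L^(r-1) d C], where [C]
   is the component [partial_- B] of [dB], that is [dA = L^r C]. *)
Lemma partial_plus_minus r A : (0 < r <= n)%N -> FOmega M r.-1 (n + r.-1)%N A ->
  partial_plus (partial_minus A) = reflect_r (ext_d (Lneg r (ext_d A))).
Proof.
move=> /andP[r0 rn] FA; have [|B pB AB] := FOmega_top _ FA; first by lia.
have kA : Omega M (n + r.-1)%N A by case/(FOmegaP _ _ r0): FA.
have kB := primitive_Omega pB.
have kdA : Omega M (n + r)%N (ext_d A) by apply: Omega_cast (Omega_ext_d kA); lia.
set C := Lneg r (ext_d A).
have kC : Omega M (n - r)%N C by apply: Omega_cast (Omega_Lneg r kdA); lia.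
have LC : ext_d A = Lpow r C.
  by rewrite [LHS](Pi_Lneg r0 kdA) (Pi_high r0 kdA) ?add0r.
have dA : ext_d A = Lpow r.-1 (ext_d B) by rewrite AB (ext_d_Lpow _ kB).
(* [L^(r+1) C = L dA = d (L^r B)], and [L^r] kills the primitive [B] of degree [n - r + 1]. *)
have pC : primitive M (n - r)%N C.
  apply/primitive_nat; first by lia.
  split=> //; have -> : (n.+1 - (n - r) = 1 + r)%N by lia.
  rewrite LpowD -LC -(ext_d_Lpow 1 kA) AB -LpowD (primitive_Lpow pB) ?ext_d0 //; lia.
have kdBC : Omega M ((n - r.-1)%N%:Z + 1) (ext_d B - L C).
  apply: OmegaB; first exact: Omega_ext_d.
  by apply: Omega_cast (Omega_L kC); lia.
have LdBC : Lpow r.-1 (ext_d B - L C) = 0.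
  by rewrite LpowB -dA -LpowSr prednK // LC subrr.
have pdBC : primitive M ((n - r.-1)%N%:Z + 1) (ext_d B - L C).
  (* For [r = 1] the degree is [n + 1], where only [0] is primitive; [LdBC] with exponent [0] says
     exactly this. *)
  have [r1|r1] := leqP r 1.
    have r1E : r.-1 = 0%N by lia.
    move: LdBC; rewrite r1E /= => ->; exact: primitive0.
  have E : (n - r.-1)%N%:Z + 1 = (n - r.-1).+1%:Z by lia.
  rewrite E; apply/primitive_nat; first by lia.
  split; first by rewrite -E.
  by have -> : (n.+1 - (n - r.-1).+1 = r.-1)%N by lia.
have pdC : primitive M (n - r.-1)%N (ext_d C).
  apply/primitive_nat; first by lia.
  split; first by apply: Omega_cast (Omega_ext_d kC); lia.
  have -> : (n.+1 - (n - r.-1) = r)%N by lia.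
  by rewrite -(ext_d_Lpow r kC) -LC (ext_d_ext_d kA).
rewrite AB (partial_minus_term pB); last by lia.
rewrite (@partial_prim_eq _ _ (ext_d B - L C) C) //=; last 3 first.
- by lia.
- by have -> : (n - r.-1)%N%:Z - 1 = (n - r)%N%:Z by lia.
- by rewrite subrK.
rewrite (partial_plus_term pC); last by lia.
rewrite (@partial_prim_eq _ _ (ext_d C) 0) /=; last 4 first.
- by lia.
- by have -> : (n - r)%N%:Z + 1 = (n - r.-1)%N%:Z by lia.
- exact: primitive0.
- by rewrite wedge0 addr0.
have := reflect_term (j := 0) pdC; rewrite addn0 => -> //; last by lia.
by congr (Lpow _ _); lia.
Qed.

End LefschetzOperators.

(** * Exactness *)

Section Subquotients.
Context {R : realType} {V : lmodType R}.
Implicit Types (H : subquotient V) (f g : V -> V).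

Lemma subspaceD (S : set V) u v : is_subspace S -> S u -> S v -> S (u + v).
Proof. by move=> [_ lS] Su Sv; rewrite -[u]scale1r; exact: lS. Qed.

Lemma subspaceN (S : set V) u : is_subspace S -> S u -> S (- u).
Proof. by move=> [S0 lS] Su; rewrite -[- u]addr0 -scaleN1r; exact: lS. Qed.

Lemma subspaceB (S : set V) u v : is_subspace S -> S u -> S v -> S (u - v).
Proof. by move=> sS Su Sv; apply: subspaceD => //; exact: subspaceN. Qed.

Lemma coh_class_eq H x y : is_subspace (boundaries H) ->
  coh_class H x = coh_class H y <-> boundaries H (x - y).
Proof.
move=> sB; split=> [E|Bxy].
  have : coh_class H x x by rewrite /coh_class /= subrr; case: sB.
  by rewrite E.
apply/seteqP; split=> z /= Bz.
  by have := subspaceD sB Bz Bxy; rewrite addrA subrK.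
by have := subspaceB sB Bz Bxy; rewrite opprB addrA subrK.
Qed.

Lemma induced_map_class H H' f x : induces H H' f -> cycles H x ->
  induced_map H' f (coh_class H x) = coh_class H' (f x).
Proof.
move=> [[sZ sB BZ] [sZ' sB' BZ'] fZ fB flin] Zx.
apply/seteqP; split=> [z /= [y Bxy Bz]|z /= Bz]; last first.
  by exists x => //; rewrite /coh_class /= subrr; case: sB.
have fy : f y = f (y - x) + f x.
  have {1}-> : y = 1 *: (y - x) + x by rewrite scale1r subrK.
  by rewrite flin ?scale1r //; exact: BZ.
rewrite /coh_class /=; have -> : z - f x = (z - f y) + f (y - x).
  by rewrite fy opprD addrA addrAC subrK.
by apply: subspaceD => //; apply: fB; exists (y - x).
Qed.

(** Exactness on representatives; it frees the arguments below from cosets. *)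
Lemma exact_atI H1 H2 H3 f g : induces H1 H2 f -> induces H2 H3 g ->
  (forall x, cycles H1 x -> boundaries H3 (g (f x))) ->
  (forall y, cycles H2 y -> boundaries H3 (g y) ->
     exists2 x, cycles H1 x & boundaries H2 (y - f x)) ->
  exact_at H1 H2 H3 f g.
Proof.
move=> If Ig gf0 ex; split=> //.
have [_ [_ sB2 _] fZ _ _] := If; have [_ [_ sB3 _] _ _ _] := Ig.
apply/seteqP; split=> [_ [_ [x Zx <-] <-]|c [[y Zy <-]]].
  have Zfx : cycles H2 (f x) by apply: fZ; exists x.
  rewrite (induced_map_class If Zx); split; first by exists (f x).
  by rewrite (induced_map_class Ig Zfx); apply/(coh_class_eq _ _ sB3); rewrite subr0; exact: gf0.
rewrite (induced_map_class Ig Zy) => /(coh_class_eq _ _ sB3); rewrite subr0 => Bgy.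
have [x Zx Byx] := ex y Zy Bgy.
exists (coh_class H1 x); first by exists x.
by rewrite (induced_map_class If Zx); apply/esym/(coh_class_eq _ _ sB2).
Qed.

Lemma zeroH_wf : subquotient_wf (zeroH V).
Proof.
have s0 : is_subspace [set (0 : V)].
  by split=> // a u v /= -> ->; rewrite scaler0 addr0.
by split.
Qed.

End Subquotients.

(** * Cycles and boundaries of the filtered complexes *)

Section FilteredCohomology.
Context {R : realType} {n : nat} {M : symplecticManifold R n}.
Context (r : nat) (hr : (0 < r <= n)%N).
Implicit Types (A B C D X Y : dform M) (k l m : int).

Let r0 : (0 < r)%N. Proof. by case/andP: hr. Qed.
Let rn : (r <= n)%N. Proof. by case/andP: hr. Qed.

Lemma Hd_wf k : subquotient_wf (Hd M k).
Proof.
split.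
- split; first by split; [exact: Omega0|exact: ext_d0].
  move=> a u v [ku du] [kv dv]; split; first exact: Omega_lin.
  by rewrite (ext_d_lin _ ku kv) du dv scaler0 addr0.
- split; first by exists 0; [exact: Omega0|exact: ext_d0].
  move=> a _ _ [u ku <-] [v kv <-]; exists (a *: u + v); first exact: Omega_lin.
  exact: ext_d_lin ku kv.
- move=> _ [u ku <-]; split; last exact: ext_d_ext_d ku.
  by apply: Omega_cast (Omega_ext_d ku); lia.
Qed.

(* One description for all degrees, covering both cases of [FHplus]; likewise for
   [boundaries_minus] below. *)
Lemma cycles_plus k A : k <= n%:Z + r%:Z - 1 ->
  cycles (FHplus M r.-1 k) A <->
  FOmega M r.-1 k A /\
  exists C, [/\ Omega M (k - 2 * r%:Z + 1) C, ext_d A = Lpow r C & ext_d C = 0].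
Proof.
move=> knr; rewrite /FHplus; case: eqP => kE /=; split=> -[FA].
- have kA : Omega M k A by case/(FOmegaP _ _ r0): FA.
  have kdA := Omega_ext_d kA; have kN := Omega_Lneg r kdA.
  have dA : ext_d A = Lpow r (Lneg r (ext_d A)).
    by rewrite [LHS](Pi_Lneg r0 kdA) (Pi_high r0 kdA) ?add0r //; lia.
  move: (FA); rewrite {1}kE => FA'; rewrite (partial_plus_minus hr FA').
  move=> /(reflect_eq0 (Omega_ext_d kN)) dC; split=> //.
  exists (Lneg r (ext_d A)); split=> //.
  by apply: Omega_cast kN; lia.
- move=> [C [kC dA dC]]; split=> //; move: (FA); rewrite {1}kE => FA'.
  rewrite (partial_plus_minus hr FA') dA (Lneg_Lpow r0 kC); last by lia.
  by rewrite dC reflect0.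
- have kA : Omega M k A by case/(FOmegaP _ _ r0): FA.
  have kdA := Omega_ext_d kA; have kN := Omega_Lneg r kdA.
  move=> PdA; have dA : ext_d A = Lpow r (Lneg r (ext_d A)).
    by rewrite [LHS](Pi_Lneg r0 kdA) -/(d_plus r.-1 A) PdA add0r.
  split=> //; exists (Lneg r (ext_d A)); split=> //.
    by apply: Omega_cast kN; lia.
  (* Off the middle degree [dC] has degree at most [n - r], so [L^r dC = d d A = 0] suffices. *)
  apply: (Lpow_inj (q := r) (Omega_ext_d kN)); first by lia.
  by rewrite -(ext_d_Lpow r kN) -dA (ext_d_ext_d kA).
- move=> [C [kC dA dC]]; split=> //.
  by rewrite /d_plus dA (Pi_Lpow r0 kC).
Qed.

(** As [Pi d L^r = Pi L^r d = 0], arbitrary forms [X] have the same boundaries as their filtered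
    parts. *)
Lemma boundaries_plus k A :
  boundaries (FHplus M r.-1 k) A <->
  exists2 X, Omega M (k - 1) X & A = Pi r.-1 (ext_d X).
Proof.
have -> : boundaries (FHplus M r.-1 k) = @d_plus _ _ M r.-1 @` FOmega M r.-1 (k - 1).
  by rewrite /FHplus; case: eqP.
split=> [[X /(FOmegaP _ _ r0)[kX _] <-]|[X kX ->]]; first by exists X.
exists (Pi r.-1 X); first by exists X.
have kPX := Omega_Pi r.-1 kX; have kN := Omega_Lneg r kX.
rewrite /d_plus [in RHS](Pi_Lneg r0 kX) (ext_dD kPX (Omega_Lpow r kN)).
rewrite (PiD _ (Omega_ext_d kPX) (Omega_cast _ (Omega_ext_d (Omega_Lpow r kN)))); last by lia.
by rewrite (ext_d_Lpow r kN) (Pi_Lpow r0 (Omega_ext_d kN)) addr0.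
Qed.

Lemma FOmega_lin k (a : R) A B : FOmega M r.-1 k A -> FOmega M r.-1 k B ->
  FOmega M r.-1 k (a *: A + B).
Proof.
move=> /(FOmegaP _ _ r0)[kA A0] /(FOmegaP _ _ r0)[kB B0]; apply/(FOmegaP _ _ r0); split.
  exact: Omega_lin.
by rewrite (Lneg_lin r a kA kB) A0 B0 scaler0 addr0.
Qed.

Lemma FOmega0 k : FOmega M r.-1 k 0.
Proof. by apply/(FOmegaP _ _ r0); split; [exact: Omega0|exact: Lneg0]. Qed.

Lemma FHplus_wf k : k <= n%:Z + r%:Z - 1 -> subquotient_wf (FHplus M r.-1 k).
Proof.
move=> knr; split.
- split.
    apply/(cycles_plus _ knr); split; first exact: FOmega0.
    by exists 0; split; [exact: Omega0|rewrite ext_d0 Lpow0|exact: ext_d0].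
  move=> a u v /(cycles_plus _ knr)[Fu [C [kC du dC]]] /(cycles_plus _ knr)[Fv [D [kD dv dD]]].
  apply/(cycles_plus _ knr); split; first exact: FOmega_lin.
  have [ku _] := (FOmegaP _ _ r0).1 Fu; have [kv _] := (FOmegaP _ _ r0).1 Fv.
  exists (a *: C + D); split; first exact: Omega_lin.
    by rewrite (ext_d_lin a ku kv) Lpow_lin du dv.
  by rewrite (ext_d_lin a kC kD) dC dD scaler0 addr0.
- split; first by apply/boundaries_plus; exists 0; [exact: Omega0|rewrite ext_d0 Pi0].
  move=> a u v /boundaries_plus[X kX ->] /boundaries_plus[Y kY ->].
  apply/boundaries_plus; exists (a *: X + Y); first exact: Omega_lin.
  by rewrite (ext_d_lin a kX kY) (Pi_lin r.-1 a (Omega_ext_d kX) (Omega_ext_d kY)).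
- move=> u /boundaries_plus[X kX ->]; apply/(cycles_plus _ knr).
  have kdX : Omega M k (ext_d X) by apply: Omega_cast (Omega_ext_d kX); lia.
  split; first by exists (ext_d X).
  have kE := Omega_Lneg r kdX; set E := Lneg r _ in kE.
  have PE : Pi r.-1 (ext_d X) = ext_d X - Lpow r E.
    by rewrite [X in _ = X - _](Pi_Lneg r0 kdX) addrK.
  (* Since [Pi dX = dX - L^r E], its differential is [- L^r dE]. *)
  exists (- ext_d E); rewrite PE; split.
  - by apply: OmegaN; apply: Omega_cast (Omega_ext_d kE); lia.
  - rewrite (ext_dB kdX (Omega_Lpow r kE)) (ext_d_ext_d kX) add0r LpowN.
    by rewrite (ext_d_Lpow r kE).
  - by rewrite (ext_dN (Omega_ext_d kE)) (ext_d_ext_d kE) oppr0.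
Qed.

Lemma cycles_minus m A : cycles (FHminus M r.-1 (2 * n%:Z - m)) A <->
  [/\ Omega M (2 * n%:Z - m) A, Lpow r (reflect_r A) = 0 & ext_d (reflect_r A) = 0].
Proof.
have -> : cycles (FHminus M r.-1 (2 * n%:Z - m)) =
    [set A | FOmega M r.-1 (2 * n%:Z - m) A /\ d_minus A = 0].
  by rewrite /FHminus; case: eqP.
split=> [[/(FOmega_reflectP _ _ r0)[kA LA] dA]|[kA LA dA]].
  by split=> //; exact: reflect_eq0 (Omega_ext_d (Omega_reflect kA)) dA.
split; first exact/(FOmega_reflectP _ _ r0).
by rewrite /d_minus dA reflect0.
Qed.

Lemma boundaries_minus m A : n%:Z - r%:Z + 1 <= m ->
  boundaries (FHminus M r.-1 (2 * n%:Z - m)) A <->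
  Omega M (2 * n%:Z - m) A /\
  exists Y X, [/\ Omega M (m - 1) Y, Omega M (m + 2 * r%:Z - 2) X,
    Lpow r Y = ext_d X & reflect_r A = ext_d Y].
Proof.
move=> mnr; rewrite /FHminus; case: eqP => mE /=; split.
- move=> [X FX <-]; have [kX _] := (FOmegaP _ _ r0).1 FX.
  have kdX := Omega_ext_d kX; have kN := Omega_Lneg r kdX.
  move: (FX); rewrite mE => FX'; rewrite (partial_plus_minus hr FX').
  split; first by apply: Omega_cast (Omega_reflect (Omega_ext_d kN)); lia.
  exists (Lneg r (ext_d X)), X; split.
  + by apply: Omega_cast kN; lia.
  + by apply: Omega_cast kX; lia.
  + by rewrite [RHS](Pi_Lneg r0 kdX) (Pi_high r0 kdX) ?add0r //; lia.
  + exact: reflectK (Omega_ext_d kN).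
- move=> [kA [Y [X [kY kX LY RA]]]].
  have kPX := Omega_Pi r.-1 kX; have kNX := Omega_Lneg r kX.
  exists (Pi r.-1 X); first by exists X => //; apply: Omega_cast kX; lia.
  have FP : FOmega M r.-1 (n + r.-1)%N (Pi r.-1 X).
    by exists X => //; apply: Omega_cast kX; lia.
  rewrite (partial_plus_minus hr FP).
  (* Passing from [X] to its filtered part changes [Y] by an exact form, which leaves [dY]
     unchanged. *)
  have dPX : ext_d (Pi r.-1 X) = Lpow r (Y - ext_d (Lneg r X)).
    rewrite LpowB LY [in RHS](Pi_Lneg r0 kX) (ext_dD kPX (Omega_Lpow r kNX)).
    by rewrite (ext_d_Lpow r kNX) -(Pi_Lneg r0 kX) addrK.
  have kYN : Omega M (m - 1) (Y - ext_d (Lneg r X)).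
    by apply: OmegaB => //; apply: Omega_cast (Omega_ext_d kNX); lia.
  rewrite dPX (Lneg_Lpow r0 kYN); last by lia.
  rewrite (ext_dB kY (Omega_ext_d kNX)) (ext_d_ext_d kNX) subr0 -RA.
  exact: reflectK kA.
- move=> [X /(FOmega_reflectP _ _ r0)[kX LX] <-].
  have kRX := Omega_reflect kX; have kdR := Omega_ext_d kRX.
  split; first by apply: Omega_cast (Omega_reflect kdR); lia.
  exists (reflect_r X), 0; split.
  + by apply: Omega_cast kRX; lia.
  + exact: Omega0.
  + by rewrite LX ext_d0.
  + exact: reflectK kdR.
- move=> [kA [Y [X [kY kX LY RA]]]].
  (* Off the middle degree [X] has degree at least [n + r], hence [X = L^r W]; then [Y - dW] has the
     same differential as [Y] and is killed by [L^r]. *)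
  have [|W kW XW] := Lpow_surj (q := r) kX; first by lia.
  have kdW : Omega M (m - 1) (ext_d W) by apply: Omega_cast (Omega_ext_d kW); lia.
  have kY' := OmegaB kY kdW.
  exists (reflect_r (Y - ext_d W)).
    apply/(FOmega_reflectP _ _ r0); split.
      by apply: Omega_cast (Omega_reflect kY'); lia.
    by rewrite (reflectK kY') LpowB LY XW (ext_d_Lpow r kW) subrr.
  rewrite /d_minus (reflectK kY') (ext_dB kY kdW) (ext_d_ext_d kW) subr0 -RA.
  exact: reflectK kA.
Qed.

Lemma FHminus_wf m : n%:Z - r%:Z + 1 <= m -> subquotient_wf (FHminus M r.-1 (2 * n%:Z - m)).
Proof.
move=> mnr; split.
- split.
    apply/cycles_minus; split; [exact: Omega0|by rewrite reflect0 Lpow0|by rewrite reflect0 ext_d0].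
  move=> a u v /cycles_minus[ku Lu du] /cycles_minus[kv Lv dv]; apply/cycles_minus.
  rewrite (reflect_lin a ku kv) Lpow_lin Lu Lv.
  rewrite (ext_d_lin a (Omega_reflect ku) (Omega_reflect kv)) du dv.
  by split; [exact: Omega_lin|rewrite scaler0 addr0..].
- split.
    apply/(boundaries_minus _ mnr); split; first exact: Omega0.
    exists 0, 0; split; [exact: Omega0|exact: Omega0| |].
      by rewrite Lpow0 ext_d0.
    by rewrite reflect0 ext_d0.
  move=> a u v /(boundaries_minus _ mnr)[ku [Y [X [kY kX LY Ru]]]].
  move=> /(boundaries_minus _ mnr)[kv [Y' [X' [kY' kX' LY' Rv]]]].
  apply/(boundaries_minus _ mnr); split; first exact: Omega_lin.
  exists (a *: Y + Y'), (a *: X + X'); split; [exact: Omega_lin|exact: Omega_lin| |].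
    by rewrite Lpow_lin LY LY' (ext_d_lin a kX kX').
  by rewrite (reflect_lin a ku kv) Ru Rv (ext_d_lin a kY kY').
- move=> u /(boundaries_minus _ mnr)[ku [Y [X [kY kX LY Ru]]]].
  apply/cycles_minus; rewrite Ru; split=> //; last exact: ext_d_ext_d kY.
  by rewrite -(ext_d_Lpow r kY) LY (ext_d_ext_d kX).
Qed.

(** * The maps of the sequence and the segments through [FHplus] *)

Lemma induces_L k l : l = k + 2 * r%:Z -> induces (Hd M k) (Hd M l) (Lpow r).
Proof.
move=> lE; split; [exact: Hd_wf|exact: Hd_wf| | |by move=> *; exact: Lpow_lin].
- move=> _ [u [ku du] <-]; split; first by apply: Omega_cast (Omega_Lpow r ku); lia.
  by rewrite (ext_d_Lpow r ku) du Lpow0.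
- move=> _ [_ [u ku <-] <-]; exists (Lpow r u); last exact: ext_d_Lpow ku.
  by apply: Omega_cast (Omega_Lpow r ku); lia.
Qed.

Lemma ext_d_Pi k A : Omega M k A ->
  ext_d (Pi r.-1 A) = ext_d A - Lpow r (ext_d (Lneg r A)).
Proof.
move=> kA; have kN := Omega_Lneg r kA.
have {1}-> : Pi r.-1 A = A - Lpow r (Lneg r A).
  by rewrite [X in _ = X - _](Pi_Lneg r0 kA) addrK.
by rewrite (ext_dB kA (Omega_Lpow r kN)) (ext_d_Lpow r kN).
Qed.

Lemma ext_d_Pi_closed k A : Omega M k A -> ext_d A = 0 ->
  ext_d (Pi r.-1 A) = Lpow r (ext_d (- Lneg r A)).
Proof.
move=> kA dA; have kN := Omega_Lneg r kA.
by rewrite (ext_d_Pi kA) dA sub0r (ext_dN kN) LpowN.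
Qed.

Lemma induces_Pi k : k <= n%:Z + r%:Z - 1 -> induces (Hd M k) (FHplus M r.-1 k) (Pi r.-1).
Proof.
move=> knr; split; [exact: Hd_wf|exact: FHplus_wf| | |].
- move=> _ [u [ku du] <-]; apply/(cycles_plus _ knr); split; first by exists u.
  have kN := OmegaN (Omega_Lneg r ku).
  exists (ext_d (- Lneg r u)); split; last exact: ext_d_ext_d kN.
    by apply: Omega_cast (Omega_ext_d kN); lia.
  exact: ext_d_Pi_closed ku du.
- by move=> _ [_ [u ku <-] <-]; apply/boundaries_plus; exists u.
- by move=> a u v [ku _] [kv _]; exact: Pi_lin ku kv.
Qed.

Lemma Lneg_ext_d_cycle k A C : k <= n%:Z + r%:Z - 1 -> Omega M (k - 2 * r%:Z + 1) C ->
  ext_d A = Lpow r C -> Lneg r (ext_d A) = C.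
Proof. by move=> knr kC ->; rewrite (Lneg_Lpow r0 kC) //; lia. Qed.

Lemma induces_Lneg_d k l : l = k - 2 * r%:Z + 1 -> k <= n%:Z + r%:Z - 1 ->
  induces (FHplus M r.-1 k) (Hd M l) (fun A => Lneg r (ext_d A)).
Proof.
move=> -> knr; split; [exact: FHplus_wf|exact: Hd_wf| | |].
- move=> _ [u /(cycles_plus _ knr)[_ [C [kC du dC]]] <-].
  by rewrite (Lneg_ext_d_cycle knr kC du).
- move=> _ [_ /boundaries_plus[X kX ->] <-].
  have kdX : Omega M k (ext_d X) by apply: Omega_cast (Omega_ext_d kX); lia.
  have kN := OmegaN (Omega_Lneg r kdX).
  exists (- Lneg r (ext_d X)); first by apply: Omega_cast kN; lia.
  apply/esym/(Lneg_ext_d_cycle knr); first by apply: Omega_cast (Omega_ext_d kN); lia.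
  exact: ext_d_Pi_closed kdX (ext_d_ext_d kX).
- move=> a u v /(cycles_plus _ knr)[/(FOmegaP _ _ r0)[ku _] _].
  move=> /(cycles_plus _ knr)[/(FOmegaP _ _ r0)[kv _] _].
  by rewrite (ext_d_lin a ku kv) (Lneg_lin r a (Omega_ext_d ku) (Omega_ext_d kv)).
Qed.

(** The kernel of the projection is the image of [L^r], so [A - dX = L^r C]; [dC] has degree at most
    [n - r], where [L^r] is injective, so [C] is closed. This serves both at the start of the
    sequence and further on. *)
Lemma Pi_boundary_lift k A X : k <= n%:Z + r%:Z - 1 -> Omega M k A -> ext_d A = 0 ->
  Omega M (k - 1) X -> Pi r.-1 A = Pi r.-1 (ext_d X) ->
  exists C, [/\ Omega M (k - 2 * r%:Z) C, ext_d C = 0 & A - Lpow r C = ext_d X].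
Proof.
move=> knr kA dA kX PA.
have kdX : Omega M k (ext_d X) by apply: Omega_cast (Omega_ext_d kX); lia.
have kD := OmegaB kA kdX; have kN := Omega_Lneg r kD.
have E : A - ext_d X = Lpow r (Lneg r (A - ext_d X)).
  by rewrite {1}(Pi_Lneg r0 kD) (PiB _ kA kdX) PA subrr add0r.
exists (Lneg r (A - ext_d X)); split.
- by apply: Omega_cast kN; lia.
- apply: (Lpow_inj (q := r) (Omega_ext_d kN)); first by lia.
  by rewrite -(ext_d_Lpow r kN) -E (ext_dB kA kdX) dA (ext_d_ext_d kX) subrr.
- by rewrite -E subKr.
Qed.

Lemma exact_start : 2 * r%:Z - 1 <= n%:Z + r%:Z - 1 ->
  exact_at (zeroH (dform M)) (Hd M (2 * r%:Z - 1)) (FHplus M r.-1 (2 * r%:Z - 1))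
    (fun A => A) (Pi r.-1).
Proof.
move=> knr; apply: exact_atI; last 2 first.
- by move=> _ ->; apply/boundaries_plus; exists 0; [exact: Omega0|rewrite ext_d0].
- move=> A [kA dA] /boundaries_plus[X kX PA].
  have [C [kC dC E]] := Pi_boundary_lift knr kA dA kX PA.
  (* [C] has degree [-1]. *)
  have C0 : C = 0 by apply: Omega_eq0 kC; lia.
  exists 0 => //; rewrite subr0; exists X => //.
  by rewrite -E C0 Lpow0 subr0.
- split=> //; [exact: zeroH_wf|exact: Hd_wf| |].
    by move=> _ [_ -> <-]; split; [exact: Omega0|exact: ext_d0].
  by move=> _ [_ -> <-]; exists 0; [exact: Omega0|exact: ext_d0].
- exact: induces_Pi.
Qed.

Lemma exact_L_Pi k : k <= n%:Z + r%:Z - 1 ->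
  exact_at (Hd M (k - 2 * r%:Z)) (Hd M k) (FHplus M r.-1 k) (Lpow r) (Pi r.-1).
Proof.
move=> knr; apply: exact_atI.
- by apply: induces_L; lia.
- exact: induces_Pi.
- move=> C [kC dC]; rewrite (Pi_Lpow r0 kC); apply/boundaries_plus.
  by exists 0; [exact: Omega0|rewrite ext_d0 Pi0].
- move=> A [kA dA] /boundaries_plus[X kX PA].
  have [C [kC dC E]] := Pi_boundary_lift knr kA dA kX PA.
  by exists C => //; exists X.
Qed.

Lemma exact_Pi_d k : k <= n%:Z + r%:Z - 1 ->
  exact_at (Hd M k) (FHplus M r.-1 k) (Hd M (k - 2 * r%:Z + 1))
    (Pi r.-1) (fun A => Lneg r (ext_d A)).
Proof.
move=> knr; apply: exact_atI.
- exact: induces_Pi.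
- exact: induces_Lneg_d.
- move=> A [kA dA]; have kN := OmegaN (Omega_Lneg r kA).
  exists (- Lneg r A); first by apply: Omega_cast kN; lia.
  apply/esym/(Lneg_ext_d_cycle knr); first by apply: Omega_cast (Omega_ext_d kN); lia.
  exact: ext_d_Pi_closed kA dA.
- move=> A /(cycles_plus _ knr)[FA [C [kC dA dC]]].
  rewrite (Lneg_ext_d_cycle knr kC dA) => -[E kE dE].
  have kLE : Omega M k (Lpow r E) by apply: Omega_cast (Omega_Lpow r kE); lia.
  have [kA _] := (FOmegaP _ _ r0).1 FA.
  (* Here [dA = L^r dE], so the correction makes [A] closed, and the projection does not see it. *)
  exists (A - Lpow r E).
    split; first exact: OmegaB.
    by rewrite (ext_dB kA kLE) (ext_d_Lpow r kE) dA dE subrr.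
  rewrite (PiB _ kA kLE) (Pi_FOmega r0 FA) (Pi_Lpow r0 kE) subr0 subrr.
  by apply/boundaries_plus; exists 0; [exact: Omega0|rewrite ext_d0 Pi0].
Qed.

Lemma exact_d_L k : k <= n%:Z + r%:Z - 1 ->
  exact_at (FHplus M r.-1 k) (Hd M (k - 2 * r%:Z + 1)) (Hd M (k + 1))
    (fun A => Lneg r (ext_d A)) (Lpow r).
Proof.
move=> knr; apply: exact_atI.
- exact: induces_Lneg_d.
- by apply: induces_L; lia.
- move=> A /(cycles_plus _ knr)[/(FOmegaP _ _ r0)[kA _] [C [kC dA dC]]].
  rewrite (Lneg_ext_d_cycle knr kC dA) -dA; exists A => //.
  by apply: Omega_cast kA; lia.
- move=> C [kC dC] [A kA' dA].
  have kA : Omega M k A by apply: Omega_cast kA'; lia.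
  have kN := Omega_Lneg r kA.
  have kdN : Omega M (k - 2 * r%:Z + 1) (ext_d (Lneg r A)).
    by apply: Omega_cast (Omega_ext_d kN); lia.
  have dP : ext_d (Pi r.-1 A) = Lpow r (C - ext_d (Lneg r A)).
    by rewrite (ext_d_Pi kA) dA LpowB.
  have kCN := OmegaB kC kdN.
  (* Projecting the primitive [A] of [L^r C] into the filtration changes [C] only by the exact form
     [d L^(-r) A]. *)
  exists (Pi r.-1 A).
    apply/(cycles_plus _ knr); split; first by exists A.
    exists (C - ext_d (Lneg r A)); split=> //.
    by rewrite (ext_dB kC kdN) dC (ext_d_ext_d kN) subrr.
  rewrite (Lneg_ext_d_cycle knr kCN dP) subKr.
  by exists (Lneg r A) => //; apply: Omega_cast kN; lia.
Qed.

Definition connecting A : dform M := Pi r.-1 (reflect_r (ext_d (Lneg r A))).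

(** * The segments through [FHminus] *)

Section UpperHalf.
Context (m : int) (mnr : n%:Z - r%:Z + 1 <= m).
(** The segment is indexed by the degree [m] in which the reflection lands; [mnr] amounts to
    [k >= n + r], where [L^r] is surjective. *)
Let k : int := m + 2 * r%:Z - 1.

Lemma Lpow_Lneg_high A : Omega M k A -> Lpow r (Lneg r A) = A.
Proof.
by move=> kA; rewrite [RHS](Pi_Lneg r0 kA) (Pi_high r0 kA) ?add0r // /k; lia.
Qed.

Lemma Omega_Lneg_high A : Omega M k A -> Omega M (m - 1) (Lneg r A).
Proof. by move=> kA; apply: Omega_cast (Omega_Lneg r kA); rewrite /k; lia. Qed.

Lemma Omega_ext_d_m A : Omega M (m - 1) A -> Omega M m (ext_d A).
Proof. by move=> kA; apply: Omega_cast (Omega_ext_d kA); lia. Qed.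

Lemma Omega_reflect_m A : Omega M m A -> Omega M (2 * n%:Z - m) (reflect_r A).
Proof. by move=> kA; apply: Omega_cast (Omega_reflect kA); lia. Qed.

Lemma Omega_reflect_m' A : Omega M (2 * n%:Z - m) A -> Omega M m (reflect_r A).
Proof. by move=> kA; apply: Omega_cast (Omega_reflect kA); lia. Qed.

Lemma ext_d_Lneg_kernel A : Omega M k A -> ext_d A = 0 -> Lpow r (ext_d (Lneg r A)) = 0.
Proof.
by move=> kA dA; rewrite -(ext_d_Lpow r (Omega_Lneg_high kA)) (Lpow_Lneg_high kA).
Qed.

(** [L^r d L^(-r) A = dA = 0], so the reflected form already lies in the filtration and the
    projection fixes it. *)
Lemma connecting_closed A : Omega M k A -> ext_d A = 0 ->
  connecting A = reflect_r (ext_d (Lneg r A)).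
Proof.
move=> kA dA; have kd := Omega_ext_d_m (Omega_Lneg_high kA).
apply: (Pi_FOmega r0 (k := 2 * n%:Z - m)); apply/(FOmega_reflectP _ _ r0).
split; first exact: Omega_reflect_m.
by rewrite (reflectK kd) ext_d_Lneg_kernel.
Qed.

Lemma reflect_connecting A : Omega M k A -> ext_d A = 0 ->
  reflect_r (connecting A) = ext_d (Lneg r A).
Proof.
move=> kA dA; rewrite (connecting_closed kA dA).
exact: reflectK (Omega_ext_d_m (Omega_Lneg_high kA)).
Qed.

Lemma Omega_connecting A : Omega M k A -> ext_d A = 0 -> Omega M (2 * n%:Z - m) (connecting A).
Proof.
move=> kA dA; rewrite (connecting_closed kA dA).
exact/Omega_reflect_m/Omega_ext_d_m/Omega_Lneg_high.
Qed.

Lemma induces_connecting : induces (Hd M k) (FHminus M r.-1 (2 * n%:Z - m)) connecting.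
Proof.
split; [exact: Hd_wf|exact: FHminus_wf| | |].
- move=> _ [A [kA dA] <-]; apply/cycles_minus; rewrite (reflect_connecting kA dA); split.
  + exact: Omega_connecting.
  + exact: ext_d_Lneg_kernel.
  + exact: ext_d_ext_d (Omega_Lneg_high kA).
- move=> _ [_ [X kX <-] <-].
  have kdX : Omega M k (ext_d X) by apply: Omega_cast (Omega_ext_d kX); lia.
  have ddX := ext_d_ext_d kX.
  apply/(boundaries_minus _ mnr); split; first exact: Omega_connecting.
  exists (Lneg r (ext_d X)), X; split.
  + exact: Omega_Lneg_high.
  + by apply: Omega_cast kX; rewrite /k; lia.
  + exact: Lpow_Lneg_high.
  + exact: reflect_connecting.
- move=> a u v [ku du] [kv dv].
  have kNu := Omega_Lneg_high ku; have kNv := Omega_Lneg_high kv.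
  have kdu := Omega_ext_d_m kNu; have kdv := Omega_ext_d_m kNv.
  rewrite /connecting (Lneg_lin r a ku kv) (ext_d_lin a kNu kNv) (reflect_lin a kdu kdv).
  exact: Pi_lin (Omega_reflect_m kdu) (Omega_reflect_m kdv).
Qed.

Lemma induces_reflect : induces (FHminus M r.-1 (2 * n%:Z - m)) (Hd M m) (@reflect_r R n M).
Proof.
split; [exact: FHminus_wf|exact: Hd_wf| | |].
- by move=> _ [A /cycles_minus[kA _ dA] <-]; split; first exact: Omega_reflect_m'.
- move=> _ [A /(boundaries_minus _ mnr)[kA [Y [X [kY _ _ RA]]]] <-].
  by rewrite RA; exists Y.
- by move=> a u v /cycles_minus[ku _ _] /cycles_minus[kv _ _]; exact: reflect_lin ku kv.
Qed.

(** The case [X = 0], applied to the difference [Y] of two preimages of one form under [L^r]. *)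
Lemma Lpow_kernel_boundary A Y : Omega M (2 * n%:Z - m) A -> Omega M (m - 1) Y ->
  Lpow r Y = 0 -> reflect_r A = ext_d Y -> boundaries (FHminus M r.-1 (2 * n%:Z - m)) A.
Proof.
move=> kA kY LY RA; apply/(boundaries_minus _ mnr); split=> //.
by exists Y, 0; split=> //; [exact: Omega0|rewrite LY ext_d0].
Qed.

Lemma exact_L_connecting : exact_at (Hd M (m - 1)) (Hd M k) (FHminus M r.-1 (2 * n%:Z - m))
  (Lpow r) connecting.
Proof.
apply: exact_atI.
- by apply: induces_L; rewrite /k; lia.
- exact: induces_connecting.
- move=> C [kC dC].
  have kLC : Omega M k (Lpow r C) by apply: Omega_cast (Omega_Lpow r kC); rewrite /k; lia.
  have dLC : ext_d (Lpow r C) = 0 by rewrite (ext_d_Lpow r kC) dC Lpow0.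
  have kN := Omega_Lneg_high kLC.
  apply: (@Lpow_kernel_boundary _ (Lneg r (Lpow r C) - C)).
  + exact: Omega_connecting.
  + exact: OmegaB.
  + by rewrite LpowB (Lpow_Lneg_high kLC) subrr.
  + by rewrite (reflect_connecting kLC dLC) (ext_dB kN kC) dC subr0.
- move=> A [kA dA] /(boundaries_minus _ mnr)[_ [Y [X [kY kX LY]]]].
  rewrite (reflect_connecting kA dA) => dE; have kN := Omega_Lneg_high kA.
  (* Both terms have the same differential, and [L^r] sends their difference to [A - dX]. *)
  exists (Lneg r A - Y).
    by split; [exact: OmegaB|rewrite (ext_dB kN kY) dE subrr].
  rewrite LpowB (Lpow_Lneg_high kA) subKr LY.
  by exists X; [apply: Omega_cast kX; rewrite /k; lia|].
Qed.

Lemma exact_connecting_reflect : exact_at (Hd M k) (FHminus M r.-1 (2 * n%:Z - m)) (Hd M m)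
  connecting (@reflect_r R n M).
Proof.
apply: exact_atI.
- exact: induces_connecting.
- exact: induces_reflect.
- move=> A [kA dA]; rewrite (reflect_connecting kA dA).
  by exists (Lneg r A) => //; exact: Omega_Lneg_high.
- move=> A /cycles_minus[kA LA dA] [E kE RA].
  have kLE : Omega M k (Lpow r E) by apply: Omega_cast (Omega_Lpow r kE); rewrite /k; lia.
  have dLE : ext_d (Lpow r E) = 0 by rewrite (ext_d_Lpow r kE) RA LA.
  have kN := Omega_Lneg_high kLE; have kf := Omega_connecting kLE dLE.
  exists (Lpow r E) => //; apply: (@Lpow_kernel_boundary _ (E - Lneg r (Lpow r E))).
  + exact: OmegaB.
  + exact: OmegaB.
  + by rewrite LpowB (Lpow_Lneg_high kLE) subrr.
  + have -> : A - connecting (Lpow r E) = -1 *: connecting (Lpow r E) + A.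
      by rewrite scaleN1r addrC.
    rewrite (reflect_lin (-1) kf kA) (reflect_connecting kLE dLE) (ext_dB kE kN) RA.
    by rewrite scaleN1r addrC.
Qed.

(** Subtracting [dE] moves [C] into the kernel of [L^r] within its class, where reflection turns it
    into a cycle. The end of the sequence is the case [E = 0]. *)
Lemma kernel_cycle C E : Omega M m C -> ext_d C = 0 -> Omega M (m - 1) E ->
  Lpow r C = Lpow r (ext_d E) ->
  exists2 A, cycles (FHminus M r.-1 (2 * n%:Z - m)) A &
    boundaries (Hd M m) (C - reflect_r A).
Proof.
move=> kC dC kE LC; have kdE := Omega_ext_d_m kE; have kCE := OmegaB kC kdE.
exists (reflect_r (C - ext_d E)).
  apply/cycles_minus; rewrite (reflectK kCE); split.
  - exact: Omega_reflect_m.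
  - by rewrite LpowB LC subrr.
  - by rewrite (ext_dB kC kdE) dC (ext_d_ext_d kE) subrr.
by rewrite (reflectK kCE) subKr; exists E.
Qed.

Lemma exact_reflect_L : exact_at (FHminus M r.-1 (2 * n%:Z - m)) (Hd M m) (Hd M (k + 1))
  (@reflect_r R n M) (Lpow r).
Proof.
apply: exact_atI.
- exact: induces_reflect.
- by apply: induces_L; rewrite /k; lia.
- move=> A /cycles_minus[_ -> _]; exists 0; [exact: Omega0|exact: ext_d0].
- move=> C [kC dC] [A kA' dA].
  have kA : Omega M k A by apply: Omega_cast kA'; lia.
  apply: (kernel_cycle kC dC (Omega_Lneg_high kA)).
  by rewrite -(ext_d_Lpow r (Omega_Lneg_high kA)) (Lpow_Lneg_high kA).
Qed.

Lemma exact_end : 2 * n%:Z < m + 2 * r%:Z ->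
  exact_at (FHminus M r.-1 (2 * n%:Z - m)) (Hd M m) (zeroH (dform M))
    (@reflect_r R n M) (fun=> 0).
Proof.
move=> m2n; apply: exact_atI.
- exact: induces_reflect.
- split; [exact: Hd_wf|exact: zeroH_wf|by move=> _ [? _ <-]|by move=> _ [? _ <-]|].
  by move=> *; rewrite scaler0 addr0.
- by [].
- move=> C [kC dC] _; apply: (kernel_cycle kC dC (Omega0 _)).
  (* [L^r C] has degree [m + 2r > 2n], so it vanishes. *)
  by rewrite ext_d0 Lpow0; apply: Omega_dim (Omega_Lpow r kC); lia.
Qed.

End UpperHalf.

End FilteredCohomology.

Theorem theorem4p2 (R : realType) (n r : nat) (M : symplecticManifold R n)
    (hr : (1 <= r <= n)%N) :
  [/\ (* 0 -> H_d^{2r-1} -> F^{r-1}H_+^{2r-1} *)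
      exact_at (zeroH (dform M)) (Hd M (2 * r%:Z - 1))
               (FHplus M r.-1 (2 * r%:Z - 1))
               (fun A => A) (Pi r.-1),
      (* the segments through F^{r-1}H_+^k *)
      forall k : int, 2 * r%:Z - 1 <= k <= n%:Z + r%:Z - 1 ->
        [/\ exact_at (Hd M (k - 2 * r%:Z)) (Hd M k) (FHplus M r.-1 k)
                     (Lpow r) (Pi r.-1),
            exact_at (Hd M k) (FHplus M r.-1 k) (Hd M (k - 2 * r%:Z + 1))
                     (Pi r.-1) (fun A => Lneg r (ext_d A))
          & exact_at (FHplus M r.-1 k) (Hd M (k - 2 * r%:Z + 1)) (Hd M (k + 1))
                     (fun A => Lneg r (ext_d A)) (Lpow r)],
      (* the segments through F^{r-1}H_-^{2n+2r-1-k} *)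
      forall k : int, n%:Z + r%:Z <= k <= 2 * n%:Z ->
        [/\ exact_at (Hd M (k - 2 * r%:Z)) (Hd M k)
                     (FHminus M r.-1 (2 * n%:Z + 2 * r%:Z - 1 - k))
                     (Lpow r)
                     (fun A => Pi r.-1 (reflect_r (ext_d (Lneg r A)))),
            exact_at (Hd M k) (FHminus M r.-1 (2 * n%:Z + 2 * r%:Z - 1 - k))
                     (Hd M (k - 2 * r%:Z + 1))
                     (fun A => Pi r.-1 (reflect_r (ext_d (Lneg r A))))
                     (@reflect_r R n M)
          & k < 2 * n%:Z ->
            exact_at (FHminus M r.-1 (2 * n%:Z + 2 * r%:Z - 1 - k))
                     (Hd M (k - 2 * r%:Z + 1)) (Hd M (k + 1))
                     (@reflect_r R n M) (Lpow r)]
    & (* F^{r-1}H_-^{2r-1} -> H_d^{2n-2r+1} -> 0 *)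
      exact_at (FHminus M r.-1 (2 * r%:Z - 1))
               (Hd M (2 * n%:Z - 2 * r%:Z + 1)) (zeroH (dform M))
               (@reflect_r R n M) (fun=> 0)].
Proof.
split.
- by apply: exact_start => //; lia.
- move=> k /andP[_ knr]; split.
  + exact: exact_L_Pi.
  + exact: exact_Pi_d.
  + exact: exact_d_L.
- move=> k /andP[nrk _].
  have mnr : n%:Z - r%:Z + 1 <= k - 2 * r%:Z + 1 by lia.
  have -> : 2 * n%:Z + 2 * r%:Z - 1 - k = 2 * n%:Z - (k - 2 * r%:Z + 1) by lia.
  have kE : k = k - 2 * r%:Z + 1 + 2 * r%:Z - 1 by lia.
  split=> [||_].
  + have := @exact_L_connecting R n M r hr _ mnr.
    by rewrite -kE addrK.
  + by have := @exact_connecting_reflect R n M r hr _ mnr; rewrite -kE.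
  + by have := @exact_reflect_L R n M r hr _ mnr; rewrite -kE.
- have -> : 2 * r%:Z - 1 = 2 * n%:Z - (2 * n%:Z - 2 * r%:Z + 1) by lia.
  by apply: exact_end => //; lia.
Qed.
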